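(* Let $f := (P/Q)e^T$, where $P, Q, T$ are complex polynomials with $\gcd(P,Q)=1$, $P\not\equiv 0$, $q:=\deg Q\ge 2$ and $t:=\deg T\ge 1$, and put $p:=\deg P$. Assume that $Q$ is monic and that all of its zeros $z_1,\dots,z_q$ are distinct. Let $d_t$ be the leading coefficient of $T$, let $S=\{z_1,\dots,z_q\}$, and for $n\ge 1$ let $\mu_n$ be the zero-counting measure of $f^{(n)}$ and $\mathcal{L}_{\mu_n}(z)=\int_{\mathbb{C}}\log|z-\zeta|\,\mathrm{d}\mu_n(\zeta)$ its logarithmic potential. Then: (i) The measures $\mu_n$ converge, in the sense of distributions on $\mathbb{C}$, as $n\to\infty$ to a measure $\mu_S$ with total mass $(q-1)/(q-1+t)$. (ii) The logarithmic potentials $\mathcal{L}_{\mu_n}(z)$ diverge as $n\to\infty$, in the sense that $\lim_{n\to\infty}\mathcal{L}_{\mu_n}(z)=\infty$ for every $z\notin S$ lying in the interior of one of the Voronoi cells of $S$. (iii) The shifted logarithmic potentials $$\widetilde{\mathcal{L}}_{\mu_n}(z) := \mathcal{L}_{\mu_n}(z) - \frac{\log n!}{n(q+t-1)+p}$$ converge in $L^1_{loc}(\mathbb{C})$ as $n\to\infty$ to $$\Psi(z) = \frac{1}{q+t-1}\left(\max_{i=1,\dots,q}\left\{\log|z-z_i|^{-1}\right\} + \log|Q(z)| - \log\left(|d_t|\,t\right)\right).$$ (iv) The measure $\mu_S$ is given by $\frac{1}{2\pi}\Delta\Psi$ (Laplacian in the sense of distributions).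
   Context: The zero-counting measure of a polynomial of degree $d\ge1$ is the probability measure assigning mass $1/d$ to each zero, accounting for multiplicity. One has $f^{(n)}=\frac{P_n}{Q^{n+1}}e^T$ with $P_n$ a polynomial relatively prime to $Q$, where $P_0=P$ and $P_n=(QT'-nQ')P_{n-1}+QP_{n-1}'$ for $n\ge1$; $\deg P_n=n(q+t-1)+p$. The zeros of $f^{(n)}$ are the zeros of $P_n$, and the zero-counting measure of $f^{(n)}$ means the zero-counting measure of $P_n$. The Voronoi cell of $z_i\in S$ is $V_i=\{z\in\mathbb{C}: |z-z_i|=\min_{j}|z-z_j|\}$. The function $\Psi$ is understood at the points $z_i$ by continuous extension. *)

(* Defs.v *)
From HB Require Import structures.
From mathcomp Require Import all_boot all_order all_algebra complex ring lra.
From mathcomp Require Import all_classical all_reals all_analysis.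

Set Implicit Arguments.
Unset Strict Implicit.
Unset Printing Implicit Defensive.

Import Order.TTheory GRing.Theory Num.Theory ComplexField.
Import numFieldNormedType.Exports.

Local Open Scope classical_set_scope.
Local Open Scope complex_scope.
Local Open Scope ring_scope.

(* Topology, smoothness and measure theory on the complex plane are those of
   R * R (product topology, product Borel sigma-algebra); algebra takes place
   in R[i], and toC / ofC identify the two. *)
Definition plane (R : realType) := (measurableTypeR R * measurableTypeR R)%type.

Definition toC (R : realType) (z : R * R) : R[i] := z.1 +i* z.2.

Definition ofC (R : realType) (c : R[i]) : R * R :=
  (complex.Re c, complex.Im c).

(* The real-valued modulus: `|c| is R[i]-valued. *)
Definition cabs (R : realType) (c : R[i]) : R := Normc.normc c.

Definition leb2 (R : realType) : {measure set (plane R) -> \bar R} :=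
  (@lebesgue_measure R \x @lebesgue_measure R)%E.

Definition deg (R : realType) (p : {poly R[i]}) : nat := (size p).-1.

(* The zeros of p listed with multiplicity (meaningful for p != 0). *)
Definition zeros (R : realType) (p : {poly R[i]}) : seq R[i] :=
  sval (closed_field_poly_normal p).

Definition zero_counting_measure (R : realType) (p : {poly R[i]}) :
    {measure set (plane R) -> \bar R} :=
  mscale (((deg p)%:R : R)^-1)%:nng
    (msum (fun i => \d_(ofC (zeros p)`_i : plane R)) (size (zeros p))).

Definition cexp (R : realType) (z : R[i]) : R[i] :=
  (expR (complex.Re z))%:C * (cos (complex.Im z) +i* sin (complex.Im z)).

Definition mero_exp (R : realType) (P Q T : {poly R[i]}) (z : R[i]) : R[i] :=
  P.[z] / Q.[z] * cexp T.[z].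

(* The zeros of the n-th derivative of mero_exp P Q T are by convention those
   of deriv_num P Q T n; see derive1n_mero_exp below. *)
Fixpoint deriv_num (R : realType) (P Q T : {poly R[i]}) (n : nat) :
    {poly R[i]} :=
  if n is m.+1 then
    (Q * T^`() - n%:R *: Q^`()) * deriv_num P Q T m
    + Q * (deriv_num P Q T m)^`()
  else P.

(* lne is the extended logarithm, so the potential is -oo at an atom of mu. *)
Definition log_potential (R : realType) (mu : {measure set (plane R) -> \bar R})
    (z : R * R) : \bar R :=
  (\int[mu]_w lne (cabs (toC z - toC w))%:E)%E.

(* Maximum and minimum of a nonempty finite family. *)
Definition max_seq (R : realType) (s : seq R) : R :=
  \big[Num.max/head 0 s]_(x <- s) x.

Definition min_seq (R : realType) (s : seq R) : R :=
  \big[Num.min/head 0 s]_(x <- s) x.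

Definition voronoi_cell (R : realType) (S : seq R[i]) (a : R[i]) :
    set (R * R) :=
  [set z | cabs (toC z - a) = min_seq [seq cabs (toC z - b) | b <- S]].

Definition Psi_formula (R : realType) (Q T : {poly R[i]}) (z : R * R) : R :=
  ((deg Q + deg T - 1)%N%:R)^-1 *
  (max_seq [seq ln (cabs (toC z - a))^-1 | a <- zeros Q]
   + ln (cabs Q.[toC z])
   - ln (cabs (lead_coef T) * (deg T)%:R)).

(* The formula degenerates to a difference of infinities at the zeros of Q,
   where its continuous extension is taken. *)
Definition Psi (R : realType) (Q T : {poly R[i]}) (z : R * R) : R :=
  if toC z \in zeros Q then lim (Psi_formula Q T w @[w --> z^'])
  else Psi_formula Q T z.

Definition L1loc (R : realType) (u : R * R -> \bar R) : Prop :=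
  forall K : set (R * R), compact K -> (@leb2 R).-integrable K u.

Definition cvg_L1loc (R : realType) (u : nat -> R * R -> \bar R)
    (l : R * R -> \bar R) : Prop :=
  [/\ forall n, L1loc (u n), L1loc l &
      forall K : set (R * R), compact K ->
        ((\int[@leb2 R]_(z in K) `|u n z - l z|)%E @[n --> \oo] --> 0%E)].

(* All iterated directional derivatives of order <= k exist and are
   continuous. *)
Fixpoint Ck (R : realType) (k : nat) (phi : R * R -> R) : Prop :=
  if k is j.+1 then
    (forall z v, derivable phi z v) /\ (forall v, Ck j (fun z => 'D_v phi z))
  else continuous phi.

Definition test_function (R : realType) (phi : R * R -> R) : Prop :=
  (forall k, Ck k phi) /\ compact (closure [set z | phi z != 0]).

Definition laplacian (R : realType) (phi : R * R -> R) (z : R * R) : R :=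
  'D_(1, 0) (fun w => 'D_(1, 0) phi w) z + 'D_(0, 1) (fun w => 'D_(0, 1) phi w) z.

(* Distributions are handled through their values on (real) test functions. *)
Definition distr_of_measure (R : realType)
    (mu : {measure set (plane R) -> \bar R}) (phi : R * R -> R) : \bar R :=
  (\int[mu]_z (phi z)%:E)%E.

Definition distr_of_fun (R : realType) (g : R * R -> R) (phi : R * R -> R) :
    \bar R :=
  (\int[@leb2 R]_z (g z * phi z)%:E)%E.

Definition distr_laplacian (R : realType) (u : (R * R -> R) -> \bar R)
    (phi : R * R -> R) : \bar R :=
  u (laplacian phi).

Lemma cexpD (R : realType) (z w : R[i]) : cexp (z + w) = cexp z * cexp w.
Proof.
case: z w => [a b] [c d]; rewrite /cexp /=.
rewrite expRD cosD sinD.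
apply/eqP; rewrite eq_complex /=; apply/andP; split; apply/eqP; ring.
Qed.

Lemma real_taylor1 (R : realType) (g : R -> R) (d : R) :
  is_derive (0 : R) 1 g d -> forall e : R, 0 < e ->
  exists2 r, 0 < r & forall a, `|a| < r -> `|g a - g 0 - d * a| <= e * `|a|.
Proof.
move=> [dg gd] e e0.
have : h^-1 *: (g (h *: 1 + 0) - g 0) @[h --> (0:R)^'] --> d.
  by rewrite -gd; exact: dg.
move/cvgrPdist_le => /(_ e e0) /nbhs_ballP [r /= r0 H].
exists r => // a ar.
have [->|a0] := eqVneq a 0; first by rewrite subrr mulr0 subr0 normr0 mulr0.
have : ball (0:R) r a by rewrite /ball /= sub0r normrN.
move=> /H /(_ a0).
rewrite /GRing.scale /= mulr1 addr0 => K.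
have -> : g a - g 0 - d * a = - (d - a^-1 * (g a - g 0)) * a by field.
by rewrite normrM normrN ler_wpM2r.
Qed.

Lemma normC_le (R : realType) (a b : R) :
  `|(a +i* b : R[i])| <= (`|a| + `|b|)%:C.
Proof.
rewrite normc_def lecR /= -(ger0_norm (addr_ge0 (normr_ge0 a) (normr_ge0 b))).
rewrite -sqrtr_sqr ler_wsqrtr // sqrrD !real_normK ?num_real //.
by rewrite lerD2r lerDl pmulrn_lge0 // mulr_ge0.
Qed.

Lemma cexp_near0 (R : realType) (e : R) : 0 < e ->
  exists2 r : R, 0 < r & forall h : R[i], `|h| < r%:C ->
    `|cexp h - 1 - h| <= e%:C * `|h|.
Proof.
move=> e0.
have [u [u0 u1 ue]] : exists u : R, [/\ 0 < u, u <= 1 & u <= e / 8].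
  exists (Num.min 1 (e / 8)); split; last 2 first.
  - by rewrite ge_min lexx.
  - by rewrite ge_min lexx orbT.
  - by rewrite lt_min ltr01 divr_gt0.
have [r1 r10 H1] := real_taylor1 (is_derive_expR (0:R)) u0.
have [r2 r20 H2] := real_taylor1 (is_derive_cos (0:R)) u0.
have [r3 r30 H3] := real_taylor1 (is_derive_sin (0:R)) u0.
exists (Num.min u (Num.min r1 (Num.min r2 r3))).
  by rewrite !lt_min u0 r10 r20 r30.
case=> a b hr.
move: hr; rewrite normc_def /= ltcR; set N := Num.sqrt _.
rewrite !lt_min => /and4P[Nu N1 N2 N3].
have aN : `|a| <= N by rewrite -sqrtr_sqr ler_wsqrtr // lerDl sqr_ge0.
have bN : `|b| <= N by rewrite -sqrtr_sqr ler_wsqrtr // lerDr sqr_ge0.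
have {}H1 := H1 a (le_lt_trans aN N1).
have {}H2 := H2 b (le_lt_trans bN N2).
have {}H3 := H3 b (le_lt_trans bN N3).
move: H1 H2 H3; rewrite expR0 cos0 sin0 oppr0 mul0r !mul1r !(subr0, addr0) => H1 H2 H3.
have -> : cexp (a +i* b) - 1 - (a +i* b) =
  (expR a * cos b - 1 - a) +i* (expR a * sin b - b) :> R[i].
  by apply/eqP; rewrite eq_complex /=; apply/andP; split; apply/eqP; ring.
apply: (le_trans (normC_le _ _)); rewrite -rmorphM lecR.
have N0 : 0 <= N by rewrite sqrtr_ge0.
have [ua ub] : u * `|a| <= u * N /\ u * `|b| <= u * N.
  by split; rewrite ler_pM2l.
have uN : u * N <= N by rewrite ler_piMl.
have NN : N * N <= u * N by rewrite ler_wpM2r // ltW.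
have ueN : u * N <= e / 8 * N by rewrite ler_wpM2r.
have E1 : `|expR a - 1| <= 2 * N.
  have -> : expR a - 1 = (expR a - 1 - a) + a by ring.
  apply: le_trans (ler_normD _ _) _.
  by lra.
have E2 : `|sin b| <= 2 * N.
  have -> : sin b = (sin b - b) + b by ring.
  apply: le_trans (ler_normD _ _) _.
  by lra.
have C1 : `|cos b| <= 1 by rewrite ler_norml cos_geN1 cos_le1.
have A1 : `|1 + a| <= 2.
  apply: le_trans (ler_normD _ _) _; rewrite normr1; lra.
have -> : expR a * cos b - 1 - a =
  (expR a - 1 - a) * cos b + (1 + a) * (cos b - 1) by ring.
have -> : expR a * sin b - b = (expR a - 1) * sin b + (sin b - b) by ring.
have X1 : `|(expR a - 1 - a) * cos b| <= u * N.
  rewrite normrM; apply: (@le_trans _ _ (`|expR a - 1 - a| * 1)).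
    exact: ler_wpM2l.
  by lra.
have X2 : `|(1 + a) * (cos b - 1)| <= 2 * (u * N).
  rewrite normrM; apply: ler_pM => //.
  by lra.
have X3 : `|(expR a - 1) * sin b| <= 4 * (u * N).
  rewrite normrM; apply: (@le_trans _ _ ((2 * N) * (2 * N))).
    exact: ler_pM.
  lra.
have X4 : `|sin b - b| <= u * N by lra.
apply: (@le_trans _ _ (8 * (u * N))); last by lra.
have := ler_normD ((expR a - 1 - a) * cos b) ((1 + a) * (cos b - 1)).
have := ler_normD ((expR a - 1) * sin b) (sin b - b).
lra.
Qed.

Lemma is_derive1_compF (K : numFieldType) (f g : K -> K) (x a b : K) :
  is_derive (g x) 1 f a -> is_derive x 1 g b -> is_derive x 1 (f \o g) (a * b).
Proof.
move=> [/derivable1_diffP df <-] [/derivable1_diffP dg <-].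
have dfg := differentiable_comp dg df.
apply: DeriveDef; first exact/derivable1_diffP.
rewrite (deriveE _ dfg) (diff_comp dg df) /= -(deriveE _ dg).
rewrite -[X in 'd _ _ X]mulr1 [LHS]linearZ /= -(deriveE _ df).
by rewrite /GRing.scale /= mulrC.
Qed.

Section complex_derivatives.
Variable R : realType.
(* Complex differentiation: R[i] as a normed module over itself. *)
Let K : numFieldType := R[i].

Lemma is_derive_cexp (x : K) : is_derive x 1 (@cexp R : K -> K) (cexp x).
Proof.
have H : (h^-1 *: ((@cexp R : K -> K) (h *: 1 + x) - cexp x)) @[h --> (0:K)^'] --> (cexp x : K).
  have L : ((cexp h - 1) / h : K) @[h --> (0:K)^'] --> (1 : K).
    apply/cvgrPdist_le => /= e e0.
    have [eR e'] : complex.Im e = 0 /\ 0 < complex.Re e.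
      by move: e0; rewrite ltcE /= => /andP[/eqP].
    have eE : e = (complex.Re e)%:C by case: e {e0} eR e' => ? ? /= ->.
    have [r r0 Hr] := cexp_near0 e'.
    apply/nbhs_ballP; exists (r%:C : K); first by rewrite /= ltcR.
    move=> h /=; rewrite /ball /= sub0r normrN => hr h0.
    have -> : 1 - (cexp h - 1) / h = - (cexp h - 1 - h) / h :> K by field.
    rewrite normrM normrN normfV ler_pdivrMr ?normr_gt0 // eE; exact: Hr.
  have -> : (fun h : K => h^-1 *: ((@cexp R : K -> K) (h *: 1 + x) - cexp x)) =
      (fun h : K => (cexp x : K) * ((cexp h - 1) / h)).
    apply/funext => h; rewrite /GRing.scale /= mulr1 cexpD; ring.
  rewrite -[X in _ --> X]mulr1; exact: (@cvgMl_tmp K _ _ _ _ (cexp x : K) _ L).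
apply: DeriveDef; first by apply/cvg_ex; eexists; exact: H.
exact: cvg_lim H.
Qed.

Lemma is_derive_hornerC (p : {poly K}) (x : K) :
  is_derive x 1 (horner p : K -> K) (p^`()).[x].
Proof.
elim/poly_ind: p => [|p c IH].
  rewrite deriv0 horner0; have -> : horner 0 = cst 0 :> (K -> K).
    by apply/funext => y; rewrite horner0.
  exact: is_derive_cst.
have -> : horner (p * 'X + c%:P) = (horner p : K -> K) * id + cst c :> (K -> K).
  by apply/funext => y; rewrite !hornerE.
apply: (is_derive_eq (is_deriveD (is_deriveM IH (is_derive_id _ _)) (is_derive_cst _ _ _))).
by rewrite derivD derivM derivX derivC !hornerE /GRing.scale /=; ring.
Qed.

Lemma is_derive_cexp_horner (T : {poly K}) (x : K) :
  is_derive x 1 (fun z : K => cexp T.[z] : K) (T^`().[x] * cexp T.[x]).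
Proof.
rewrite mulrC.
exact: (is_derive1_compF (is_derive_cexp _) (is_derive_hornerC T x)).
Qed.

(* deriv_num P Q T n is the numerator of the n-th complex derivative of
   (P / Q) e^T. *)
Lemma derive1n_mero_exp (P Q T : {poly K}) (n : nat) (z : K) : Q.[z] != 0 ->
  derive1n n (mero_exp P Q T : K -> K) z =
  (deriv_num P Q T n).[z] / Q.[z] ^+ n.+1 * cexp T.[z].
Proof.
elim: n z => [|n IH] z Qz; first by rewrite expr1.
rewrite derive1nS derive1E.
set N := deriv_num P Q T n in IH *.
have nQ : \forall w \near z, Q.[w : K] != 0.
  have [dQ _] := is_derive_hornerC Q z.
  have cQ : {for z, continuous (horner Q : K -> K)}.
    by apply: differentiable_continuous; apply/derivable1_diffP.
  exact: (cvgr_neq0 _ cQ Qz).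
pose g (w : K) : K := N.[w] * (Q.[w] ^+ n.+1)^-1 * cexp T.[w].
rewrite (@near_eq_derive _ _ _ _ g); last by near=> w; rewrite IH //; near: w.
have dQn := is_deriveX n.+1 (is_derive_hornerC Q z).
have Qn0 : ((horner Q : K -> K) ^+ n.+1) z != 0 by rewrite exprfctE expf_neq0.
have dV : is_derive z 1 (fun y : K => (((horner Q : K -> K) ^+ n.+1) y)^-1)
  (- (((horner Q : K -> K) ^+ n.+1) z) ^- 2 *: ((n.+1%:R * Q.[z] ^+ n) *: Q^`().[z])).
  case: dQn => d1 d2; apply: DeriveDef; first exact: derivableV.
  by rewrite deriveV // d2.
have := is_deriveM (is_deriveM (is_derive_hornerC N z) dV) (is_derive_cexp_horner T z).
have -> : ((horner N : K -> K) * (fun y : K => (((horner Q : K -> K) ^+ n.+1) y)^-1)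
  * (fun y : K => cexp T.[y] : K)) = g.
  by apply/funext => w; rewrite /g /= exprfctE.
case=> _ ->.
rewrite /= -/N mulrfctE /= !exprfctE !(hornerD, hornerM, hornerN, hornerZ).
rewrite /GRing.scale /= !exprS expr0 mulr1.
have : Q.[z] ^+ n != 0 by rewrite expf_neq0.
move: (cexp T.[z]) (Q.[z] ^+ n) Qz => E qn Qz qn0.
field; exact/andP.
Unshelve. all: by end_near. Qed.
End complex_derivatives.

(* Main.v *)
(* Write P_n for the numerator of the n-th derivative.

   Pointwise asymptotics. By partial fractions, P_n(z) / (n! Q(z)^(n+1)) is a
   sum over the poles a of residue(a) S_n(a) / (z - a)^(n+1), up to a
   superexponentially small term, where S_n(a) is a partial sum of the Taylor
   series of exp(T(a) - T(z)) and is therefore bounded and bounded away from 0.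
   The nearest pole dominates, which gives the limit of the shifted potentials
   off the bisectors; log n! / n -> oo then gives (ii).

   L1 convergence. On a square, a mean of the kernels ln |z - a|, normalized by
   ln |a| for the far points a, is bounded in L2. Hence the shifted potentials
   are constants plus an L2-bounded sequence; almost everywhere convergence
   bounds the constants and upgrades to convergence in L1.

   The limit measure. The singular part m of Psi is the minimum of the functions
   ln |z - a|. Approximating it by smooth functions and integrating by parts,
   the integral of m times the Laplacian of phi is minus the sum over a of the
   integral of grad phi . (z - a) / |z - a|^2 over the Voronoi cell of a. In the
   coordinates z = a + sg (x, x s), with x > 0 and sg = 1 or -1, of Jacobian x,
   each inner integral is the variation of phi along a ray, from a to the exit
   point of the cell, with weight ds / (1 + s^2). This exhibits the distribution
   as a combination of point masses and of images of ds / (1 + s^2); applied to a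
   single pole it gives the fundamental solution, so that the point masses of
   Laplacian(Psi) cancel. In almost every direction exactly one cell is
   unbounded, whence the total mass. *)

Require Import Defs.
From HB Require Import structures.
From mathcomp Require Import all_boot all_order all_algebra complex ring lra zify.
From mathcomp Require Import all_classical all_reals all_analysis measurable_realfun.

Set Implicit Arguments.
Unset Strict Implicit.
Unset Printing Implicit Defensive.

Import Order.TTheory GRing.Theory Num.Theory ComplexField.
Import numFieldNormedType.Exports.

Local Open Scope classical_set_scope.
Local Open Scope complex_scope.
Local Open Scope ring_scope.

(** * Asymptotics of the numerators *)

(** The zeros of P_n are never located. In the limit a proportion t / (q - 1 + t) of them escapes to
    infinity, which is why [limit_measure] is not a probability and why the potentials carry
    constants that nothing bounds at the outset. Only |P_n(z)| at a fixed z is estimated; the degree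
    and the leading coefficient of P_n then give the potential.

    S_n(a) is handled by polynomial identities: the recurrence itself generates the Taylor
    coefficients, and a truncated Cauchy product with the series of -T gives the lower bound.

    Convergence of the measures is L1 convergence tested on Laplacian(phi), whose integral 0 makes
    log n! harmless. The limit must be a measure and not only a distribution: hence the explicit
    images along rays, positive by construction. Slopes replace angles, ds / (1 + s^2) being the
    angular element, so that only affine changes of one variable occur. The function m has a
    gradient that jumps across the bisectors and is singular at the poles; smoothing it by a sum of
    large powers avoids boundary terms on the cells. *)

Section deriv_num_theory.
Variable R : realType.
Local Notation C := R[i].
Implicit Types P Q T B H : {poly C}.

Lemma deriv1 : (1 : {poly C})^`() = 0.
Proof. exact: derivC. Qed.

(** For fixed Q and T the recurrence is linear in its starting polynomial, so partial fractions can
    be treated term by term. *)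
Lemma deriv_numZD c P1 P2 Q T n :
  deriv_num (c *: P1 + P2) Q T n = c *: deriv_num P1 Q T n + deriv_num P2 Q T n.
Proof.
elim: n => //= n ->; rewrite derivD derivZ -!mul_polyC; ring.
Qed.

Lemma deriv_num_sum (I : Type) (s : seq I) (c : I -> C) (F : I -> {poly C}) B Q T n :
  deriv_num (\sum_(i <- s) c i *: F i + B) Q T n =
  \sum_(i <- s) c i *: deriv_num (F i) Q T n + deriv_num B Q T n.
Proof.
elim: s => [|i s IH]; first by rewrite !big_nil !add0r.
by rewrite !big_cons -!addrA deriv_numZD IH.
Qed.

(** P H / (Q H) is the same function as P / Q, but its n-th numerator is taken over (Q H)^(n+1).
    This puts a simple pole, or a polynomial, over the full denominator. *)
Lemma deriv_num_common_factor P Q T H n :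
  deriv_num (P * H) (Q * H) T n = deriv_num P Q T n * H ^+ n.+1.
Proof.
elim: n => [|n IH] /=; first by rewrite expr1.
rewrite IH !derivM deriv_exp -!mul_polyC rmorph_nat -(mulr_natl _ n.+1) /= !exprS.
ring.
Qed.

(** Linear growth of the degree is what makes each differentiation cost O(n / rho) in the growth
    estimate. *)
Lemma size_deriv_num1 B T n :
  (size (deriv_num B 1 T n) <= size B + n * (size T).-1)%N.
Proof.
elim: n => [|n IH] /=; first by rewrite mul0n addn0.
rewrite mul1r deriv1 scaler0 subr0 mul1r.
apply: (leq_trans (size_polyD _ _)); rewrite geq_max; apply/andP; split.
  have [->|T'0] := eqVneq (T^`()) 0; first by rewrite mul0r size_poly0.
  have T0 : T != 0 by apply: contra_neq T'0 => ->; rewrite deriv0.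
  have h2 := lt_size_deriv T0.
  apply: (leq_trans (size_polyMleq _ _)).
  rewrite mulSn; move: h2 IH; move: (size T) (size T^`()) (size (deriv_num B 1 T n)) => a b c.
  move: (n * a.-1)%N (size B) => u v; lia.
have dl p : (size (p^`() : {poly C}) <= size p)%N.
  have [->|p0] := eqVneq p 0; first by rewrite deriv0.
  exact/ltnW/lt_size_deriv.
apply: (leq_trans (leq_trans (dl _) IH)).
by rewrite leq_add2l leq_mul2r leqnSn orbT.
Qed.

(* The Taylor coefficients at z of h |-> exp (T (z + h) - T z), as polynomials
   in z. *)
Definition exp_coef T k : {poly C} := (k`!%:R^-1 : C) *: deriv_num 1 1 T k.

Lemma exp_coef0 T : exp_coef T 0 = 1.
Proof. by rewrite /exp_coef /= invr1 scale1r. Qed.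

(** Coefficient form of the equation d_h g = d_z g + T'(z) g satisfied by g(z, h) = exp (T (z + h) -
    T z). *)
Lemma exp_coefS T k :
  (k.+1%:R : C) *: exp_coef T k.+1 = T^`() * exp_coef T k + (exp_coef T k)^`().
Proof.
rewrite /exp_coef /= mul1r deriv1 scaler0 subr0 mul1r derivZ -scalerAr -scalerDr.
by rewrite scalerA factS natrM invfM mulrA divff ?mul1r // pnatr_eq0.
Qed.

(** The S_n(a) of the overview: the Taylor expansion is at z, with increment a - z. *)
Definition exp_partial T a n : {poly C} :=
  \sum_(k < n.+1) (a%:P - 'X) ^+ k * exp_coef T k.

(** The full series E = exp (T a - T z) satisfies T' E + E' = 0; after truncation the sum telescopes
    and only the next Taylor term survives. *)
Lemma exp_partial_deriv T a n :
  T^`() * exp_partial T a n + (exp_partial T a n)^`() =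
  (n.+1%:R : C) *: ((a%:P - 'X) ^+ n * exp_coef T n.+1).
Proof.
elim: n => [|n IH]; rewrite /exp_partial.
  by rewrite big_ord1 !expr0 !mul1r -exp_coefS.
rewrite big_ord_recr /= -/(exp_partial T a n) derivD mulrDr addrACA IH.
rewrite [in RHS]scalerAr exp_coefS derivM deriv_exp derivB derivX derivC sub0r.
rewrite -(mulr_natl (-1 * _) n.+1) -!mul_polyC rmorph_nat /= !exprS; ring.
Qed.

(** This is the Leibniz formula for e^T / (z - a): the term with k derivatives on e^T contributes
    the k-th Taylor term once (-1)^n n! / (z - a)^(n+1) is factored out. *)
Lemma deriv_num_pole T a n :
  deriv_num 1 ('X - a%:P) T n = (((-1) ^+ n * n`!%:R) : C) *: exp_partial T a n.
Proof.
elim: n => [|n IH].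
  by rewrite /= /exp_partial big_ord1 exp_coef0 expr0 !mul1r scale1r.
rewrite [LHS]/= IH derivB derivX derivC subr0 derivZ.
have E := exp_partial_deriv T a n.
have -> : (exp_partial T a n)^`() =
   (n.+1%:R : C) *: ((a%:P - 'X) ^+ n * exp_coef T n.+1) - T^`() * exp_partial T a n.
  by rewrite -E; ring.
rewrite [exp_partial T a n.+1]/exp_partial big_ord_recr /= -/(exp_partial T a n).
rewrite factS natrM -!mul_polyC !rmorphM !rmorphXn /= !rmorph_nat !rmorphN1 !exprS.
ring.
Qed.

(* The Taylor coefficients of exp (T (z + h) - T z) exp (T z - T (z + h)) = 1. *)
Definition exp_conv T m : {poly C} :=
  \sum_(k < m.+1) exp_coef T k * exp_coef (- T) (m - k).

(** In the product of the two series the terms T' and -T' cancel, leaving d_h = d_z. Since the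
    coefficient of order 0 is the constant 1, all later ones vanish. *)
Lemma exp_convS T m : (m.+1%:R : C) *: exp_conv T m.+1 = (exp_conv T m)^`().
Proof.
have H k : (k <= m.+1)%N -> (m.+1%:R : C) *: (exp_coef T k * exp_coef (- T) (m.+1 - k)) =
   ((k%:R : C) *: exp_coef T k) * exp_coef (- T) (m.+1 - k) +
    exp_coef T k * (((m.+1 - k)%N%:R : C) *: exp_coef (- T) (m.+1 - k)).
  by move=> km; rewrite -(scalerAl k%:R) -(scalerAr (m.+1 - k)%:R) -scalerDl -natrD subnKC.
rewrite /exp_conv scaler_sumr (eq_bigr _ (fun (k : 'I_m.+2) _ => H k (ltn_ord k))).
rewrite big_split /= big_ord_recl scale0r mul0r add0r.
rewrite [X in _ + X]big_ord_recr /= subnn scale0r mulr0 addr0 raddf_sum /= -big_split /=.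
apply: eq_bigr => k _; rewrite exp_coefS /= subSS.
have kn : (k <= m)%N by rewrite -ltnS.
rewrite (subSn kn) exp_coefS derivM derivN; ring.
Qed.

Lemma exp_conv_eq0 T m : exp_conv T m.+1 = 0.
Proof.
have H : exp_conv T m.+1 = (m.+1%:R : C)^-1 *: (exp_conv T m)^`().
  by rewrite -exp_convS scalerA mulVf ?scale1r // pnatr_eq0.
rewrite H; suff -> : (exp_conv T m)^`() = 0 by rewrite scaler0.
elim: m {H} => [|m IH]; first by rewrite /exp_conv big_ord1 !exp_coef0 mulr1 derivC.
have := exp_convS T m; rewrite IH => /eqP; rewrite scaler_eq0 pnatr_eq0 /= => /eqP ->.
by rewrite deriv0.
Qed.

End deriv_num_theory.

Section cabs_theory.
Variable R : realType.
Local Notation C := R[i].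
Implicit Types x y z : C.

Lemma cabs_ge0 z : 0 <= cabs z.
Proof. by case: z => a b; rewrite /cabs /= sqrtr_ge0. Qed.

Lemma cabs0 : cabs (0 : C) = 0. Proof. exact: Normc.normc0. Qed.
Lemma cabs1 : cabs (1 : C) = 1. Proof. exact: Normc.normc1. Qed.
Lemma cabsM x y : cabs (x * y) = cabs x * cabs y.
Proof. exact: Normc.normcM. Qed.
Lemma cabsV x : cabs x^-1 = (cabs x)^-1. Proof. exact: Normc.normcV. Qed.
Lemma cabsX x n : cabs (x ^+ n) = cabs x ^+ n.
Proof. by elim: n => [|n IH]; rewrite ?cabs1 // !exprS cabsM IH. Qed.
Lemma cabsN x : cabs (- x) = cabs x. Proof. exact: normcN. Qed.
Lemma cabs_eq0 z : (cabs z == 0) = (z == 0).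
Proof. by apply/eqP/eqP => [/Normc.eq0_normc//|->]; rewrite cabs0. Qed.
Lemma cabs_gt0 z : (0 < cabs z) = (z != 0).
Proof. by rewrite lt0r cabs_eq0 cabs_ge0 andbT. Qed.
Lemma cabsD x y : cabs (x + y) <= cabs x + cabs y. Proof. exact: le_normcD. Qed.
Lemma cabs_natr n : cabs (n%:R : C) = n%:R.
Proof. by rewrite /cabs -[n%:R]/(1 *+ n) normcMn Normc.normc1. Qed.
Lemma cabsB_sym x y : cabs (x - y) = cabs (y - x).
Proof. by rewrite -cabsN opprB. Qed.
Lemma cabs_sub_le x y : cabs x - cabs y <= cabs (x + y).
Proof. by have := cabsD (x + y) (- y); rewrite cabsN addrK; lra. Qed.
Lemma cabs_sum (I : Type) (s : seq I) (P : pred I) (F : I -> C) :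
  cabs (\sum_(i <- s | P i) F i) <= \sum_(i <- s | P i) cabs (F i).
Proof.
elim/big_ind2: _ => //; first by rewrite cabs0.
by move=> x1 x2 y1 y2 h1 h2; apply: (le_trans (cabsD _ _)); rewrite lerD.
Qed.
Lemma cabs_prod (I : Type) (s : seq I) (P : pred I) (F : I -> C) :
  cabs (\prod_(i <- s | P i) F i) = \prod_(i <- s | P i) cabs (F i).
Proof.
by elim/big_ind2: _ => //; [rewrite cabs1 | move=> ? ? ? ? <- <-; rewrite cabsM].
Qed.

End cabs_theory.

(** * Coefficient norms and the growth of the numerators *)

Section poly_norm.
Variables (R : realType) (rho : R).
Hypothesis rho0 : 0 < rho.
Local Notation C := R[i].
Implicit Types p q : {poly C}.

(** A weighted l1 norm of the coefficients stands in for the supremum over the disc of radius rho: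
    it is submultiplicative, and derivatives are estimated coefficient by coefficient. *)
Definition poly_norm p : R := \sum_(k < size p) cabs p`_k * rho ^+ k.

Lemma poly_normE N p : (size p <= N)%N ->
  poly_norm p = \sum_(k < N) cabs p`_k * rho ^+ k.
Proof.
move=> sN; rewrite /poly_norm (big_ord_widen N (fun k => cabs p`_k * rho ^+ k)) //.
rewrite big_mkcond; apply: eq_bigr => k _; case: ltnP => // sk.
by rewrite nth_default // cabs0 mul0r.
Qed.

Lemma poly_norm_ge0 p : 0 <= poly_norm p.
Proof. by apply: sumr_ge0 => k _; rewrite mulr_ge0 ?cabs_ge0 // exprn_ge0 // ltW. Qed.

Lemma horner_poly_norm p z : cabs z <= rho -> cabs p.[z] <= poly_norm p.
Proof.
move=> zr; rewrite horner_coef; apply: (le_trans (cabs_sum _ _ _)).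
apply: ler_sum => k _; rewrite cabsM cabsX ler_wpM2l ?cabs_ge0 //.
by rewrite lerXn2r ?nnegrE ?cabs_ge0 // ltW.
Qed.

Lemma poly_normD p q : poly_norm (p + q) <= poly_norm p + poly_norm q.
Proof.
set N := maxn (size p) (size q).
rewrite (@poly_normE N) ?size_polyD // (@poly_normE N p) ?leq_maxl //.
rewrite (@poly_normE N q) ?leq_maxr // -big_split /=; apply: ler_sum => k _.
by rewrite coefD -mulrDl ler_wpM2r ?cabsD // exprn_ge0 // ltW.
Qed.

Lemma poly_normZ (c : C) p : poly_norm (c *: p) = cabs c * poly_norm p.
Proof.
rewrite (@poly_normE (size p)) ?size_scale_leq // mulr_sumr.
by apply: eq_bigr => k _; rewrite coefZ cabsM mulrA.
Qed.

Lemma poly_norm_cons p (c : C) : poly_norm (p * 'X + c%:P) = poly_norm p * rho + cabs c.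
Proof.
rewrite (@poly_normE (size p).+1); last by rewrite size_MXaddC; case: ifP.
rewrite big_ord_recl addrC coefD coefMX coefC /= add0r expr0 mulr1; congr (_ + _).
rewrite mulr_suml; apply: eq_bigr => k _.
by rewrite coefD coefMX coefC /= addr0 exprSr mulrA.
Qed.

Lemma poly_normM p q : poly_norm (p * q) <= poly_norm p * poly_norm q.
Proof.
elim/poly_ind: p => [|p c IH].
  by rewrite mul0r {1}/poly_norm size_poly0 big_ord0 mulr_ge0 ?poly_norm_ge0.
have -> : (p * 'X + c%:P) * q = ((p * q) * 'X + 0%:P) + c *: q.
  by rewrite -mul_polyC polyC0; ring.
apply: (le_trans (poly_normD _ _)).
rewrite !poly_norm_cons poly_normZ cabs0 addr0 mulrDl lerD2r mulrAC.
by rewrite ler_wpM2r // ltW.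
Qed.

Lemma poly_norm_deriv p : poly_norm p^`() <= (size p)%:R / rho * poly_norm p.
Proof.
have [->|p0] := eqVneq p 0.
  by rewrite deriv0 /poly_norm size_poly0 !big_ord0 mulr0.
rewrite (@poly_normE (size p) p^`()); last exact/ltnW/lt_size_deriv.
rewrite (@poly_normE (size p).+1 p) // big_ord_recl mulrDr.
apply: ler_wpDl.
  by rewrite !mulr_ge0 ?invr_ge0 ?cabs_ge0 // ?ltW // expr0.
rewrite mulr_sumr; apply: ler_sum => k _; rewrite coef_deriv /=.
rewrite -[_ *+ k.+1]mulr_natl cabsM cabs_natr exprS.
have -> : (size p)%:R / rho * (cabs p`_(bump 0 k) * (rho * rho ^+ k)) =
   (size p)%:R * (cabs p`_k.+1 * rho ^+ k) by rewrite /bump /=; field; rewrite gt_eqF.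
rewrite -mulrA ler_wpM2r ?ler_nat //.
by rewrite mulr_ge0 ?cabs_ge0 // exprn_ge0 // ltW.
Qed.

End poly_norm.

Section growth.
Variable R : realType.
Local Notation C := R[i].

(* On a disc of radius rho, differentiating a polynomial of degree O(n) costs a
   factor O(n / rho), so that a large rho makes the constant gamma small. *)
Lemma deriv_num1_growth (B T : {poly C}) (z : C) (gamma : R) : 0 < gamma ->
  exists2 K : R, 0 < K & forall n, cabs (deriv_num B 1 T n).[z] <= K * gamma ^+ n * n`!%:R.
Proof.
move=> g0; set g := gamma / 2; have g'0 : 0 < g by rewrite divr_gt0.
set t := (size T).-1; pose rho := 1 + cabs z + t%:R / g.
have rho0 : 0 < rho.
  by rewrite /rho -addrA ltr_pwDl // addr_ge0 ?cabs_ge0 // divr_ge0 // ltW.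
have zr : cabs z <= rho.
  by rewrite /rho addrAC lerDr addr_ge0 // divr_ge0 // ltW.
have tr : t%:R / rho <= g.
  rewrite ler_pdivrMr // mulrC -ler_pdivrMr //.
  by rewrite /rho lerDr addr_ge0 ?cabs_ge0.
pose A := poly_norm rho T^`() + (size B)%:R / rho.
have A0 : 0 <= A by rewrite addr_ge0 ?poly_norm_ge0 // divr_ge0 // ltW.
(* One step costs at most A + n g. With A <= M g this is at most (M + n + 1) g, and the product of
   these factors builds up (M + n)!. *)
have [M MA] : exists M : nat, A <= M%:R * g.
  exists (Num.truncn (A / g)).+1; rewrite -ler_pdivrMr //.
  by rewrite ltW // truncnS_gt.
have H n : poly_norm rho (deriv_num B 1 T n) <=
    poly_norm rho B * g ^+ n * (M + n)`!%:R.
  elim: n => [|n IH].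
    rewrite expr0 mulr1 addn0 ler_peMr ?poly_norm_ge0 //.
    by rewrite ler1n fact_gt0.
  rewrite /= mul1r deriv1 scaler0 subr0 mul1r.
  apply: (le_trans (poly_normD rho0 _ _)).
  set G := poly_norm rho (deriv_num B 1 T n) in IH *.
  have G0 : 0 <= G by exact: poly_norm_ge0.
  apply: (@le_trans _ _ (((M + n).+1)%:R * g * G)).
    apply: (@le_trans _ _ ((A + n%:R * g) * G)); last first.
      rewrite ler_wpM2r // (_ : (M + n).+1%:R = M%:R + n%:R + 1 :> R); last first.
        by rewrite -addn1 !natrD.
      by rewrite !mulrDl mul1r; move: (n%:R * g) => ?; lra.
    apply: (le_trans (lerD (poly_normM rho0 _ _) (poly_norm_deriv rho0 _))).
    rewrite -/G -mulrDl ler_wpM2r // /A -addrA lerD2l.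
    apply: (@le_trans _ _ ((size B + n * t)%:R / rho)).
      by rewrite ler_wpM2r ?invr_ge0 ?(ltW rho0) // ler_nat size_deriv_num1.
    rewrite natrD mulrDl lerD2l natrM -mulrA ler_wpM2l //.
  rewrite addnS factS natrM exprS.
  have -> : poly_norm rho B * (g * g ^+ n) * ((M + n).+1%:R * (M + n)`!%:R) =
    (M + n).+1%:R * g * (poly_norm rho B * g ^+ n * (M + n)`!%:R) by ring.
  by rewrite ler_wpM2l // mulr_ge0 // ltW.
exists ((poly_norm rho B + 1) * M`!%:R * 2 ^+ M).
  by rewrite !mulr_gt0 ?exprn_gt0 ?ltr0n ?fact_gt0 // ltr_wpDl ?poly_norm_ge0.
move=> n; apply: (le_trans (horner_poly_norm rho0 _ zr)); apply: (le_trans (H n)).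
have -> : (M + n)`! = ('C(M + n, M) * (M`! * n`!))%N.
  by have := bin_fact (leq_addr n M); rewrite addKn => <-.
rewrite /g expr_div_n !natrM.
(* Passing from (M + n)! to n! costs 2^n, which is the reason for g = gamma / 2. *)
have b2 : ('C(M + n, M))%:R <= 2 ^+ M * 2 ^+ n :> R.
  rewrite -exprD -natrX ler_nat.
  have h : (M < (M + n).+1)%N by rewrite ltnS leq_addr.
  rewrite -[(2 ^ _)%N]/((1 + 1) ^ _)%N expnDn (bigD1 (Ordinal h)) //=.
  by rewrite !exp1n !muln1 leq_addr.
have -> : (poly_norm rho B + 1) * M`!%:R * 2 ^+ M * gamma ^+ n * n`!%:R =
  (poly_norm rho B + 1) * (gamma ^+ n / 2 ^+ n) * ((2 ^+ M * 2 ^+ n) * (M`!%:R * n`!%:R)).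
  by field; rewrite gt_eqF // exprn_gt0.
have gn0 : 0 <= gamma ^+ n / 2 ^+ n by rewrite divr_ge0 // exprn_ge0 // ltW.
apply: ler_pM.
- by rewrite mulr_ge0 // poly_norm_ge0.
- by rewrite !mulr_ge0.
- by rewrite ler_wpM2r // lerDl.
- by rewrite ler_wpM2r // mulr_ge0.
Qed.

End growth.

Section exp_partial_bounds.
Variable R : realType.
Local Notation C := R[i].

(** The factor h^k is absorbed by a small gamma. The base 16 is spent in [exp_partial_ge] as 2 * 4 *
    2: the [m.+2] terms of a convolution, the [n.*2.+1] coefficients of a product, and a remaining
    decay 2^-n. *)
Lemma exp_coef_growth (T : {poly C}) (z h : C) :
  exists2 K : R, 0 < K & forall k, cabs ((exp_coef T k).[z] * h ^+ k) <= K / 16 ^+ k.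
Proof.
pose g := (16 * (1 + cabs h))^-1.
have h1 : 0 < 1 + cabs h by rewrite ltr_pwDl // cabs_ge0.
have g0 : 0 < g by rewrite invr_gt0 mulr_gt0.
have [K K0 H] := deriv_num1_growth 1 T z g0.
exists K => // k; rewrite cabsM cabsX /exp_coef hornerZ cabsM cabsV cabs_natr.
rewrite -[_^-1 * _]mulrC mulrAC ler_pdivrMr ?ltr0n ?fact_gt0 //.
apply: (@le_trans _ _ (K * g ^+ k * k`!%:R * (1 + cabs h) ^+ k)).
  apply: ler_pM; rewrite ?cabs_ge0 ?exprn_ge0 ?cabs_ge0 //.
  by rewrite lerXn2r ?nnegrE ?cabs_ge0 ?(ltW h1) // lerDr.
rewrite /g exprVn exprMn le_eqVlt; apply/orP; left; apply/eqP; field.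
by rewrite !expf_neq0 ?gt_eqF.
Qed.

Lemma leq_expn2 m : (m.+1 <= 2 ^ m)%N.
Proof. by elim: m => // m IH; rewrite expnS; lia. Qed.

Lemma leq_expn4 n : (n.*2.+1 <= 4 ^ n)%N.
Proof. by elim: n => // n IH; rewrite expnS; lia. Qed.

Lemma exp_partialE (T : {poly C}) (a z : C) n :
  (exp_partial T a n).[z] = \sum_(k < n.+1) (exp_coef T k).[z] * (a - z) ^+ k.
Proof.
rewrite /exp_partial horner_sum; apply: eq_bigr => k _.
by rewrite hornerM horner_exp hornerD hornerN hornerX hornerC [LHS]mulrC.
Qed.

Lemma exp_partial_le (T : {poly C}) (a z : C) :
  exists2 K : R, 0 < K & forall n, cabs (exp_partial T a n).[z] <= K.
Proof.
have [K K0 H] := exp_coef_growth T z (a - z).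
exists (2 * K); first by rewrite mulr_gt0.
move=> n; rewrite exp_partialE; apply: (le_trans (cabs_sum _ _ _)).
apply: (@le_trans _ _ (\sum_(k < n.+1) K / 16 ^+ k)); first by apply: ler_sum => k _; exact: H.
have -> : \sum_(k < n.+1) K / 16 ^+ k = K * (16 / 15 * (1 - (16^-1) ^+ n.+1)).
  elim: n => [|n IH]; first by rewrite big_ord1 expr0 expr1; field.
  rewrite big_ord_recr /= IH !exprS exprVn; field.
  by rewrite expf_neq0.
have : 0 <= (16^-1 : R) ^+ n.+1 by rewrite exprn_ge0 ?invr_ge0 // ler0n.
by nra.
Qed.

(* The inverse of the Taylor series of exp (T (z + h) - T z) is that of -T, and
   the Cauchy product of the partial sums tends to 1. *)
Lemma exp_partial_ge (T : {poly C}) (a z : C) :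
  exists2 c : R, 0 < c &
    exists N, forall n, (N <= n)%N -> c <= cabs (exp_partial T a n).[z].
Proof.
set h := a - z.
have [K1 K10 H1] := exp_coef_growth T z h.
have [K2 K20 H2] := exp_coef_growth (- T) z h.
have [L L0 HL] := exp_partial_le (- T) a z.
exists (2 * L)^-1; first by rewrite invr_gt0 mulr_gt0.
exists (Num.truncn (2 * (K1 * K2))).+1 => n Nn.
(* The partial sums are values at 1 of polynomials in an auxiliary variable, so that their product
   is a convolution of coefficients. *)
pose p := \poly_(k < n.+1) ((exp_coef T k).[z] * h ^+ k).
pose q := \poly_(k < n.+1) ((exp_coef (- T) k).[z] * h ^+ k).
have p1 : p.[1] = (exp_partial T a n).[z].
  by rewrite horner_poly exp_partialE; apply: eq_bigr => k _; rewrite expr1n mulr1.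
have q1 : q.[1] = (exp_partial (- T) a n).[z].
  by rewrite horner_poly exp_partialE; apply: eq_bigr => k _; rewrite expr1n mulr1.
have cp k : cabs p`_k <= K1 / 16 ^+ k.
  by rewrite coef_poly; case: ifP => _ //; rewrite cabs0 divr_ge0 ?exprn_ge0 ?(ltW K10).
have cq k : cabs q`_k <= K2 / 16 ^+ k.
  by rewrite coef_poly; case: ifP => _ //; rewrite cabs0 divr_ge0 ?exprn_ge0 ?(ltW K20).
have c0 : (p * q)`_0 = 1.
  by rewrite coefM big_ord1 !coef_poly /= !exp_coef0 !expr0 !mulr1 hornerC mulr1.
have cS m : cabs (p * q)`_m.+1 <= K1 * K2 / 8 ^+ n.
  have K120 : 0 <= K1 * K2 by rewrite mulr_ge0 // ltW.
  (* Up to degree n the truncation is invisible and the coefficient is one of the vanishing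
     [exp_conv]; beyond n the geometric decay applies. *)
  have [mn|nm] := leqP m.+1 n.
    suff -> : (p * q)`_m.+1 = 0 by rewrite cabs0 divr_ge0 ?exprn_ge0.
    transitivity ((exp_conv T m.+1).[z] * h ^+ m.+1); last first.
      by rewrite exp_conv_eq0 horner0 mul0r.
    rewrite coefM /exp_conv horner_sum mulr_suml; apply: eq_bigr => k _.
    have km : (k <= m.+1)%N by rewrite -ltnS.
    rewrite !coef_poly !ltnS (leq_trans km mn) (leq_trans (leq_subr _ _) mn).
    have e : h ^+ m.+1 = h ^+ k * h ^+ (m.+1 - k) by rewrite -exprD subnKC.
    by rewrite hornerM e; ring.
  apply: (@le_trans _ _ (K1 * K2 / 8 ^+ m.+1)); last first.
    rewrite ler_wpM2l // lef_pV2 ?posrE ?exprn_gt0 //.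
    apply: ler_weXn2l; [by rewrite ler1n | exact: ltnW].
  rewrite coefM; apply: (le_trans (cabs_sum _ _ _)).
  apply: (@le_trans _ _ (\sum_(k < m.+2) K1 * K2 / 16 ^+ m.+1)).
    apply: ler_sum => k _; rewrite cabsM.
    have km : (k <= m.+1)%N by rewrite -ltnS.
    have -> : K1 * K2 / 16 ^+ m.+1 = (K1 / 16 ^+ k) * (K2 / 16 ^+ (m.+1 - k)).
      have -> : (16 : R) ^+ m.+1 = 16 ^+ k * 16 ^+ (m.+1 - k) by rewrite -exprD subnKC.
      by field; rewrite !expf_neq0.
    by apply: ler_pM; rewrite ?cabs_ge0.
  rewrite sumr_const card_ord -[_ *+ m.+2]mulr_natl.
  have -> : m.+2%:R * (K1 * K2 / 16 ^+ m.+1) = K1 * K2 / 8 ^+ m.+1 * (m.+2%:R / 2 ^+ m.+1).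
    have -> : (16 : R) ^+ m.+1 = 8 ^+ m.+1 * 2 ^+ m.+1 by rewrite -exprMn -natrM.
    by field; rewrite !expf_neq0.
  rewrite ler_piMr //; first by rewrite divr_ge0 // exprn_ge0.
  by rewrite ler_pdivrMr ?exprn_gt0 // mul1r -natrX ler_nat leq_expn2.
have E : cabs (p.[1] * q.[1] - 1) <= 1 / 2.
  have sz : (size (p * q)%R <= n.*2.+1.+1)%N.
    apply: (leq_trans (size_polyMleq _ _)).
    have : (size p <= n.+1)%N by exact: size_poly.
    have : (size q <= n.+1)%N by exact: size_poly.
    move: (size p) (size q) => u v; lia.
  rewrite -hornerM (horner_coef_wide _ sz) big_ord_recl c0 expr0 mulr1 addrC addKr.
  apply: (le_trans (cabs_sum _ _ _)).
  apply: (@le_trans _ _ (\sum_(k < n.*2.+1) K1 * K2 / 8 ^+ n)).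
    by apply: ler_sum => k _; rewrite expr1n mulr1 cS.
  rewrite sumr_const card_ord -[_ *+ n.*2.+1]mulr_natl.
  have n4 : (n.*2.+1)%:R <= 4 ^+ n :> R by rewrite -natrX ler_nat leq_expn4.
  have e8 : (8 : R) ^+ n = 4 ^+ n * 2 ^+ n by rewrite -exprMn -natrM.
  apply: (@le_trans _ _ (4 ^+ n * (K1 * K2 / 8 ^+ n))).
    by rewrite ler_wpM2r // divr_ge0 ?exprn_ge0 // mulr_ge0 // ltW.
  have -> : 4 ^+ n * (K1 * K2 / 8 ^+ n) = K1 * K2 / 2 ^+ n.
    by rewrite e8; field; rewrite !expf_neq0.
  rewrite ler_pdivrMr ?exprn_gt0 //.
  have : 2 * (K1 * K2) <= 2 ^+ n.
    apply: (@le_trans _ _ n%:R).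
      by apply/ltW/(lt_le_trans (truncnS_gt _)); rewrite ler_nat.
    by rewrite -natrX ler_nat ltnW // leq_expn2.
  by lra.
rewrite -p1 -div1r ler_pdivrMr ?mulr_gt0 //.
have := HL n; rewrite -q1 => HL'.
have : 1 / 2 <= cabs (p.[1] * q.[1]).
  have := cabs_sub_le 1 (p.[1] * q.[1] - 1).
  by rewrite cabs1 addrCA subrr addr0; lra.
rewrite cabsM => H.
have : cabs p.[1] * cabs q.[1] <= cabs p.[1] * L by rewrite ler_wpM2l // cabs_ge0.
by move: (cabs p.[1] * L) (cabs p.[1]) H => *; lra.
Qed.

End exp_partial_bounds.

(** * Partial fractions and domination by the nearest pole *)

Section partial_fractions.
Variable R : realType.
Local Notation C := R[i].
Implicit Types (P Q T B : {poly C}) (zs : seq C).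

Definition prodXsubC_but zs (a : C) : {poly C} :=
  \prod_(b <- zs | b != a) ('X - b%:P).

Lemma prodXsubC_butE zs a : uniq zs -> a \in zs ->
  \prod_(b <- zs) ('X - b%:P) = ('X - a%:P) * prodXsubC_but zs a.
Proof. by move=> uz az; rewrite (bigD1_seq a). Qed.

Lemma root_prodXsubC_but zs a b : b \in zs -> b != a -> (prodXsubC_but zs a).[b] = 0.
Proof.
move=> bz ba; rewrite /prodXsubC_but horner_prod (big_rem b) //= ba.
by rewrite !hornerE subrr mul0r.
Qed.

Lemma prodXsubC_but_neq0 zs a z : (forall b, b \in zs -> b != a -> z != b) ->
  (prodXsubC_but zs a).[z] != 0.
Proof.
move=> H; rewrite /prodXsubC_but horner_prod prodf_seq_neq0.
by apply/allP => b bz; apply/implyP => ba; rewrite !hornerE subr_eq0 H.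
Qed.

Definition residue P zs a : C := P.[a] / (prodXsubC_but zs a).[a].

(** Lagrange interpolation: P minus the sum vanishes at the distinct points [zs], hence is divisible
    by the product. *)
Lemma partial_fraction P zs : uniq zs ->
  exists B, P = \sum_(a <- zs) residue P zs a *: prodXsubC_but zs a
                + B * \prod_(b <- zs) ('X - b%:P).
Proof.
move=> uz; set S := \sum_(a <- zs) _.
have : \prod_(b <- zs) ('X - b%:P) %| P - S.
  apply: uniq_roots_dvdp; last by rewrite uniq_rootsE.
  apply/allP => a az; rewrite /root hornerD hornerN horner_sum (bigD1_seq a) //=.
  rewrite hornerZ /residue divfK; last first.
    by apply: prodXsubC_but_neq0 => b _; rewrite eq_sym.
  rewrite big_seq_cond big1 ?addr0 ?subrr // => b /andP[bz ba].
  by rewrite hornerZ (@root_prodXsubC_but zs b a) ?mulr0 // eq_sym.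
by case/dvdpP => B E; exists B; rewrite -E addrC subrK.
Qed.

Lemma deriv_num_partial_fraction P B T zs n : uniq zs ->
  P = \sum_(a <- zs) residue P zs a *: prodXsubC_but zs a
      + B * \prod_(b <- zs) ('X - b%:P) ->
  deriv_num P (\prod_(b <- zs) ('X - b%:P)) T n =
  \sum_(a <- zs) (residue P zs a * ((-1) ^+ n * n`!%:R)) *:
     (exp_partial T a n * prodXsubC_but zs a ^+ n.+1)
  + deriv_num B 1 T n * (\prod_(b <- zs) ('X - b%:P)) ^+ n.+1.
Proof.
move=> uz; set Q := \prod_(b <- zs) _ => {1}->.
rewrite deriv_num_sum; congr (_ + _); last first.
  by have := deriv_num_common_factor B 1 T Q n; rewrite mul1r.
rewrite big_seq [RHS]big_seq; apply: eq_bigr => a az.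
have := deriv_num_common_factor 1 ('X - a%:P) T (prodXsubC_but zs a) n.
by rewrite /Q (prodXsubC_butE uz az) mul1r => ->; rewrite deriv_num_pole -scalerAl scalerA.
Qed.

(* Near z the pole nearest to z dominates the Taylor coefficients. *)
Lemma deriv_num_asymp P T zs (a z : C) : uniq zs -> a \in zs -> z \notin zs ->
  (forall b, b \in zs -> b != a -> cabs (z - a) < cabs (z - b)) -> P.[a] != 0 ->
  let Q := \prod_(b <- zs) ('X - b%:P) in
  exists c K : R, exists N : nat, [/\ 0 < c, 0 < K & forall n, (N <= n)%N ->
    c <= cabs (deriv_num P Q T n).[z] * cabs (z - a) ^+ n / (n`!%:R * cabs Q.[z] ^+ n.+1) <= K].
Proof.
move=> uz az zz near Pa Q.
have [B PB] := partial_fraction P uz.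
have zb b : b \in zs -> z - b != 0 by move=> bz; rewrite subr_eq0; apply: contraNneq zz => ->.
have Qz : Q.[z] != 0.
  by rewrite horner_prod prodf_seq_neq0; apply/allP => b bz; rewrite /= !hornerE zb.
pose S b n := (exp_partial T b n).[z].
pose main n := residue P zs a * (-1) ^+ n * S a n / (z - a).
pose rest n := \sum_(b <- zs | b != a) residue P zs b * (-1) ^+ n * S b n / (z - b) *
   ((z - a) / (z - b)) ^+ n + (z - a) ^+ n * (deriv_num B 1 T n).[z] / n`!%:R.
have E n : (deriv_num P Q T n).[z] * (z - a) ^+ n / (n`!%:R * Q.[z] ^+ n.+1) = main n + rest n.
  have n0 : (n`!%:R : C) != 0 by rewrite pnatr_eq0 -lt0n fact_gt0.
  rewrite (deriv_num_partial_fraction T n uz PB) -/Q hornerD hornerM horner_exp horner_sum.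
  rewrite [\sum_(b <- zs) _](bigD1_seq a) //= /main /rest !mulrDl addrA.
  have Qb b : b \in zs -> (prodXsubC_but zs b).[z] = Q.[z] / (z - b).
    move=> bz; rewrite /Q (prodXsubC_butE uz bz) hornerM !hornerE mulrAC divff ?mul1r //.
    exact: zb.
  congr (_ + _ + _).
  - rewrite hornerZ hornerM horner_exp Qb // -/(S a n) !exprS expr_div_n.
    field; rewrite n0 Qz zb // !expf_neq0 ?zb //=.
  - rewrite !mulr_suml big_seq_cond [RHS]big_seq_cond; apply: eq_bigr => b /andP[bz ba].
    rewrite hornerZ hornerM horner_exp Qb // -/(S b n) !exprS !expr_div_n.
    by field; rewrite n0 Qz zb // !expf_neq0 ?zb.
  - by field; rewrite n0 !expf_neq0.
have Sle b : exists2 K : R, 0 < K & forall n, cabs (S b n) <= K by exact: exp_partial_le.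
have lim : cabs (rest n) @[n --> \oo] --> (0 : R).
  pose bnd n := \sum_(b <- zs | b != a) cabs (residue P zs b * (-1) ^+ n * S b n / (z - b) *
   ((z - a) / (z - b)) ^+ n) + cabs ((z - a) ^+ n * (deriv_num B 1 T n).[z] / n`!%:R).
  apply: (@squeeze_cvgr _ _ _ _ (fun _ => 0) bnd); [|exact: cvg_cst|].
    apply: nearW => n; rewrite cabs_ge0 /=.
    by apply: (le_trans (cabsD _ _)); rewrite lerD2r cabs_sum.
  rewrite -[X in _ --> X]addr0; apply: cvgD.
    suff H s : {subset s <= zs} -> \sum_(b <- s | b != a)
        cabs (residue P zs b * (-1) ^+ n * S b n / (z - b) * ((z - a) / (z - b)) ^+ n)
        @[n --> \oo] --> (0 : R) by exact: H.
    elim: s => [|b s IH] sz.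
      by under eq_fun do rewrite big_nil; exact: cvg_cst.
    have {}IH := IH (fun x xs => sz x (@mem_behead _ (b :: s) x xs)).
    under eq_fun do rewrite big_cons.
    have bz : b \in zs by apply: sz; rewrite mem_head.
    case: (eqVneq b a) => ba /=; first exact: IH.
    suff A : cabs (residue P zs b * (-1) ^+ n * S b n / (z - b) * ((z - a) / (z - b)) ^+ n)
        @[n --> \oo] --> (0 : R) by have := cvgD A IH; rewrite addr0 => AIH; exact: AIH.
    have [K K0 HK] := Sle b.
    pose l := cabs ((z - a) / (z - b)).
    have l0 : 0 <= l by exact: cabs_ge0.
    have l1 : `|l| < 1.
      by rewrite ger0_norm // /l cabsM cabsV ltr_pdivrMr ?cabs_gt0 ?zb // mul1r near.
    apply: (@squeeze_cvgr _ _ _ _ (fun _ => 0)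
      (fun n => (cabs (residue P zs b) * K / cabs (z - b)) * l ^+ n)); last first.
    - by have := @cvg_geometric R (cabs (residue P zs b) * K / cabs (z - b)) _ l1.
    - exact: cvg_cst.
    - apply: nearW => n; rewrite cabs_ge0 /= cabsM cabsX -/l.
      apply: ler_wpM2r; first by rewrite exprn_ge0.
      move: (residue P zs b) => rb; rewrite !cabsM cabsX cabsN cabs1 expr1n mulr1 cabsV.
      by rewrite ler_wpM2r ?invr_ge0 ?cabs_ge0 // ler_wpM2l // cabs_ge0.
  (* The polynomial part is multiplied by |z - a|^n; this growth rate beats it with 2^-n to
     spare. *)
  pose g := (2 * cabs (z - a))^-1.
  have za0 : 0 < cabs (z - a) by rewrite cabs_gt0 zb.
  have g0 : 0 < g by rewrite invr_gt0 mulr_gt0.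
  have [K K0 HK] := deriv_num1_growth B T z g0.
  have h1 : `|2^-1 : R| < 1 by rewrite ger0_norm //; lra.
  apply: (@squeeze_cvgr _ _ _ _ (fun _ => 0) (fun n => K * 2^-1 ^+ n)); last first.
  - by have := @cvg_geometric R K _ h1.
  - exact: cvg_cst.
  - apply: nearW => n; rewrite cabs_ge0 /= !cabsM cabsX cabsV cabs_natr.
    rewrite ler_pdivrMr ?ltr0n ?fact_gt0 //.
    apply: (le_trans (ler_wpM2l _ (HK n))); first by rewrite exprn_ge0 // cabs_ge0.
    rewrite /g !exprVn exprMn le_eqVlt; apply/orP; left; apply/eqP; field.
    by rewrite !expf_neq0 // gt_eqF.
have ra : residue P zs a != 0.
  rewrite /residue mulf_neq0 // invr_eq0; apply: prodXsubC_but_neq0 => b _; by rewrite eq_sym.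
have [K K0 HK] := Sle a.
have [c c0 [N HN]] := exp_partial_ge T a z.
pose r := cabs (residue P zs a) / cabs (z - a).
have r0 : 0 < r by rewrite divr_gt0 ?cabs_gt0 ?zb.
have mainE n : cabs (main n) = r * cabs (S a n).
  rewrite /main /r; move: (residue P zs a) => ra'.
  by rewrite !cabsM cabsX cabsN cabs1 expr1n mulr1 cabsV; ring.
exists (r * c / 2), (r * K + r * c / 2).
have e0 : 0 < r * c / 2 by apply: divr_gt0 => //; exact: mulr_gt0.
have /cvgrPdist_le /(_ _ e0) [N' _ HN'] := lim.
exists (maxn N N'); split => //; first by rewrite addr_gt0 // mulr_gt0.
move=> n; rewrite geq_max => /andP[Nn N'n].
have -> : cabs (deriv_num P Q T n).[z] * cabs (z - a) ^+ n / (n`!%:R * cabs Q.[z] ^+ n.+1) =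
   cabs (main n + rest n) by rewrite -E !cabsM cabsV cabsM !cabsX cabs_natr.
have /= := HN' n N'n; rewrite sub0r normrN ger0_norm ?cabs_ge0 // => h1.
have h2 := mainE n.
have h3 : r * c <= r * cabs (S a n) by rewrite ler_pM2l // HN.
have h4 : r * cabs (S a n) <= r * K by rewrite ler_pM2l.
have := cabs_sub_le (main n) (rest n); have := cabsD (main n) (rest n).
move: (cabs (main n + rest n)) (cabs (main n)) (cabs (rest n)) h1 h2 h3 h4 e0.
by move: (r * cabs (S a n)) (r * c) (r * K) => *; apply/andP; split; lra.
Qed.

End partial_fractions.

Section leading_terms.
Variable R : realType.
Local Notation C := R[i].
Implicit Types (P Q T : {poly C}).

Lemma size_lead_coef_deriv T : (1 <= deg T)%N ->
  size T^`() = deg T /\ lead_coef T^`() = lead_coef T * (deg T)%:R.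
Proof.
rewrite /deg => t1; have T0 : T != 0 by apply: contraTneq t1 => ->; rewrite size_poly0.
have c : T^`()`_(size T).-2 = lead_coef T * (size T).-1%:R.
  by rewrite coef_deriv prednK // mulr_natr lead_coefE.
have s : size T^`() = (size T).-1.
  apply/eqP; rewrite eqn_leq; apply/andP; split.
    by rewrite -ltnS prednK ?lt_size_deriv // size_poly_gt0.
  rewrite leqNgt; apply/negP => sl; move: c; rewrite nth_default; last first.
    by rewrite -ltnS prednK.
  move/esym/eqP; rewrite mulf_eq0 lead_coef_eq0 (negbTE T0) pnatr_eq0 /= => /eqP t0.
  by rewrite t0 in t1.
by split => //; rewrite lead_coefE s c.
Qed.

(** Since deg T >= 1, the product Q T' has larger degree than Q', and Q T' P_n larger degree than Q
    P_n'; the leading term always comes from Q T' P_n. *)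
Lemma deriv_num_lead P Q T n : P != 0 -> Q \is monic -> (1 <= deg T)%N ->
  size (deriv_num P Q T n) = (n * (deg Q + deg T - 1) + deg P).+1 /\
  lead_coef (deriv_num P Q T n) = (lead_coef T * (deg T)%:R) ^+ n * lead_coef P.
Proof.
move=> P0 Qm t1; have [sT lT] := size_lead_coef_deriv t1.
have Q0 : Q != 0 by exact: monic_neq0.
have T'0 : T^`() != 0 by rewrite -size_poly_gt0 sT.
have sQ : size Q = (deg Q).+1 by rewrite /deg prednK // size_poly_gt0.
elim: n => [|n [IHs IHl]].
  by rewrite mul0n add0n expr0 mul1r /deg prednK // size_poly_gt0.
rewrite /=; set F := deriv_num P Q T n in IHs IHl *.
have F0 : F != 0 by rewrite -size_poly_gt0 IHs.
have sQT : size (Q * T^`()) = (deg Q + deg T)%N by rewrite size_mul // sQ sT.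
have sQ' : (size (n.+1%:R *: Q^`())%R < size (Q * T^`())%R)%N.
  apply: (leq_ltn_trans (size_scale_leq _ _)); apply: (leq_trans (lt_size_deriv Q0)).
  by rewrite sQT sQ; lia.
have sA : size (Q * T^`() - n.+1%:R *: Q^`()) = (deg Q + deg T)%N.
  by rewrite size_polyDl ?size_polyN // sQT.
have lA : lead_coef (Q * T^`() - n.+1%:R *: Q^`()) = lead_coef T * (deg T)%:R.
  by rewrite lead_coefDl ?size_polyN // lead_coefM (monicP Qm) mul1r.
have A0 : Q * T^`() - n.+1%:R *: Q^`() != 0 by rewrite -size_poly_gt0 sA; lia.
have sB : (size (Q * F^`())%R < size ((Q * T^`() - n.+1%:R *: Q^`()) * F)%R)%N.
  rewrite [X in (_ < X)%N]size_mul // sA; apply: (leq_ltn_trans (size_polyMleq _ _)).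
  have := lt_size_deriv F0; rewrite sQ.
  by move: (size F) (size F^`()) => u v uv; lia.
rewrite size_polyDl // lead_coefDl // size_mul // sA IHs; split.
  by rewrite mulSn; move: (n * _)%N => u; lia.
by rewrite lead_coefM lA IHl exprS mulrA.
Qed.

Lemma deriv_num_deg P Q T n : P != 0 -> Q \is monic -> (1 <= deg T)%N ->
  deg (deriv_num P Q T n) = (n * (deg Q + deg T - 1) + deg P)%N.
Proof. by move=> P0 Qm t1; rewrite /deg (deriv_num_lead n P0 Qm t1).1. Qed.

Lemma deriv_num_neq0 P Q T n : P != 0 -> Q \is monic -> (1 <= deg T)%N ->
  deriv_num P Q T n != 0.
Proof.
by move=> P0 Qm t1; rewrite -size_poly_gt0 (deriv_num_lead n P0 Qm t1).1.
Qed.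

Lemma zerosE P : P = lead_coef P *: \prod_(a <- zeros P) ('X - a%:P).
Proof. exact: svalP (closed_field_poly_normal P). Qed.

Lemma monic_zerosE Q : Q \is monic -> Q = \prod_(a <- zeros Q) ('X - a%:P).
Proof. by move=> /monicP Q1; rewrite {1}[Q]zerosE Q1 scale1r. Qed.

Lemma size_zeros P : P != 0 -> size (zeros P) = deg P.
Proof.
move=> P0; rewrite /deg [in RHS](zerosE P) size_scale ?lead_coef_eq0 //.
by rewrite size_prod_XsubC.
Qed.

Lemma mem_zeros P a : P != 0 -> (a \in zeros P) = (P.[a] == 0).
Proof.
move=> P0; rewrite [in RHS](zerosE P) hornerZ mulf_eq0 lead_coef_eq0 (negbTE P0) /=.
by rewrite -root_prod_XsubC.
Qed.

Lemma cabs_horner_zeros P z :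
  cabs P.[z] = cabs (lead_coef P) * \prod_(a <- zeros P) cabs (z - a).
Proof.
rewrite [in LHS](zerosE P) hornerZ cabsM horner_prod cabs_prod.
by congr (_ * _); apply: eq_bigr => a _; rewrite !hornerE.
Qed.

Lemma ln_prod_seq (I : eqType) (s : seq I) (F : I -> R) : (forall i, i \in s -> 0 < F i) ->
  ln (\prod_(i <- s) F i) = \sum_(i <- s) ln (F i).
Proof.
elim: s => [|i s IH] F0; first by rewrite !big_nil ln1.
have F0' j : j \in s -> 0 < F j by move=> js; apply: F0; rewrite inE js orbT.
rewrite !big_cons lnM ?posrE ?IH //; first by apply: F0; rewrite mem_head.
by rewrite big_seq; apply: prodr_gt0 => j; exact: F0'.
Qed.

Lemma max_seq_eq (s : seq R) x : x \in s -> (forall y, y \in s -> y <= x) -> max_seq s = x.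
Proof.
move=> xs H; rewrite /max_seq; apply/eqP; rewrite eq_le; apply/andP; split; last first.
  exact: le_bigmax_seq.
rewrite big_seq; apply: bigmax_le => //.
by apply: H; case: s xs  => //= y s _; rewrite mem_head.
Qed.

Lemma min_seq_le (s : seq R) y : y \in s -> min_seq s <= y.
Proof. by move=> ys; rewrite /min_seq; exact: ge_bigmin_seq. Qed.

Lemma exists_nearest (S : seq C) (z : C) : S != [::] ->
  exists2 a, a \in S & forall b, b \in S -> cabs (z - a) <= cabs (z - b).
Proof.
elim: S => // a [|a' S] IH _; first by exists a; rewrite ?mem_head // => b /[!inE] /eqP ->.
have [//|c cS Hc] := IH.
have [ac|ca] := leP (cabs (z - a)) (cabs (z - c)).
  exists a; rewrite ?mem_head // => b; rewrite inE => /orP[/eqP -> //|bS].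
  exact: (le_trans ac (Hc _ bS)).
exists c; first by rewrite inE cS orbT.
by move=> b; rewrite inE => /orP[/eqP ->|bS]; [exact: ltW | exact: Hc].
Qed.

Lemma lnV_le (x y : R) : 0 < x -> x <= y -> ln y^-1 <= ln x^-1.
Proof.
move=> x0 xy; have y0 := lt_le_trans x0 xy.
by rewrite !lnV ?posrE // lerN2 ler_ln ?posrE.
Qed.

Lemma max_seq_nearest (S : seq C) (z a : C) : a \in S -> z != a ->
  (forall b, b \in S -> cabs (z - a) <= cabs (z - b)) ->
  max_seq [seq ln (cabs (z - b))^-1 | b <- S] = - ln (cabs (z - a)).
Proof.
move=> aS za H.
have a0 : 0 < cabs (z - a) by rewrite cabs_gt0 subr_eq0.
rewrite -lnV ?posrE //; apply: max_seq_eq; first by apply/mapP; exists a.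
by move=> y /mapP[b bS ->]; exact: lnV_le (H _ bS).
Qed.

(** The pointwise asymptotics is known only up to bounded factors; after taking logarithms these
    form [b], which the degree in the denominator kills. *)
Lemma cvg_affine_ratio (b : nat -> R) (L M : R) (D p : nat) : (1 <= D)%N ->
  (\forall n \near \oo, `|b n| <= M) ->
  (n%:R * L + b n) / (n * D + p)%N%:R @[n --> \oo] --> L / D%:R.
Proof.
move=> D1 [N _ HN]; apply/cvgrPdist_le => e e0.
have D0 : 0 < D%:R :> R by rewrite ltr0n.
pose M' := M + p%:R * `|L|.
exists (maxn N (Num.truncn (M' / e)).+1) => // n /=; rewrite geq_max => /andP[Nn Mn].
have n0 : (0 < n)%N by case: n {Nn} Mn.
have dn0 : 0 < (n * D + p)%N%:R :> R by rewrite ltr0n addn_gt0 muln_gt0 n0 D1.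
have -> : L / D%:R - (n%:R * L + b n) / (n * D + p)%N%:R =
   (p%:R * L / D%:R - b n) / (n * D + p)%N%:R.
  by move: dn0; rewrite natrD natrM => dn0; field; rewrite !gt_eqF.
rewrite normrM normfV (gtr0_norm dn0) ler_pdivrMr //.
have h1 : `|p%:R * L / D%:R - b n| <= M'.
  rewrite /M' [M + _]addrC; apply: (le_trans (ler_normB _ _)); apply: lerD; last exact: HN.
  rewrite !normrM normfV !normr_nat ler_piMr ?mulr_ge0 //.
  by rewrite invf_le1 // ler1n.
apply: (le_trans h1); rewrite mulrC -ler_pdivrMr //.
apply: (le_trans (ltW (truncnS_gt _))); rewrite ler_nat.
by apply: (leq_trans Mn); apply: (leq_trans (leq_pmulr n D1)); rewrite leq_addr.
Qed.

(* The real-valued logarithmic potential of the zero counting measure (ln 0 = 0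
   replaces -oo at the zeros). *)
Definition log_mean P (z : C) : R :=
  ((deg P)%:R)^-1 * \sum_(a <- zeros P) ln (cabs (z - a)).

Definition log_factor P Q T n : R := ln n`!%:R / (n * (deg Q + deg T - 1) + deg P)%N%:R.

(** The sum over the zeros is ln |P_n(z)| minus the logarithm of the leading coefficient. By
    [deriv_num_asymp] it equals ln n! + n L up to a bounded error, and the degree divides it. *)
Lemma log_mean_cvg P Q T (a : C) (z : R * R) : P != 0 -> Q \is monic -> (1 <= deg T)%N ->
  (2 <= deg Q)%N -> coprimep P Q -> uniq (zeros Q) -> a \in zeros Q -> toC z \notin zeros Q ->
  (forall b, b \in zeros Q -> b != a -> cabs (toC z - a) < cabs (toC z - b)) ->
  (\forall n \near \oo, (deriv_num P Q T n).[toC z] != 0) /\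
  (log_mean (deriv_num P Q T n) (toC z) - log_factor P Q T n @[n --> \oo] --> Psi_formula Q T z).
Proof.
move=> P0 Qm t1 q2 cPQ uQ aQ zQ near; set w := toC z in zQ near *.
have Q0 := monic_neq0 Qm.
have T0 : T != 0 by apply: contraTneq t1 => ->; rewrite /deg size_poly0.
have Pa : P.[a] != 0.
  apply: (@coprimep_root _ Q); first by rewrite coprimep_sym.
  by rewrite /root -mem_zeros.
have zb b : b \in zeros Q -> 0 < cabs (w - b).
  by move=> bQ; rewrite cabs_gt0 subr_eq0; apply: contraNneq zQ => ->.
have wa0 := zb a aQ.
have near' b : b \in zeros Q -> cabs (w - a) <= cabs (w - b).
  by move=> bQ; have [->//|ba] := eqVneq b a; exact/ltW/near.
have [c [K [N [c0 K0 HN]]]] := deriv_num_asymp T uQ aQ zQ near Pa.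
move: HN; rewrite /= -(monic_zerosE Qm) => HN.
pose F := deriv_num P Q T.
have Qz : Q.[w] != 0 by rewrite -mem_zeros.
have Qz0 : 0 < cabs Q.[w] by rewrite cabs_gt0.
have fact0 n : 0 < n`!%:R :> R by rewrite ltr0n fact_gt0.
have den0 n : 0 < n`!%:R * cabs Q.[w] ^+ n.+1 by rewrite mulr_gt0 // exprn_gt0.
have F0 n : (N <= n)%N -> (F n).[w] != 0.
  move=> Nn; apply/eqP => Fn0; have /andP[+ _] := HN n Nn.
  by rewrite -/(F n) Fn0 cabs0 !mul0r => /(lt_le_trans c0); rewrite ltxx.
split; first by exists N => // n /= Nn; exact: F0.
have d0 : 0 < cabs (lead_coef T) * (deg T)%:R.
  by rewrite mulr_gt0 ?ltr0n // cabs_gt0 lead_coef_eq0.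
have lP0 : 0 < cabs (lead_coef P) by rewrite cabs_gt0 lead_coef_eq0.
(* The coefficient of n: the first two terms come from Q^(n+1) / (z - a)^n, the last one from the
   leading coefficient. *)
pose L := ln (cabs Q.[w]) - ln (cabs (w - a)) - ln (cabs (lead_coef T) * (deg T)%:R).
have -> : Psi_formula Q T z = L / (deg Q + deg T - 1)%N%:R.
  rewrite /Psi_formula -/w (max_seq_nearest aQ _ near'); last first.
    by rewrite -subr_eq0 -cabs_gt0.
  by rewrite /L mulrC; congr (_ * _); ring.
pose V n := \sum_(b <- zeros (F n)) ln (cabs (w - b)) - ln n`!%:R.
have -> : (fun n => log_mean (F n) w - log_factor P Q T n) =
    (fun n => (n%:R * L + (V n - n%:R * L)) / (n * (deg Q + deg T - 1) + deg P)%N%:R).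
  apply/funext => n; rewrite /log_mean /log_factor deriv_num_deg //.
  by rewrite addrCA subrr addr0 /V mulrBl mulrC.
apply: (@cvg_affine_ratio _ _
  (`|ln (cabs Q.[w]) - ln (cabs (lead_coef P))| + `|ln c| + `|ln K|)).
  by rewrite -addnBA //; apply: leq_trans (ltnW q2) (leq_addr _ _).
exists N => // n /= Nn.
set e := cabs (deriv_num P Q T n).[w] * cabs (w - a) ^+ n / (n`!%:R * cabs Q.[w] ^+ n.+1) in HN.
have /andP[ce eK] : c <= e <= K by exact: HN.
have e0 : 0 < e := lt_le_trans c0 ce.
have Fw0 : 0 < cabs (F n).[w] by rewrite cabs_gt0 F0.
have -> : V n - n%:R * L = ln (cabs Q.[w]) - ln (cabs (lead_coef P)) + ln e.
  have -> : ln e = ln (cabs (F n).[w]) + n%:R * ln (cabs (w - a))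
      - (ln n`!%:R + n.+1%:R * ln (cabs Q.[w])).
    rewrite /e ln_div ?posrE ?den0 ?mulr_gt0 ?exprn_gt0 //.
    by rewrite !lnM ?posrE ?exprn_gt0 // !lnXn // !mulr_natl.
  have -> : ln (cabs (F n).[w]) = n%:R * ln (cabs (lead_coef T) * (deg T)%:R)
      + ln (cabs (lead_coef P)) + \sum_(b <- zeros (F n)) ln (cabs (w - b)).
    rewrite cabs_horner_zeros (deriv_num_lead n P0 Qm t1).2 !cabsM cabsX cabsM cabs_natr.
    have wz b : b \in zeros (F n) -> 0 < cabs (w - b).
      move=> bz; rewrite cabs_gt0 subr_eq0; apply: contraTneq bz => <-.
      by rewrite mem_zeros ?F0 // deriv_num_neq0.
    have P1 : 0 < \prod_(b <- zeros (F n)) cabs (w - b).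
      by rewrite big_seq; apply: prodr_gt0 => b; exact: wz.
    rewrite lnM ?posrE ?mulr_gt0 ?exprn_gt0 // lnM ?posrE ?exprn_gt0 //.
    rewrite (@ln_prod_seq _ _ (fun b => cabs (w - b)) wz).
    by rewrite lnXn // mulr_natl.
  rewrite /V /L -(addn1 n) natrD; ring.
have lce : ln c <= ln e by rewrite ler_ln ?posrE.
have leK : ln e <= ln K by rewrite ler_ln ?posrE.
rewrite -[leRHS]addrA; apply: (le_trans (ler_normD _ _)); rewrite lerD2l.
rewrite ler_norml; have := ler_norm (ln K); have := ler_norm (- ln c); rewrite normrN.
have := normr_ge0 (ln K); have := normr_ge0 (ln c).
by move=> *; apply/andP; split; lra.
Qed.

End leading_terms.

(** * Lebesgue measure on the plane *)

Section plane_measurability.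
Variable R : realType.

(** The link between the product topology and the product sigma-algebra: U is the union of the boxes
    with rational centre and inverse integer size that it contains. *)
Lemma open_plane_measurable (U : set (R * R)) : open U -> measurable (U : set (plane R)).
Proof.
move=> oU.
pose B (i : rat * rat * nat) : set (plane R) :=
  `]ratr i.1.1 - i.2.+1%:R^-1, ratr i.1.1 + i.2.+1%:R^-1[%classic `*`
  `]ratr i.1.2 - i.2.+1%:R^-1, ratr i.1.2 + i.2.+1%:R^-1[%classic.
have -> : (U : set (plane R)) = \bigcup_i (if `[< B i `<=` U >] then B i else set0).
  apply/seteqP; split => [[x y] Uxy|z [i _]]; last first.
    by case: ifPn => // /asboolP; apply.
  have /nbhs_ballP[e /= e0 He] : nbhs (x, y) U by exact: open_nbhs_nbhs.
  pose n := Num.truncn (2 / e); pose d : R := n.+1%:R^-1.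
  have d0 : 0 < d by rewrite invr_gt0.
  have de : d + d <= e.
    have h : 2 / e < n.+1%:R by exact: truncnS_gt.
    have -> : d + d = 2 * d by ring.
    rewrite /d ler_pdivrMr // mulrC -ler_pdivrMr //; exact: ltW.
  have [a] : exists a : rat, ratr a \in `]x - d, x + d[.
    by apply: rat_in_itvoo; lra.
  have [b] : exists b : rat, ratr b \in `]y - d, y + d[.
    by apply: rat_in_itvoo; lra.
  rewrite !in_itv /= => /andP[b1 b2] /andP[a1 a2].
  exists (a, b, n) => //; case: ifPn; last first.
    move/asboolP; apply: contra_notP => _ [u v] [] /=.
    rewrite !in_itv /= => /andP[u1 u2] /andP[v1 v2]; apply: He.
    by split; rewrite /ball /= ltr_norml; apply/andP; split; rewrite -/d in u1 u2 v1 v2; lra.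
  by move=> _; split => /=; rewrite in_itv /= -/d; apply/andP; split; lra.
apply: countable_bigcupT_measurable => [|i]; first exact: countableP.
by case: ifP => // _; apply: measurableX; exact: measurable_itv.
Qed.

Lemma closed_plane_measurable (F : set (R * R)) : closed F -> measurable (F : set (plane R)).
Proof. by move/closed_openC/open_plane_measurable/measurableC; rewrite setCK. Qed.

Lemma compact_plane_measurable (K : set (R * R)) : compact K -> measurable (K : set (plane R)).
Proof.
move=> cK; apply: closed_plane_measurable; apply: compact_closed => //.
Qed.

Lemma continuous_plane_measurable (f : R * R -> R) :
  continuous f -> measurable_fun setT (f : plane R -> R).
Proof.
move=> /continuousP cf; apply: (measurability _ (RGenOpens.measurableE R)).
move=> _ [_ [a [b ->] <-]]; rewrite setTI; apply: open_plane_measurable.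
exact/cf/interval_open.
Qed.

Definition square (A : R) : set (R * R) := [set z | `|z.1| <= A /\ `|z.2| <= A].

Lemma squareE A : square A = `[- A, A]%classic `*` `[- A, A]%classic.
Proof.
apply/seteqP; split=> z /=; rewrite !in_itv /= -!ler_norml => -[]; by split.
Qed.

Lemma measurable_square A : measurable (square A : set (plane R)).
Proof. by rewrite squareE; apply: measurableX; exact: measurable_itv. Qed.

Lemma compact_sub_square (K : set (R * R)) : compact K -> exists2 A, 0 < A & K `<=` square A.
Proof.
move=> /compact_bounded [M [Mr HM]]; exists (`|M| + 1); first by rewrite ltr_wpDl.
move=> z Kz; have : `|z| <= `|M| + 1 by apply: HM => //; rewrite ltr_pwDr // ler_norm.
by rewrite /square /= prod_normE ge_max => /andP[].
Qed.

Lemma leb2E (A : set (plane R)) :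
  @leb2 R A = (@lebesgue_measure R \x @lebesgue_measure R)%E A.
Proof. by []. Qed.

Lemma leb2_square A : 0 <= A -> @leb2 R (square A) = ((2 * A) ^+ 2)%:E.
Proof.
move=> A0; rewrite squareE leb2E product_measure1E; do 2?exact: measurable_itv.
rewrite /= lebesgue_measure_itv lte_fin; case: ltP => h; last first.
  have -> : A = 0 by lra.
  by rewrite mulr0 expr0n mule0.
by rewrite -EFinB -EFinM; congr (_%:E); ring.
Qed.

Lemma measurable_line (a b c : R) :
  measurable ([set z | a * z.1 + b * z.2 = c] : set (plane R)).
Proof.
apply: closed_plane_measurable.
have -> : [set z : R * R | a * z.1 + b * z.2 = c] =
  (fun z : R * R => a * z.1 + b * z.2) @^-1` [set c] by [].
apply: closed_comp; last exact: closed_eq.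
move=> z _; apply: cvgD; apply: cvgM; try exact: cvg_cst; [exact: cvg_fst|exact: cvg_snd].
Qed.

Lemma line_negligible (a b c : R) : (a != 0) || (b != 0) ->
  @leb2 R [set z | a * z.1 + b * z.2 = c] = 0%E.
Proof.
move=> ab; set L := [set z | _].
have mL : measurable (L : set (plane R)) by exact: measurable_line.
rewrite leb2E /product_measure1 /=.
rewrite (@ae_eq_integral _ _ _ _ setT (cst 0%E)) //.
- by rewrite integral0.
- exact: (measurable_fun_xsection lebesgue_measure mL).
have [b0|b0] := eqVneq b 0; last first.
  apply: aeW => x _ /=.
  have -> : xsection L x = [set (c - a * x) / b].
    apply/seteqP; split => y; rewrite /xsection /= inE /L /=.
      by move=> <-; field.
    by move=> ->; field.
  exact: lebesgue_measure_set1.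
have a0 : a != 0 by move: ab; rewrite b0 eqxx orbF.
exists [set c / a]; split; first exact: measurable_set1.
  exact: lebesgue_measure_set1.
move=> x /= H; apply/eqP; apply: contrapT => xc; apply: H => _.
have -> : xsection L x = set0; last exact: measure0.
apply/seteqP; split => y //; rewrite /xsection /= inE /L /= b0 mul0r addr0 => axc.
by apply: xc; rewrite -axc; apply/eqP; field.
Qed.

Lemma line_ae (a b c : R) : (a != 0) || (b != 0) ->
  {ae @leb2 R, forall z, a * z.1 + b * z.2 != c}.
Proof.
move=> ab; exists [set z | a * z.1 + b * z.2 = c]; split.
- exact: measurable_line.
- exact: line_negligible.
- by move=> z /= /negP; rewrite negbK => /eqP.
Qed.

End plane_measurability.

Section image_measure.
Context d d' (T1 : measurableType d) (T2 : measurableType d') (R : realType).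
Variables (m : {measure set T1 -> \bar R}) (f : T1 -> T2).
Hypothesis mf : measurable_fun setT f.

Definition image_measure : {measure set T2 -> \bar R}.
Proof. by refine (pushforward m f : {measure set T2 -> \bar R}); exact: mf. Defined.

Lemma ge0_integral_image_measure (g : T2 -> \bar R) :
  measurable_fun setT g -> (forall y, 0 <= g y)%E ->
  (\int[image_measure]_y g y = \int[m]_x g (f x))%E.
Proof. by move=> mg g0; rewrite /image_measure ge0_integral_pushforward. Qed.

End image_measure.

(** * Affine changes of variable on the line *)

Section affine_change.
Variable R : realType.
Local Notation mu := (@lebesgue_measure R).
Implicit Types (c d : R).

Lemma measurable_affine c d : measurable_fun setT (fun x : measurableTypeR R => (c * x + d : measurableTypeR R)).
Proof.
apply: (@continuous_measurable_fun R) => x.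
by apply: cvgD; [apply: cvgMl_tmp; exact: cvg_id|exact: cvg_cst].
Qed.

Lemma lebesgue_measure_affine c d (A : set R) : c != 0 -> measurable A ->
  mu A = (`|c|%:E * mu ((fun x => c * x + d)%R @^-1` A))%E.
Proof.
move=> c0 mA; have c0' : 0 <= `|c| by [].
have mphi := measurable_affine c d.
pose m := mscale (NngNum c0') (image_measure mu mphi).
rewrite (_ : (`|c|%:E * _)%E = m A) //; apply: lebesgue_measure_unique => //.
move=> _ [[a b]] _ <- /=; rewrite /m /mscale /= /pushforward /=.
(* A negative factor exchanges the ends, so the preimage of a left-open interval is then right-open;
   the length computation is the same. *)
move: c0; case: (ltgtP c 0) => // sc _.
  have -> : (fun x => c * x + d) @^-1` `]a, b] = `[(b - d) / c, (a - d) / c[%classic.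
    apply/seteqP; split=> x; rewrite /= !in_itv /= => /andP[h1 h2]; apply/andP; split.
    - by rewrite ler_ndivrMr // mulrC; lra.
    - by rewrite ltr_ndivlMr // mulrC; lra.
    - by rewrite ltr_ndivlMr // mulrC in h2; lra.
    - by rewrite ler_ndivrMr // mulrC in h1; lra.
  rewrite !lebesgue_measure_itv /= !lte_fin ltr_ndivrMr // divfK ?lt_eqF // ltrD2r.
  case: ltP => _; rewrite ?mule0 // -!EFinB -EFinM ltr0_norm //; congr (_%:E).
  by field; rewrite lt_eqF.
have -> : (fun x => c * x + d) @^-1` `]a, b] = `](a - d) / c, (b - d) / c]%classic.
  apply/seteqP; split=> x; rewrite /= !in_itv /= => /andP[h1 h2]; apply/andP; split.
  - by rewrite ltr_pdivrMr // mulrC; lra.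
  - by rewrite ler_pdivlMr // mulrC; lra.
  - by rewrite ltr_pdivrMr // mulrC in h1; lra.
  - by rewrite ler_pdivlMr // mulrC in h2; lra.
rewrite !lebesgue_measure_itv /= !lte_fin ltr_pdivrMr // divfK ?gt_eqF // ltrD2r.
case: ltP => _; rewrite ?mule0 // -!EFinB -EFinM gtr0_norm //; congr (_%:E).
by field; rewrite gt_eqF.
Qed.

Lemma ge0_integral_affine c d (f : R -> \bar R) : c != 0 ->
  measurable_fun setT f -> (forall x, 0 <= f x)%E ->
  (\int[mu]_x f x = `|c|%:E * \int[mu]_x f (c * x + d)%R)%E.
Proof.
move=> c0 mf f0; have c0' : 0 <= `|c| by [].
have mphi := measurable_affine c d.
pose m := mscale (NngNum c0') (image_measure mu mphi).
transitivity (\int[m]_x f x)%E.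
  apply: eq_measure_integral => A mA _.
  by rewrite /m /mscale /= /pushforward /=; exact: lebesgue_measure_affine.
rewrite /m ge0_integral_mscale //=; congr (_ * _)%E.
exact: ge0_integral_image_measure.
Qed.

(** Half-lines are encoded by this factor in the integrand, so that all integrals stay over the
    whole line or plane and Tonelli applies directly. *)
Definition unit_step (x : R) : R := (0 < x)%R%:R.

Lemma unit_step_ge0 x : 0 <= unit_step x. Proof. exact: ler0n. Qed.

Lemma measurable_unit_step : measurable_fun setT unit_step.
Proof.
rewrite (_ : unit_step = \1_[set x | 0 < x]); last first.
  by apply/funext => x; rewrite indicE /unit_step; case: ltP => h; [rewrite mem_set|rewrite memNset] => //=; rewrite ltNge h.
by apply: measurable_indic; rewrite -set_itvoy; exact: measurable_itv.
Qed.

(** The two half-lines issued from c cover everything but the null set {c}. *)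
Lemma ge0_integral_half_lines (c : R) (f : R -> \bar R) : measurable_fun setT f ->
  (forall x, 0 <= f x)%E ->
  (\int[mu]_x f x = \int[mu]_x (f (c + 1 * x)%R * (unit_step x)%:E) +
    \int[mu]_x (f (c + (-1) * x)%R * (unit_step x)%:E))%E.
Proof.
move=> mf f0.
have m1 sg : measurable_fun setT (fun x => (f x * (unit_step (sg * (x - c)))%:E)%E).
  apply: emeasurable_funM => //; apply/measurable_EFinP.
  apply: (measurableT_comp measurable_unit_step).
  by apply: measurable_funM => //; exact: measurable_funB.
have E sg : sg * sg = 1 -> `|sg| = 1 ->
   (\int[mu]_x (f (c + sg * x)%R * (unit_step x)%:E) =
    \int[mu]_x (f x * (unit_step (sg * (x - c)))%:E))%E.
  move=> sg2 sg1; rewrite [RHS](@ge0_integral_affine sg c) //.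
  - rewrite sg1 mul1e; apply: eq_integral => x _.
    by rewrite addrK mulrA sg2 mul1r [c + _]addrC.
  - by rewrite -normr_gt0 sg1.
  - by move=> x; rewrite mule_ge0 // lee_fin unit_step_ge0.
rewrite !E ?mul1r ?mulrNN ?mulr1 ?normrN ?normr1 // -ge0_integralD //; last 4 first.
- by move=> x _; rewrite mule_ge0 // lee_fin unit_step_ge0.
- exact: m1.
- by move=> x _; rewrite mule_ge0 // lee_fin unit_step_ge0.
- exact: m1.
apply: ae_eq_integral => //; first by apply: emeasurable_funD; exact: m1.
exists [set c]; split; [exact: measurable_set1|exact: lebesgue_measure_set1|].
move=> x /= H; apply: contrapT => xc; apply: H => _.
rewrite mul1r mulN1r /unit_step oppr_gt0 subr_gt0 subr_lt0.
by case: (ltgtP x c) => [h|h|/xc //]; rewrite mule1 mule0 ?addr0 ?add0r ?adde0 ?add0e.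
Qed.

End affine_change.

Lemma measurable_invr (R : realType) : measurable_fun setT (@GRing.inv R).
Proof.
have -> : [set: R] = ~` [set 0] `|` [set 0] by rewrite setUC setUv.
apply/measurable_funU => //; first exact: measurableC.
split; last exact: measurable_fun_set1.
apply: open_continuous_measurable_fun; first exact/closed_openC/closed_eq.
by move=> x; rewrite inE /= => x0; apply: inv_continuous; apply/eqP.
Qed.

Section inverse_sqrt.
Variable R : realType.
Local Notation mu := (@lebesgue_measure R).

(** |x|^(-1/2) is the universal majorant below: it is locally integrable, it dominates the square of
    ln |x|, and a product of two of them dominates 1 / |z|. At 0 it takes the default value 0, so
    such bounds hold only off the coordinate lines. *)
Definition isqrt (x : R) : R := (Num.sqrt `|x|)^-1.

Lemma isqrt_ge0 x : 0 <= isqrt x.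
Proof. by rewrite invr_ge0 sqrtr_ge0. Qed.

Lemma measurable_isqrt : measurable_fun setT isqrt.
Proof.
apply: (measurableT_comp (@measurable_invr R)).
apply: (@continuous_measurable_fun R) => x.
by apply: continuous_comp; [exact: norm_continuous|exact: sqrt_continuous].
Qed.

Lemma integral_isqrt_itv (a L : R) : 0 < a -> a < L ->
  (\int[mu]_(x in `[a, L]) (isqrt x)%:E = (2 * Num.sqrt L - 2 * Num.sqrt a)%:E)%E.
Proof.
move=> a0 aL.
have sq x : a <= x -> isqrt x = (Num.sqrt x)^-1.
  by move=> ax; rewrite /isqrt ger0_norm // (le_trans (ltW a0)).
have dF x : a <= x -> is_derive x 1 (fun x => 2 * Num.sqrt x) (isqrt x).
  move=> ax; have x0 : 0 < x by exact: lt_le_trans ax.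
  have := is_deriveZ 2 (is_derive1_sqrt x0).
  move=> H; apply: (is_derive_eq H); rewrite sq // /GRing.scale /=; field.
  by rewrite gt_eqF // sqrtr_gt0.
have cF x : a <= x -> {for x, continuous (fun x : R => 2 * Num.sqrt x)}.
  by move=> ax; apply: differentiable_continuous; apply/derivable1_diffP; have [] := dF x ax.
rewrite (@continuous_FTC2 R isqrt (fun x => 2 * Num.sqrt x)) ?EFinB //.
- apply: continuous_in_subspaceT => x; rewrite inE /= in_itv /= => /andP[ax _].
  have x0 : 0 < x by exact: lt_le_trans ax.
  apply: cvgV; first by rewrite gt_eqF // sqrtr_gt0 normr_gt0 gt_eqF.
  by apply: continuous_comp; [exact: norm_continuous|exact: sqrt_continuous].
- split.
  + by move=> x; rewrite in_itv /= => /andP[/ltW ax _]; have [] := dF x ax.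
  + exact/cvg_at_right_filter/cF.
  + exact/cvg_at_left_filter/cF/ltW.
- move=> x; rewrite in_itv /= => /andP[/ltW ax _]; rewrite derive1E.
  by have [_ ->] := dF x ax.
Qed.

Lemma integral_isqrt_pos (L : R) : 0 < L ->
  (\int[mu]_(x in `]0%R, L]) (isqrt x)%:E <= (2 * Num.sqrt L)%:E)%E.
Proof.
(* The primitive 2 sqrt x is not differentiable at 0; the interval is exhausted from the right and
   monotone convergence applies. *)
move=> L0; pose F (n : nat) : set R := `[n.+1%:R^-1, L]%classic.
have FU : `]0, L]%classic = \bigcup_n F n.
  apply/seteqP; split => x /=; rewrite in_itv /=.
    move=> /andP[x0 xL]; exists (Num.truncn x^-1) => //.
    rewrite /F /= in_itv /= xL andbT -[leRHS]invrK lef_pV2 ?posrE ?invr_gt0 //.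
    by apply/ltW/truncnS_gt.
  move=> [n _]; rewrite /F /= in_itv /= => /andP[h ->]; rewrite andbT.
  by apply: lt_le_trans h; rewrite invr_gt0.
have mi n : measurable_fun (F n) (EFin \o isqrt).
  by apply/measurable_EFinP/measurable_funTS; exact: measurable_isqrt.
have cv : (\int[mu]_(x in F n) (isqrt x)%:E)%E @[n --> \oo] -->
    (\int[mu]_(x in \bigcup_n F n) (isqrt x)%:E)%E.
  apply: ge0_nondecreasing_set_cvg_integral => //.
  - move=> n m nm; rewrite subsetEset => x; rewrite /F /= !in_itv /= => /andP[h ->]; rewrite andbT.
    by apply: le_trans h; rewrite lef_pV2 ?posrE // ler_nat.
  - by move=> n; exact: measurable_itv.
  - by move=> n x _; rewrite lee_fin isqrt_ge0.
rewrite FU -(cvg_lim _ cv) //; apply: lime_le; first by apply/cvg_ex; eexists; exact: cv.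
apply: nearW => n; rewrite /F.
have [h|h] := ltP n.+1%:R^-1 L.
  by rewrite /= integral_isqrt_itv ?invr_gt0 // lee_fin lerBlDr lerDl mulr_ge0 // sqrtr_ge0.
apply: (@le_trans _ _ (\int[mu]_(x in [set L]) (isqrt x)%:E)%E).
  apply: ge0_subset_integral => //; last first.
  - move=> x /=; rewrite in_itv /= => /andP[h1 h2]; apply/eqP; rewrite eq_le h2 /=.
    exact: le_trans h h1.
  - by move=> x _; rewrite lee_fin isqrt_ge0.
  - by apply/measurable_EFinP/measurable_funTS; exact: measurable_isqrt.
rewrite integral_set1; last by [].
Qed.

Lemma integral_isqrt_shift (A xi : R) : 0 < A -> `|xi| <= A ->
  (\int[mu]_(x in `[(- A)%R, A]) (isqrt (x - xi))%:E <= (4 * Num.sqrt (2 * A))%:E)%E.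
Proof.
move=> A0 xiA; have L0 : 0 < 2 * A by rewrite mulr_gt0.
(* Translating [-A, A] by -xi keeps it inside [-2A, 2A], which no longer depends on xi. *)
pose f : R -> \bar R := (fun x => (isqrt x)%:E) \_ `[- (2 * A), 2 * A].
have mf : measurable_fun setT f.
  apply/(measurable_restrictT _ (measurable_itv _))/measurable_funTS/measurable_EFinP.
  exact: measurable_isqrt.
have f0 x : (0 <= f x)%E by apply: erestrict_ge0 => y _; rewrite lee_fin isqrt_ge0.
have fN (x : R) : f (- x) = f x.
  rewrite /f /patch !mem_setE !in_itv /= lerN2 (lerNl x) andbC.
  by rewrite /isqrt normrN.
apply: (@le_trans _ _ (\int[mu]_x f x)%E).
  rewrite [leRHS](@ge0_integral_affine R 1 (- xi)) ?oner_neq0 // normr1 mul1e integral_mkcond.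
  apply: ge0_le_integral => //.
  - by move=> x _; apply: erestrict_ge0 => y _; rewrite lee_fin isqrt_ge0.
  - apply/(measurable_restrictT _ (measurable_itv _))/measurable_funTS/measurable_EFinP.
    by apply: (measurableT_comp measurable_isqrt); exact: measurable_funB.
  - by apply: (measurableT_comp mf); exact: measurable_affine.
  move=> x _; rewrite /f /patch !mem_setE !in_itv /= mul1r.
  case: ifPn => [/andP[h1 h2]|_]; last by case: ifP => // _; rewrite lee_fin isqrt_ge0.
  by move: xiA; rewrite ler_norml => /andP[h3 h4]; rewrite ifT //; apply/andP; split; lra.
rewrite (ge0_integral_half_lines 0 mf f0).
have E (sg : R) : sg = 1 \/ sg = -1 ->
   (\int[mu]_x (f (0 + sg * x)%R * (unit_step x)%:E) = \int[mu]_(x in `]0%R, (2 * A)%R]) (isqrt x)%:E)%E.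
  move=> hsg; rewrite [RHS]integral_mkcond; apply: eq_integral => x _.
  rewrite (_ : f (0 + sg * x) = f x); last by case: hsg => ->; rewrite add0r ?mul1r // mulN1r fN.
  rewrite /f /patch !mem_setE !in_itv /unit_step /=.
  have [x0|x0] := ltP 0 x; last by rewrite mule0.
  by rewrite mule1 (_ : - (2 * A) <= x) //; lra.
rewrite !E; [|by right|by left].
rewrite (_ : 4 * _ = 2 * Num.sqrt (2 * A) + 2 * Num.sqrt (2 * A)); last by ring.
by rewrite EFinD; apply: leeD; exact: integral_isqrt_pos.
Qed.

End inverse_sqrt.

Section square_integrals.
Variable R : realType.
Local Notation mu := (@lebesgue_measure R).

Lemma integral_square_prod (A : R) (h k : R -> R) :
  measurable_fun setT h -> measurable_fun setT k ->
  (forall x, 0 <= h x) -> (forall x, 0 <= k x) ->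
  (\int[@leb2 R]_(z in square A) (h z.1 * k z.2)%:E =
   (\int[mu]_(x in `[(- A)%R, A]) (h x)%:E) * (\int[mu]_(x in `[(- A)%R, A]) (k x)%:E))%E.
Proof.
move=> mh mk h0 k0.
have mS : measurable (square A : set (plane R)) by exact: measurable_square.
have mI : measurable (`[- A, A]%classic : set R) by exact: measurable_itv.
have mF : measurable_fun setT (fun z : plane R => (h z.1 * k z.2)%:E).
  apply/measurable_EFinP; apply: measurable_funM.
    by apply: measurableT_comp => //.
  by apply: measurableT_comp => //.
rewrite integral_mkcond /leb2 fubini_tonelli1; last 2 first.
- by apply/(measurable_restrictT _ mS)/measurable_funTS.
- by apply: erestrict_ge0 => z _; rewrite lee_fin mulr_ge0.
have mk' : measurable_fun `[- A, A]%classic (EFin \o k).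
  exact/measurable_EFinP/measurable_funTS.
rewrite /fubini_F muleC -ge0_integralZl //; last 3 first.
- exact/measurable_EFinP/measurable_funTS.
- by move=> x _; rewrite lee_fin; exact: h0.
- by apply: integral_ge0 => x _; rewrite lee_fin; exact: k0.
rewrite [RHS]integral_mkcond; apply: eq_integral => x _.
rewrite /patch mem_setE in_itv /= -ler_norml; case: ifP => xA; last first.
  by apply: integral0_eq => y _; case: ifPn => //; rewrite inE /square /= xA => -[].
rewrite muleC -ge0_integralZl //; [|by move=> y _; rewrite lee_fin; exact: k0|by rewrite lee_fin; exact: h0].
rewrite [RHS]integral_mkcond; apply: eq_integral => y _; rewrite /patch mem_setE in_itv /= -ler_norml.
case: ifPn => [|/negP]; rewrite inE /square /= => H.
  by case: H => _ ->.
by case: ifP => // yA; case: H; rewrite xA.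
Qed.

End square_integrals.

(** * Convergence of the logarithmic potentials *)

Lemma ge0_cvge0P (R : realType) (f : nat -> \bar R) : (forall n, 0 <= f n)%E ->
  (f n @[n --> \oo] --> 0%E) <->
  (forall e : R, 0 < e -> \forall n \near \oo, (f n <= e%:E)%E).
Proof.
move=> f0; split.
  move=> /fine_cvgP[fin /cvgrPdist_le H] e e0.
  near=> n; have finn : f n \is a fin_num by near: n.
  have : `|0 - fine (f n)| <= e by near: n; exact: H.
  by rewrite sub0r normrN ger0_norm ?fine_ge0 // -lee_fin fineK.
move=> H; apply/fine_cvgP.
have fin n (e : R) : (f n <= e%:E)%E -> f n \is a fin_num.
  by move=> fe; rewrite ge0_fin_numE // (le_lt_trans fe) // ltry.
split; first by apply: filterS (H 1 ltr01) => n; exact: fin.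
apply/cvgrPdist_le => e e0; apply: filterS (H e e0) => n fe.
have fn := fin _ _ fe.
by rewrite sub0r normrN ger0_norm ?fine_ge0 // -lee_fin fineK.
Unshelve. all: by end_near. Qed.

(** * From an L2 bound modulo constants to convergence in L1 *)

Section L1_of_L2.
Context d (T : measurableType d) (R : realType).
Variables (mu : {measure set T -> \bar R}) (D : set T) (m : R).
Hypotheses (mD : measurable D) (muD : mu D = m%:E) (m0 : 0 < m).

(** Common form of the domination estimates; a slot that is not wanted receives the zero
    function. *)
Lemma integral_le_lin3 (f u1 u2 u3 : T -> R) (c0 c1 c2 c3 m1 m2 m3 : R) :
  measurable_fun D f -> measurable_fun D u1 -> measurable_fun D u2 -> measurable_fun D u3 ->
  (forall x, D x -> 0 <= f x) -> (forall x, D x -> 0 <= u1 x) ->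
  (forall x, D x -> 0 <= u2 x) -> (forall x, D x -> 0 <= u3 x) ->
  0 <= c0 -> 0 <= c1 -> 0 <= c2 -> 0 <= c3 ->
  (\int[mu]_(x in D) (u1 x)%:E <= m1%:E)%E ->
  (\int[mu]_(x in D) (u2 x)%:E <= m2%:E)%E ->
  (\int[mu]_(x in D) (u3 x)%:E <= m3%:E)%E ->
  (forall x, D x -> f x <= c0 + c1 * u1 x + c2 * u2 x + c3 * u3 x) ->
  (\int[mu]_(x in D) (f x)%:E <= (c0 * m + c1 * m1 + c2 * m2 + c3 * m3)%:E)%E.
Proof.
move=> mf mu1 mu2 mu3 f0 u10 u20 u30 c00 c10 c20 c30 i1 i2 i3 fle.
have mM (c : R) (u : T -> R) : measurable_fun D u -> measurable_fun D (fun x => (c * u x)%:E).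
  by move=> mu'; apply/measurable_EFinP; apply: measurable_funM.
have int_scale (c : R) (u : T -> R) (k : R) : measurable_fun D u -> (forall x, D x -> 0 <= u x) -> 0 <= c ->
    (\int[mu]_(x in D) (u x)%:E <= k%:E)%E -> (\int[mu]_(x in D) (c * u x)%:E <= (c * k)%:E)%E.
  move=> mu' u0 c0' ik; under eq_integral do rewrite EFinM.
  rewrite ge0_integralZl // ?lee_fin //; last exact/measurable_EFinP.
  by rewrite EFinM lee_wpmul2l ?lee_fin.
apply: (@le_trans _ _ (\int[mu]_(x in D)
   (c0%:E + (c1 * u1 x)%:E + (c2 * u2 x)%:E + (c3 * u3 x)%:E))%E).
  apply: ge0_le_integral => //.
  - exact/measurable_EFinP.
  - by do ![apply: emeasurable_funD => //]; exact: mM.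
have n0 (c : R) (u : T -> R) x : 0 <= c -> (forall x, D x -> 0 <= u x) -> D x -> (0 <= (c * u x)%:E)%E.
  by move=> ? uu ?; rewrite lee_fin mulr_ge0 // uu.
rewrite ge0_integralD //; first last.
- exact: mM.
- by move=> x Dx; apply: n0.
- by do ![apply: emeasurable_funD => //]; exact: mM.
- by move=> x Dx; rewrite !adde_ge0 ?lee_fin ?mulr_ge0 // ?u10 ?u20.
rewrite ge0_integralD //; first last.
- exact: mM.
- by move=> x Dx; apply: n0.
- by do ![apply: emeasurable_funD => //]; exact: mM.
- by move=> x Dx; rewrite !adde_ge0 ?lee_fin ?mulr_ge0 // ?u10.
rewrite ge0_integralD //; first last.
- exact: mM.
- by move=> x Dx; apply: n0.
rewrite !EFinD integral_cst // muD -EFinM; do 2!(apply: leeD; last exact: int_scale).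
by apply: leeD => //; exact: int_scale.
Qed.

Variables (w : nat -> T -> R) (C : nat -> R) (psi : T -> R) (M : R).
Hypotheses (mw : forall n, measurable_fun D (w n)) (mpsi : measurable_fun D psi).
Hypotheses (w2 : forall n, (\int[mu]_(x in D) (w n x ^+ 2)%:E <= M%:E)%E)
  (psi2 : (\int[mu]_(x in D) (psi x ^+ 2)%:E <= M%:E)%E).
Hypothesis cvg_psi : {ae mu, forall x, D x -> w n x + C n @[n --> \oo] --> psi x}.

Let g n x := w n x + C n - psi x.
Let s n x := Num.min `|g n x| 1.

Let mg n : measurable_fun D (g n).
Proof. by apply: measurable_funB => //; apply: measurable_funD. Qed.

Let mng n : measurable_fun D (fun x => `|g n x|).
Proof. exact: measurableT_comp. Qed.

Let ms n : measurable_fun D (s n).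
Proof. by apply: measurable_minr. Qed.

Let s0 n x : 0 <= s n x. Proof. by rewrite /s le_min normr_ge0 ler01. Qed.
Let s1 n x : s n x <= 1. Proof. by rewrite /s ge_min lexx orbT. Qed.

Let cvg_int_s : (\int[mu]_(x in D) (s n x)%:E)%E @[n --> \oo] --> 0%E.
Proof.
have [|||||_ _] := @dominated_convergence _ _ _ mu D mD (fun n x => (s n x)%:E) (cst 0%E) (cst 1%E).
- by move=> n; exact/measurable_EFinP.
- exact: measurable_cst.
- apply: filterS cvg_psi => x H Dx; apply: cvg_EFin; first exact: nearW.
  have h : `|g n x| @[n --> \oo] --> (0 : R).
    rewrite -(normr0 R); apply: cvg_norm; rewrite -(subrr (psi x)).
    by apply: cvgB; [exact: H|exact: cvg_cst].
  apply: (@squeeze_cvgr _ _ _ _ (fun _ => 0) (fun n => `|g n x|)) => //; last exact: cvg_cst.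
  by apply: nearW => n /=; rewrite s0 /s ge_min lexx.
- apply/integrableP; split => //.
  by under eq_integral do rewrite abse1; rewrite integral_cst // mul1e muD ltry.
- by apply: aeW => x n _; rewrite /= lee_fin ger0_norm.
by rewrite integral0.
Qed.

Let small_int_s e : 0 < e -> \forall n \near \oo, (\int[mu]_(x in D) (s n x)%:E <= e%:E)%E.
Proof.
move: e; apply: (ge0_cvge0P _).1; last exact: cvg_int_s.
by move=> n; apply: integral_ge0 => x _; rewrite lee_fin.
Qed.

(** Pointwise |C| <= 3 + psi^2 + w^2 + |C| min(|g|, 1): either |g| < 1 and C is controlled by psi
    and w, or the last term is |C| itself. Once the integral of min(|g|, 1) is at most m / 2,
    integrating leaves at most half of |C| m on the right. *)
Lemma shift_bounded : exists K : R, \forall n \near \oo, `|C n| <= K.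
Proof.
exists (2 * (3 * m + M + M) / m).
have e0 : 0 < m / 2 by rewrite divr_gt0.
apply: filterS (small_int_s e0) => n Hn.
have : (\int[mu]_(x in D) (`|C n|)%:E <=
    (3 * m + 1 * M + 1 * M + `|C n| * (m / 2))%:E)%E.
  apply: (@integral_le_lin3 _ (fun x => psi x ^+ 2) (fun x => w n x ^+ 2) (s n)) => //.
  - exact: measurable_funX.
  - exact: measurable_funX.
  - by move=> x _; rewrite sqr_ge0.
  - by move=> x _; rewrite sqr_ge0.
  move=> x _; rewrite !mul1r.
  have sq (y : R) : `|y| <= 1 + y ^+ 2.
    by have := normr_ge0 y; rewrite -(real_normK (num_real y)); nra.
  have c1 : `|C n| <= `|g n x| + `|psi x| + `|w n x|.
    have -> : C n = g n x + psi x - w n x by rewrite /g; ring.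
    by apply: (le_trans (ler_normB _ _)); rewrite lerD2r ler_normD.
  have := sq (psi x); have := sq (w n x); have := normr_ge0 (C n).
  have := sqr_ge0 (psi x); have := sqr_ge0 (w n x).
  rewrite /s; have [g1|g1] := ltP `|g n x| 1.
    by move=> *; rewrite ler_wpDr ?mulr_ge0 //; lra.
  by rewrite mulr1; lra.
rewrite integral_cst // muD -EFinM lee_fin !mul1r => H.
rewrite ler_pdivlMr //; lra.
Qed.

(* Since min(|g_n|, 1) tends to 0 in L1 by dominated convergence, the constants
   C n are bounded; then |g| <= A min(|g|, 1) + g^2 / A gives the convergence. *)
Lemma L1_cvg_of_L2_bounded : (\int[mu]_(x in D) (`|w n x + C n - psi x|)%:E)%E @[n --> \oo] --> 0%E.
Proof.
have [K HK] := shift_bounded.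
have K0 : 0 <= `|K| by [].
have M0 : 0 <= M.
  by rewrite -lee_fin; apply: le_trans psi2; apply: integral_ge0 => x _; rewrite lee_fin sqr_ge0.
(* G bounds the integral of g_n^2, by (C + w - psi)^2 <= 3 (C^2 + w^2 + psi^2). *)
pose G := 3 * K ^+ 2 * m + 3 * M + 3 * M.
have G0 : 0 <= G.
  have h : 0 <= K ^+ 2 * m by rewrite mulr_ge0 ?sqr_ge0 // ltW.
  by rewrite /G -mulrA; move: (K ^+ 2 * m) h => u h; move: (M) M0 => v v0; lra.
apply: (ge0_cvge0P _).2; first by move=> n; apply: integral_ge0 => x _; rewrite lee_fin.
move=> e e0; pose A := 1 + 2 * G / e.
have A1 : 1 <= A by rewrite lerDl divr_ge0 ?mulr_ge0 // ltW.
have A0 : 0 < A := lt_le_trans ltr01 A1.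
have e1 : 0 < e / (2 * A) by rewrite divr_gt0 // mulr_gt0.
near=> n.
have CK : `|C n| <= K by near: n.
have sn : (\int[mu]_(x in D) (s n x)%:E <= (e / (2 * A))%:E)%E by near: n; exact: small_int_s.
apply: (@le_trans _ _ ((0 * m + A * (e / (2 * A)) + A^-1 * G + 0 * 0)%:E)).
  apply: (@integral_le_lin3 _ (s n) (fun x => g n x ^+ 2) (fun => 0)) => //.
  - exact: mng.
  - exact: measurable_funX.
  - by move=> x _; rewrite sqr_ge0.
  - exact: ltW.
  - by rewrite invr_ge0 ltW.
  - have -> : G = (3 * K ^+ 2 * m + 3 * M + 3 * M + 0 * 0) by rewrite /G; ring.
    apply: (@integral_le_lin3 _ (fun x => psi x ^+ 2) (fun x => w n x ^+ 2) (fun => 0)) => //.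
    - exact: measurable_funX.
    - exact: measurable_funX.
    - exact: measurable_funX.
    - by move=> x _; rewrite sqr_ge0.
    - by move=> x _; rewrite sqr_ge0.
    - by move=> x _; rewrite sqr_ge0.
    - by rewrite mulr_ge0 // sqr_ge0.
    - by rewrite integral0.
    move=> x _; rewrite mulr0 addr0.
    have : C n ^+ 2 <= K ^+ 2 by rewrite -(real_normK (num_real (C n))) ler_sqr ?nnegrE // (le_trans _ CK).
    rewrite /g; move: (C n) (w n x) (psi x) => c u v.
    have := sqr_ge0 (c - u); have := sqr_ge0 (c + v); have := sqr_ge0 (u + v).
    by nra.
  - by rewrite integral0.
  move=> x _; rewrite mulr0 addr0 add0r /s.
  have := normr_ge0 (g n x); rewrite -[X in _ -> _ <= _ + _ * X](real_normK (num_real (g n x))).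
  move: `|g n x| => y y0; have [y1|y1] := ltP y 1.
    by rewrite ler_wpDr ?mulr_ge0 ?invr_ge0 ?sqr_ge0 ?(ltW A0) // ler_peMl.
  rewrite mulr1 -(ler_pM2l A0) mulrDr mulrA divff ?gt_eqF // mul1r.
  by have := sqr_ge0 (y - A); nra.
rewrite lee_fin mul0r mulr0 add0r addr0.
have -> : A * (e / (2 * A)) = e / 2 by field; rewrite gt_eqF.
have : A^-1 * G <= e / 2.
  rewrite mulrC ler_pdivrMr // /A mulrDr mulr1.
  have -> : e / 2 * (2 * G / e) = G by field; rewrite gt_eqF.
  by rewrite lerDr divr_ge0 // ltW.
by lra.
Unshelve. all: by end_near. Qed.

End L1_of_L2.

(** * Uniform L2 bounds for logarithmic kernels *)

Section log_kernel.
Variable R : realType.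
Local Notation C := R[i].
Implicit Types (z : R * R) (a : C).

Lemma cabs_toC z a :
  cabs (toC z - a) = Num.sqrt ((z.1 - complex.Re a) ^+ 2 + (z.2 - complex.Im a) ^+ 2).
Proof. by case: a. Qed.

Lemma cabs_toC_ge1 z a : `|z.1 - complex.Re a| <= cabs (toC z - a).
Proof. by rewrite cabs_toC -sqrtr_sqr ler_wsqrtr // lerDl sqr_ge0. Qed.

Lemma Re_le_cabs a : `|complex.Re a| <= cabs a.
Proof. by case: a => u v; rewrite /cabs /= -sqrtr_sqr ler_wsqrtr // lerDl sqr_ge0. Qed.

Lemma cabs_toC_le z : cabs (toC z) <= `|z.1| + `|z.2|.
Proof.
rewrite /cabs /= -(ger0_norm (addr_ge0 (normr_ge0 z.1) (normr_ge0 z.2))) -sqrtr_sqr.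
rewrite ler_wsqrtr // sqrrD !real_normK ?num_real //.
by rewrite lerD2r lerDl pmulrn_lge0 // mulr_ge0.
Qed.

Lemma continuous_cabs_toC a : continuous (fun z : R * R => cabs (toC z - a)).
Proof.
have -> : (fun z : R * R => cabs (toC z - a)) = (fun z => Num.sqrt
    ((z.1 - complex.Re a) * (z.1 - complex.Re a) + (z.2 - complex.Im a) * (z.2 - complex.Im a))).
  by apply/funext => z; rewrite cabs_toC !expr2.
move=> z.
have h1 : (w.1 - complex.Re a) @[w --> z] --> z.1 - complex.Re a.
  by apply: cvgB; [exact: cvg_fst|exact: cvg_cst].
have h2 : (w.2 - complex.Im a) @[w --> z] --> z.2 - complex.Im a.
  by apply: cvgB; [exact: cvg_snd|exact: cvg_cst].
apply: (continuous_cvg _ (@sqrt_continuous R _)).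
by apply: cvgD; apply: cvgM.
Qed.

Lemma measurable_ln_cabs a :
  measurable_fun setT ((fun z => ln (cabs (toC z - a))) : plane R -> R).
Proof.
apply: (@measurableT_comp _ _ _ _ _ _ (@ln R) _ (fun z : plane R => cabs (toC z - a))).
  exact: measurable_ln.
by apply: continuous_plane_measurable; exact: continuous_cabs_toC.
Qed.

Lemma ln_le_id (x : R) : 0 < x -> ln x <= x.
Proof.
move=> x0; have := @le_ln1Dx R (x - 1); rewrite (_ : 1 + (x - 1) = x); last by ring.
by move=> H; apply: (le_trans (H _)); lra.
Qed.

(** For r < 1, -ln r <= -ln |x| = 4 ln (|x|^(-1/4)) <= 4 |x|^(-1/4), whose square is 16 [isqrt x].
    In use r is |z - a| and x its first coordinate, which reduces the plane integral to one
    variable. *)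
Lemma sqr_ln_le (x r L : R) : x != 0 -> `|x| <= r -> r <= L -> 1 <= L ->
  ln r ^+ 2 <= L ^+ 2 + 16 * isqrt x.
Proof.
move=> x0 xr rL L1; have x0' : 0 < `|x| by rewrite normr_gt0.
have r0 : 0 < r := lt_le_trans x0' xr.
have i0 := isqrt_ge0 x; have L20 := sqr_ge0 L.
have [r1|r1] := leP 1 r.
  have l0 : 0 <= ln r by rewrite ln_ge0.
  have lr : ln r <= L by rewrite (le_trans (ln_le_id r0)).
  have : ln r ^+ 2 <= L ^+ 2 by rewrite ler_sqr ?nnegrE // (le_trans _ L1).
  by lra.
have sq0 : 0 < Num.sqrt `|x| by rewrite sqrtr_gt0.
pose s := (Num.sqrt (Num.sqrt `|x|))^-1.
have s0 : 0 < s by rewrite invr_gt0 sqrtr_gt0.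
have s4 : s ^+ 4 = `|x|^-1.
  by rewrite /s exprVn (exprM _ 2 2) !sqr_sqrtr // ltW.
have s2 : s ^+ 2 = isqrt x by rewrite /s exprVn sqr_sqrtr // ltW.
have lx : - ln `|x| = 4 * ln s by rewrite -lnV ?posrE // -s4 lnXn // mulr_natl.
have ls : ln s <= s := ln_le_id s0.
have lr0 : ln r <= 0 by rewrite ln_le0 // ltW.
have lrx : ln `|x| <= ln r by rewrite ler_ln ?posrE.
have : (- ln r) ^+ 2 <= (4 * s) ^+ 2.
  by rewrite ler_sqr ?nnegrE //; [lra|lra|rewrite mulr_ge0 // ltW].
by rewrite sqrrN exprMn s2; lra.
Qed.

Variable A : R.
Hypothesis A1 : 1 <= A.
Let A0 : 0 < A. Proof. exact: lt_le_trans A1. Qed.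
Local Notation D := (square A : set (plane R)).

(* Subtracting ln |a| for the points a far from the square makes the kernel
   bounded in L2 uniformly in a. *)
Definition log_kernel a z : R :=
  if cabs a <= 4 * A then ln (cabs (toC z - a)) else ln (cabs (toC z - a)) - ln (cabs a).

Lemma measurable_log_kernel a : measurable_fun setT (log_kernel a : plane R -> R).
Proof.
have -> : log_kernel a = if cabs a <= 4 * A then fun z => ln (cabs (toC z - a))
   else fun z => ln (cabs (toC z - a)) - ln (cabs a).
  by apply/funext => z; rewrite /log_kernel; case: ifP.
case: ifP => _; first exact: measurable_ln_cabs.
by apply: measurable_funB => //; exact: measurable_ln_cabs.
Qed.

Let mD : measurable D. Proof. exact: measurable_square. Qed.

Lemma leb2_square_fin : @leb2 R D = ((2 * A) ^+ 2)%:E.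
Proof. by apply: leb2_square; exact: ltW. Qed.

Let D0 : 0 < (2 * A) ^+ 2. Proof. by rewrite exprn_gt0 // mulr_gt0. Qed.

Lemma integral_isqrt_square a : cabs a <= 4 * A ->
  (\int[@leb2 R]_(z in D) (isqrt (z.1 - complex.Re a))%:E <=
     ((4 * Num.sqrt (2 * (4 * A))) * (2 * (4 * A)))%:E)%E.
Proof.
move=> aA; have A40 : 0 < 4 * A by rewrite mulr_gt0.
have mi : measurable_fun setT (fun x : R => isqrt (x - complex.Re a)).
  by apply: (measurableT_comp (@measurable_isqrt R)); exact: measurable_funB.
(* The point a may lie outside the square of size A; enlarging to 4 A brings its real part inside,
   as [integral_isqrt_shift] requires. *)
apply: (@le_trans _ _ (\int[@leb2 R]_(z in square (4 * A)) (isqrt (z.1 - complex.Re a) * cst 1 z.2)%:E)%E).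
  under [leRHS]eq_integral do rewrite /= mulr1.
  apply: ge0_subset_integral => //.
  - exact: measurable_square.
  - by apply/measurable_EFinP/measurable_funTS; exact: (measurableT_comp mi).
  - by move=> z _; rewrite lee_fin isqrt_ge0.
  - by move=> z [z1 z2]; split; lra.
rewrite (integral_square_prod _ mi) //; last by move=> x; rewrite isqrt_ge0.
have -> : (\int[@lebesgue_measure R]_(x in `[(- (4 * A))%R, (4 * A)%R]) (cst 1 x)%:E = (2 * (4 * A))%:E)%E.
  have := @integral_cst _ _ R (@lebesgue_measure R) `[(- (4 * A)), (4 * A)]%classic (measurable_itv _) 1%:E.
  rewrite /= lebesgue_measure_itv /= lte_fin ifT ?mul1e; last by lra.
  by rewrite -EFinB opprK => H; etransitivity; [exact: H|congr (_%:E); ring].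
rewrite [leRHS]EFinM; apply: lee_wpmul2r; first by rewrite lee_fin mulr_ge0 // ltW.
by apply: integral_isqrt_shift => //; exact: le_trans (Re_le_cabs a) aA.
Qed.

(** 2 + 6 A exceeds |z - a| on the square when |a| <= 4 A; the second summand is 16 times the bound
    of [integral_isqrt_square]. *)
Definition log_kernel_bound : R :=
  (2 + 6 * A) ^+ 2 * (2 * A) ^+ 2 + 16 * ((4 * Num.sqrt (2 * (4 * A))) * (2 * (4 * A))).

Lemma integral_sqr_log_kernel a :
  (\int[@leb2 R]_(z in D) (log_kernel a z ^+ 2)%:E <= log_kernel_bound%:E)%E.
Proof.
have mk : measurable_fun D (fun z => (log_kernel a z ^+ 2)%:E).
  by apply/measurable_EFinP/measurable_funX/measurable_funTS; exact: measurable_log_kernel.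
have zle z : D z -> cabs (toC z) <= 2 * A.
  by move=> [z1 z2]; apply: (le_trans (cabs_toC_le z)); lra.
have sq0 : 0 <= Num.sqrt (2 * (4 * A)) by rewrite sqrtr_ge0.
have [aA|aA] := leP (cabs a) (4 * A); last first.
  (* For a far point, |z| <= 2 A < |a| / 2, so |z - a| / |a| lies between 1/2 and 2 and the kernel
     is at most ln 2 <= 1 in absolute value. *)
  apply: (@le_trans _ _ (\int[@leb2 R]_(z in D) 1%:E)%E).
    apply: ge0_le_integral => //; first by move=> z _; rewrite lee_fin sqr_ge0.
    move=> z Dz; rewrite lee_fin /log_kernel (lt_geF aA).
    have a0 : 0 < cabs a by apply: lt_trans aA; rewrite mulr_gt0.
    have h1 : cabs a / 2 <= cabs (toC z - a).
      by have := zle z Dz; have := cabs_sub_le (- a) (toC z); rewrite cabsN [- a + _]addrC; lra.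
    have h2 : cabs (toC z - a) <= 2 * cabs a.
      by have := zle z Dz; have := cabsD (toC z) (- a); rewrite cabsN; lra.
    have r0 : 0 < cabs (toC z - a) by apply: lt_le_trans h1; rewrite divr_gt0.
    have a0' : 0 < cabs a / 2 by rewrite divr_gt0.
    have k1 : - ln 2 <= ln (cabs (toC z - a)) - ln (cabs a).
      have : ln (cabs a / 2) <= ln (cabs (toC z - a)) by rewrite ler_ln ?posrE.
      by rewrite ln_div ?posrE //; lra.
    have k2 : ln (cabs (toC z - a)) - ln (cabs a) <= ln 2.
      have : ln (cabs (toC z - a)) <= ln (2 * cabs a) by rewrite ler_ln ?posrE // mulr_gt0.
      by rewrite lnM ?posrE //; lra.
    have l2 : ln 2 <= 1 :> R by have := @le_ln1Dx R 1; rewrite -[1 + 1]/2; apply; lra.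
    by move: (ln (cabs (toC z - a)) - ln (cabs a)) k1 k2 => x k1 k2; have : -1 <= x <= 1; [lra|nra].
  rewrite integral_cst // mul1e leb2_square_fin lee_fin /log_kernel_bound.
  have : 0 <= 16 * ((4 * Num.sqrt (2 * (4 * A))) * (2 * (4 * A))) by rewrite !mulr_ge0 // ltW.
  by have := D0; have := A0; have : 1 <= A by []; nra.
have mI : measurable_fun D (fun z => isqrt (z.1 - complex.Re a)).
  apply: measurable_funTS; apply: (measurableT_comp (@measurable_isqrt R)).
  by apply: measurable_funB.
apply: (@le_trans _ _ (\int[@leb2 R]_(z in D) ((2 + 6 * A) ^+ 2 + 16 * isqrt (z.1 - complex.Re a))%:E)%E).
  apply: ae_ge0_le_integral => //.
  - by move=> z _; rewrite lee_fin sqr_ge0.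
  - by move=> z _; rewrite lee_fin addr_ge0 ?sqr_ge0 // mulr_ge0 // isqrt_ge0.
  - by apply/measurable_EFinP; apply: measurable_funD => //; apply: measurable_funM.
  have lae : {ae @leb2 R, forall z, 1 * z.1 + 0 * z.2 != complex.Re a}.
    by apply: line_ae; rewrite oner_neq0.
  apply: (@filterS _ _ (ae_filter_ringOfSetsType (@leb2 R)) _ _ _ lae) => z.
  rewrite mul1r mul0r addr0 => za Dz; rewrite lee_fin /log_kernel aA.
  apply: sqr_ln_le; first by rewrite subr_eq0.
  - exact: cabs_toC_ge1.
  - by have := zle z Dz; have := cabsD (toC z) (- a); rewrite cabsN; lra.
  - by move: (A1); lra.
under eq_integral do rewrite EFinD (EFinM 16).
rewrite ge0_integralD //; first last.
- by apply/measurable_EFinP; apply: measurable_funM.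
- by move=> z _; rewrite -(EFinM 16) lee_fin mulr_ge0 // isqrt_ge0.
- by move=> z _; rewrite lee_fin sqr_ge0.
rewrite integral_cst // leb2_square_fin -EFinM ge0_integralZl ?lee_fin //; first last.
- by move=> z _; rewrite lee_fin isqrt_ge0.
- exact/measurable_EFinP.
rewrite /log_kernel_bound [leRHS]EFinD; apply: leeD => //; rewrite [leRHS](EFinM 16).
by apply: lee_wpmul2l; [rewrite lee_fin|exact: integral_isqrt_square].
Qed.

Lemma jensen_sqr_mean (s : seq C) (f : C -> R) (d : nat) : d = size s ->
  ((d%:R)^-1 * \sum_(a <- s) f a) ^+ 2 <= (d%:R)^-1 * \sum_(a <- s) f a ^+ 2.
Proof.
move=> ->; case: (posnP (size s)) => [/size0nil ->|s0].
  by rewrite !big_nil !mulr0 expr0n.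
have d0 : 0 < (size s)%:R :> R by rewrite ltr0n.
set m := _ * \sum_(a <- s) f a.
have : 0 <= \sum_(a <- s) (f a - m) ^+ 2 by apply: sumr_ge0 => a _; rewrite sqr_ge0.
have -> : \sum_(a <- s) (f a - m) ^+ 2 =
   \sum_(a <- s) f a ^+ 2 - 2 * m * \sum_(a <- s) f a + (size s)%:R * m ^+ 2.
  elim: (s) => [|x u IH]; first by rewrite !big_nil /= mulr0 subr0 mul0r addr0.
  by rewrite !big_cons IH /= -[(size u).+1]addn1 natrD; ring.
have -> : \sum_(a <- s) f a = (size s)%:R * m by rewrite /m mulrA divff ?gt_eqF // mul1r.
by move=> H; rewrite [leRHS]mulrC ler_pdivlMr //; move: (\sum_(a <- s) _) H => T; nra.
Qed.

Definition kernel_mean (s : seq C) z : R := ((size s)%:R)^-1 * \sum_(a <- s) log_kernel a z.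

(** The constant removed by normalizing the far points; when zeros escape to infinity nothing bounds
    it a priori. *)
Definition kernel_shift (s : seq C) : R :=
  ((size s)%:R)^-1 * \sum_(a <- s | ~~ (cabs a <= 4 * A)) ln (cabs a).

Lemma kernel_meanE (s : seq C) z :
  ((size s)%:R)^-1 * \sum_(a <- s) ln (cabs (toC z - a)) = kernel_mean s z + kernel_shift s.
Proof.
rewrite /kernel_mean /kernel_shift -mulrDr; congr (_ * _).
rewrite [X in _ + X]big_mkcond -big_split /=; apply: eq_bigr => a _.
by rewrite /log_kernel; case: ifP => _; rewrite ?addr0 // subrK.
Qed.

Lemma measurable_kernel_mean s : measurable_fun setT (kernel_mean s : plane R -> R).
Proof.
apply: measurable_funM => //; by apply: measurable_sum => a; exact: measurable_log_kernel.
Qed.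

Lemma integral_sum_seq_le (s : seq C) (f : C -> plane R -> R) (M : R) :
  (forall a, measurable_fun setT (f a)) -> (forall a z, 0 <= f a z) ->
  (forall a, \int[@leb2 R]_(z in D) (f a z)%:E <= M%:E)%E ->
  (\int[@leb2 R]_(z in D) (\sum_(a <- s) f a z)%:E <= ((size s)%:R * M)%:E)%E.
Proof.
move=> mf f0 fM; elim: s => [|a s IH].
  by under eq_integral do rewrite big_nil; rewrite integral0 /= mul0r.
under eq_integral do rewrite big_cons EFinD.
rewrite ge0_integralD //; first last.
- by apply/measurable_EFinP/measurable_funTS; exact: measurable_sum.
- by move=> z _; rewrite lee_fin sumr_ge0.
- by apply/measurable_EFinP/measurable_funTS.
- by move=> z _; rewrite lee_fin.
by rewrite /= -[(size s).+1]addn1 natrD mulrDl mul1r addrC EFinD; exact: leeD.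
Qed.

Lemma integral_sqr_kernel_mean s :
  (\int[@leb2 R]_(z in D) (kernel_mean s z ^+ 2)%:E <= log_kernel_bound%:E)%E.
Proof.
have mk a : measurable_fun setT ((fun z => log_kernel a z ^+ 2) : plane R -> R).
  by apply: measurable_funX; exact: measurable_log_kernel.
have b0 : 0 <= log_kernel_bound.
  rewrite -lee_fin; apply: le_trans (integral_sqr_log_kernel 0).
  by apply: integral_ge0 => z _; rewrite lee_fin sqr_ge0.
apply: (@le_trans _ _ (\int[@leb2 R]_(z in D)
   (((size s)%:R)^-1%:E * (\sum_(a <- s) log_kernel a z ^+ 2)%:E))%E).
  apply: ge0_le_integral => //.
  - by move=> z _; rewrite lee_fin sqr_ge0.
  - by apply/measurable_EFinP/measurable_funX/measurable_funTS; exact: measurable_kernel_mean.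
  - apply: measurable_funeM; apply/measurable_EFinP/measurable_funTS.
    exact: measurable_sum.
  - by move=> z _; rewrite -EFinM lee_fin; exact: jensen_sqr_mean.
rewrite ge0_integralZl ?lee_fin //; first last.
- by move=> z _; rewrite lee_fin sumr_ge0 // => a _; rewrite sqr_ge0.
- apply/measurable_EFinP/measurable_funTS.
  exact: measurable_sum.
have := @integral_sum_seq_le s (fun a z => log_kernel a z ^+ 2) log_kernel_bound mk
  (fun a z => sqr_ge0 _) integral_sqr_log_kernel.
move=> H; apply: (le_trans (lee_wpmul2l _ H)); first by rewrite lee_fin.
rewrite -EFinM lee_fin mulrA; case: (size s) => [|n]; first by rewrite invr0 mul0r mul0r.
by rewrite mulVf ?mul1r // pnatr_eq0.
Qed.

End log_kernel.

Section counting_integral.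
Variable R : realType.
Local Notation C := R[i].

Lemma toC_ofC (a : C) : toC (ofC a) = a. Proof. by case: a. Qed.

(** Finiteness at the zeros turns the integral into a real sum and excludes oo - oo between positive
    and negative parts. For the logarithmic kernel it says that z is not a zero. *)
Lemma integral_zero_counting (P : {poly C}) (f : plane R -> \bar R) :
  measurable_fun setT f -> (forall a, a \in zeros P -> f (ofC a) \is a fin_num) ->
  (\int[zero_counting_measure P]_w f w =
   (((deg P)%:R : R)^-1 * \sum_(a <- zeros P) fine (f (ofC a)))%:E)%E.
Proof.
move=> mf ff.
have ge0 g : measurable_fun setT g -> (forall z, 0 <= g z)%E ->
    (forall a, a \in zeros P -> g (ofC a) \is a fin_num) ->
  (\int[zero_counting_measure P]_w g w =
   (((deg P)%:R : R)^-1 * \sum_(a <- zeros P) fine (g (ofC a)))%:E)%E.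
  move=> mg g0 fg; rewrite /zero_counting_measure ge0_integral_mscale //.
  rewrite ge0_integral_measure_sum // EFinM; congr (_ * _)%E.
  rewrite -sumEFin (big_nth 0) big_mkord.
  apply: eq_bigr => i _; rewrite integral_dirac // diracT mul1e fineK // fg //.
  by rewrite mem_nth.
have fp a : a \in zeros P -> (f^\+%E (ofC a)) = (Num.max (fine (f (ofC a))) 0)%:E.
  by move=> /ff fa; rewrite funeposE -[in LHS](fineK fa) -EFin_max.
have fn a : a \in zeros P -> (f^\-%E (ofC a)) = (Num.max (- fine (f (ofC a))) 0)%:E.
  by move=> /ff fa; rewrite funenegE -[in LHS](fineK fa) -EFinN -EFin_max.
rewrite integralE !ge0 //; last 4 first.
- exact: measurable_funeneg.
- by move=> a aP; rewrite fn.
- exact: measurable_funepos.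
- by move=> a aP; rewrite fp.
rewrite -EFinB -mulrBr -sumrB; congr (_ * _)%:E; rewrite !big_seq; apply: eq_bigr => a aP.
rewrite fp // fn //=; case: (leP 0 (fine (f (ofC a)))) => h.
  by rewrite max_r ?subr0 // oppr_le0.
by rewrite max_l ?sub0r ?opprK // oppr_ge0 ltW.
Qed.

Lemma log_potentialE (P : {poly C}) (z : R * R) : toC z \notin zeros P ->
  log_potential (zero_counting_measure P) z = (log_mean P (toC z))%:E.
Proof.
move=> zP; rewrite /log_potential integral_zero_counting.
- congr (_ * _)%:E; rewrite !big_seq; apply: eq_bigr => a aP.
  rewrite toC_ofC /lne /= leNgt cabs_gt0 subr_eq0.
  by rewrite (_ : toC z != a) //; apply: contraNneq zP => ->.
- pose A := [set w : R * R | cabs (toC w - toC z) != 0].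
  have -> : (fun w : R * R => lne (cabs (toC z - toC w))%:E) =
     fun w => if cabs (toC w - toC z) == 0 then -oo%E else (ln (cabs (toC w - toC z)))%:E.
    apply/funext => w; rewrite cabsB_sym; have := cabs_ge0 (toC w - toC z).
    move: (cabs _) => r r0; by rewrite /= eq_le r0 andbT.
  apply: measurable_fun_ifT => //.
    have -> : (fun w : plane R => cabs (toC w - toC z) == 0) = (fun w => cabs (toC w - toC z) <= 0).
      by apply/funext => w; rewrite eq_le cabs_ge0 andbT.
    apply: measurable_fun_ler => //; apply: continuous_plane_measurable.
    exact: continuous_cabs_toC.
  by apply/measurable_EFinP; exact: measurable_ln_cabs.
- move=> a aP; rewrite toC_ofC /lne leNgt cabs_gt0 subr_eq0.
  by rewrite (_ : toC z != a) //; apply: contraNneq zP => ->.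
Qed.

Lemma integral_zero_counting_fin (P : {poly C}) (f : R * R -> R) :
  measurable_fun setT (f : plane R -> R) ->
  (\int[zero_counting_measure P]_w (f w)%:E =
   (((deg P)%:R : R)^-1 * \sum_(a <- zeros P) f (ofC a))%:E)%E.
Proof. by move=> mf; rewrite integral_zero_counting //; exact/measurable_EFinP. Qed.

End counting_integral.

Lemma ae_all_seq (R : realType) d (X : measurableType d) (m : {measure set X -> \bar R}) (I : eqType)
    (s : seq I) (P : I -> X -> Prop) :
  (forall i, i \in s -> {ae m, forall z, P i z}) ->
  {ae m, forall z, forall i, i \in s -> P i z}.
Proof.
have FF := ae_filter_ringOfSetsType m.
elim: s => [|i s IH] H; first exact: (@filterS _ _ FF _ _ (fun _ _ => _) filterT).
have h1 := H i (mem_head _ _).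
have h2 := IH (fun j js => H j (@mem_behead _ (i :: s) j js)).
apply: (@filterS _ _ FF _ _ _ (@filterI _ _ FF _ _ h1 h2)) => z [Hz1 Hz2] j.
by rewrite inE => /orP[/eqP -> //|]; exact: Hz2.
Qed.

Section generic_points.
Variable R : realType.
Local Notation C := R[i].
Implicit Types (S : seq C) (z : R * R).

Lemma points_ae S : {ae @leb2 R, forall z, toC z \notin S}.
Proof.
have FF := ae_filter_ringOfSetsType (@leb2 R).
have H : {ae @leb2 R, forall z, forall a, a \in S -> 1 * z.1 + 0 * z.2 != complex.Re a}.
  by apply: ae_all_seq => a _; apply: line_ae; rewrite oner_neq0.
apply: (@filterS _ _ FF _ _ _ H) => z Hz; apply/negP => /Hz.
by rewrite mul1r mul0r addr0 eqxx.
Qed.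

Lemma equidistant_line (a b : C) z : cabs (toC z - a) = cabs (toC z - b) ->
  (2 * (complex.Re b - complex.Re a)) * z.1 + (2 * (complex.Im b - complex.Im a)) * z.2 =
  complex.Re b ^+ 2 + complex.Im b ^+ 2 - complex.Re a ^+ 2 - complex.Im a ^+ 2.
Proof.
rewrite !cabs_toC => /(congr1 (fun x => x ^+ 2)).
by rewrite !sqr_sqrtr ?addr_ge0 ?sqr_ge0 // => H; nra.
Qed.

Lemma equidistant_ae (a b : C) : a != b ->
  {ae @leb2 R, forall z, cabs (toC z - a) != cabs (toC z - b)}.
Proof.
move=> ab; have FF := ae_filter_ringOfSetsType (@leb2 R).
have n0 : (2 * (complex.Re b - complex.Re a) != 0) || (2 * (complex.Im b - complex.Im a) != 0).
  apply: contraR ab; rewrite negb_or !negbK !mulf_eq0 !pnatr_eq0 /= !subr_eq0.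
  by case: a b => a1 a2 [b1 b2] /=; rewrite eq_complex /= eq_sym [b2 == _]eq_sym.
apply: (@filterS _ _ FF _ _ _ (line_ae _ n0)) => z; apply: contraNneq => /equidistant_line ->.
exact: eqxx.
Qed.

Definition generic S z := toC z \notin S /\
  exists2 a, a \in S & forall b, b \in S -> b != a -> cabs (toC z - a) < cabs (toC z - b).

(** The exceptional points lie on finitely many lines: the vertical lines through S and the
    bisectors. *)
Lemma generic_ae S : S != [::] -> {ae @leb2 R, forall z, generic S z}.
Proof.
move=> S0; have FF := ae_filter_ringOfSetsType (@leb2 R).
have H : {ae @leb2 R, forall z, forall a, a \in S -> forall b, b \in S -> a != b ->
    cabs (toC z - a) != cabs (toC z - b)}.
  apply: ae_all_seq => a _; apply: ae_all_seq => b _.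
  case: (eqVneq a b) => [ab|ab]; last by apply: (@filterS _ _ FF _ _ _ (equidistant_ae ab)).
  by apply: (@filterS _ _ FF _ _ (fun _ _ => _) filterT).
apply: (@filterS _ _ FF _ _ _ (@filterI _ _ FF _ _ (points_ae S) H)) => z [zS Hz].
split => //; have [a aS Ha] := exists_nearest (toC z) S0.
exists a => // b bS ba; rewrite lt_neqAle Ha // andbT.
by apply: Hz => //; rewrite eq_sym.
Qed.

End generic_points.

Section limit_function.
Variable R : realType.
Local Notation C := R[i].
Implicit Types (S : seq C) (z : R * R) (P Q T : {poly C}).

(* min over S of ln |z - a|, the singular part of Psi. *)
Definition log_dist S z : R := - max_seq [seq ln (cabs (toC z - b))^-1 | b <- S].

Lemma measurable_log_dist S : measurable_fun setT (log_dist S : plane R -> R).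
Proof.
have ml b : measurable_fun setT ((fun z => ln (cabs (toC z - b))^-1) : plane R -> R).
  have -> : (fun z : plane R => ln (cabs (toC z - b))^-1) = (fun z => - ln (cabs (toC z - b))).
    apply/funext => z; have := cabs_ge0 (toC z - b); rewrite le_eqVlt => /orP[/eqP <-|r0].
      by rewrite invr0 ln0 ?oppr0.
    by rewrite lnV ?posrE.
  by apply: measurableT_comp => //; exact: measurable_ln_cabs.
rewrite /log_dist; apply: measurableT_comp => //.
have -> : (fun z : plane R => max_seq [seq ln (cabs (toC z - b))^-1 | b <- S]) =
   (fun z => \big[Num.max/head 0 [seq ln (cabs (toC z - b))^-1 | b <- S]]_(b <- S) ln (cabs (toC z - b))^-1).
  by apply/funext => z; rewrite /max_seq big_map.
have mh : measurable_fun setT ((fun z => head 0 [seq ln (cabs (toC z - b))^-1 | b <- S]) : plane R -> R).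
  by case: S => [|a S] /=.
pose hd z := head 0 [seq ln (cabs (toC z - b))^-1 | b <- S].
suff H s : measurable_fun setT ((fun z => \big[Num.max/hd z]_(b <- s) ln (cabs (toC z - b))^-1) : plane R -> R).
  exact: H.
elim: s => [|a s IH].
  by rewrite (_ : (fun z => _) = hd) //; apply/funext => z; rewrite big_nil.
rewrite (_ : (fun z => _) = (fun z => Num.max (ln (cabs (toC z - a))^-1)
   (\big[Num.max/hd z]_(b <- s) ln (cabs (toC z - b))^-1))).
  by apply: measurable_maxr; [exact: ml|exact: IH].
by apply/funext => z; rewrite big_cons.
Qed.

Lemma measurable_log_mean P :
  measurable_fun setT ((fun z => log_mean P (toC z)) : plane R -> R).
Proof.
apply: measurable_funM => //.
by apply: measurable_sum => a; exact: measurable_ln_cabs.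
Qed.

Lemma log_distE S z a : a \in S -> toC z != a ->
  (forall b, b \in S -> cabs (toC z - a) <= cabs (toC z - b)) ->
  log_dist S z = ln (cabs (toC z - a)).
Proof. by move=> aS za H; rewrite /log_dist (max_seq_nearest aS za H) opprK. Qed.

(** A measurable real representative of Psi, with ln |Q| split over the zeros; at the zeros of Q it
    takes the default values of [ln] instead of the continuous extension. *)
Definition Psi_sum Q T z : R := ((deg Q + deg T - 1)%N%:R)^-1 *
  (- log_dist (zeros Q) z + \sum_(a <- zeros Q) ln (cabs (toC z - a))
   - ln (cabs (lead_coef T) * (deg T)%:R)).

Lemma Psi_sumE Q T z : Q \is monic -> toC z \notin zeros Q ->
  Psi_formula Q T z = Psi_sum Q T z.
Proof.
move=> Qm zQ; rewrite /Psi_formula /Psi_sum /log_dist opprK; congr (_ * (_ + _ - _)).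
rewrite cabs_horner_zeros (monicP Qm) cabs1 mul1r ln_prod_seq // => a aQ.
by rewrite cabs_gt0 subr_eq0; apply: contraNneq zQ => ->.
Qed.

Lemma Psi_Psi_sum Q T z : Q \is monic -> toC z \notin zeros Q -> Psi Q T z = Psi_sum Q T z.
Proof. by move=> Qm zQ; rewrite /Psi (negbTE zQ) Psi_sumE. Qed.

Lemma measurable_Psi_sum Q T : measurable_fun setT (Psi_sum Q T : plane R -> R).
Proof.
apply: measurable_funM => //; apply: measurable_funB => //; apply: measurable_funD.
  by apply: measurableT_comp => //; exact: measurable_log_dist.
by apply: measurable_sum => a; exact: measurable_ln_cabs.
Qed.

Lemma log_dist_le S z : S != [::] -> toC z \notin S ->
  `|log_dist S z| <= \sum_(a <- S) `|ln (cabs (toC z - a))|.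
Proof.
move=> S0 zS; have [a aS Ha] := exists_nearest (toC z) S0.
have za : toC z != a by apply: contraNneq zS => ->.
rewrite (log_distE aS za Ha) (big_rem a) //= lerDl sumr_ge0 //.
Qed.

Variable A : R.
Hypothesis A1 : 1 <= A.
Local Notation D := (square A : set (plane R)).

Lemma sqr_sum_le (s : seq C) (f : C -> R) :
  (\sum_(a <- s) f a) ^+ 2 <= (size s)%:R * \sum_(a <- s) f a ^+ 2.
Proof.
case: (posnP (size s)) => [/size0nil ->|s0]; first by rewrite !big_nil mulr0 expr0n.
have := jensen_sqr_mean f (erefl (size s)).
have d0 : 0 < (size s)%:R :> R by rewrite ltr0n.
rewrite exprMn exprVn -(ler_pM2l (exprn_gt0 2 d0)) mulrA divff ?mul1r ?expf_neq0 ?gt_eqF //.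
by rewrite mulrA expr2 mulfK ?gt_eqF.
Qed.

Lemma Psi_sum_sqr Q T : Q \is monic -> zeros Q != [::] ->
  (forall a, a \in zeros Q -> cabs a <= 4 * A) ->
  exists M, (\int[@leb2 R]_(z in D) (Psi_sum Q T z ^+ 2)%:E <= M%:E)%E.
Proof.
move=> Qm Q0 QA; set S := zeros Q in Q0 QA *.
pose c := ((deg Q + deg T - 1)%N%:R)^-1 : R.
pose l := ln (cabs (lead_coef T) * (deg T)%:R).
have A0 : 0 < A := lt_le_trans ltr01 A1.
have D0 : 0 < (2 * A) ^+ 2 by rewrite exprn_gt0 // mulr_gt0.
have mD : measurable D by exact: measurable_square.
(* 8 = 2 * 4: (x - l)^2 <= 2 x^2 + 2 l^2, where |x| is at most twice the sum of the |ln |z - a||,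
   and the square of that sum is at most [size S] times the sum of squares. *)
pose B := 8 * c ^+ 2 * (size S)%:R.
have mk a : measurable_fun setT ((fun z => log_kernel A a z ^+ 2) : plane R -> R).
  by apply: measurable_funX; exact: measurable_log_kernel.
have B0 : 0 <= B by apply: mulr_ge0 => //; apply: mulr_ge0 => //; exact: sqr_ge0.
have c0 : 0 <= 2 * c ^+ 2 * l ^+ 2.
  by apply: mulr_ge0; [apply: mulr_ge0 => //|]; exact: sqr_ge0.
pose h z := 2 * c ^+ 2 * l ^+ 2 + B * \sum_(a <- S) log_kernel A a z ^+ 2.
have mh : measurable_fun setT (h : plane R -> R).
  by apply: measurable_funD => //; apply: measurable_funM => //; exact: measurable_sum.
have h0 z : 0 <= h z.
  by rewrite addr_ge0 // mulr_ge0 // sumr_ge0 // => a _; rewrite sqr_ge0.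
exists ((2 * c ^+ 2 * l ^+ 2) * (2 * A) ^+ 2 + B * ((size S)%:R * log_kernel_bound A) + 0 * 0 + 0 * 0).
apply: (@le_trans _ _ (\int[@leb2 R]_(z in D) (h z)%:E)%E); last first.
  apply: (@integral_le_lin3 _ _ _ (@leb2 R) D _ mD (leb2_square_fin A1) h
    (fun z => \sum_(a <- S) log_kernel A a z ^+ 2) (fun => 0) (fun => 0)) => //.
  - exact: measurable_funTS.
  - by apply: measurable_funTS; exact: measurable_sum.
  - by move=> z _; rewrite sumr_ge0 // => a _; rewrite sqr_ge0.
  - apply: (@integral_sum_seq_le R A S (fun a z => log_kernel A a z ^+ 2)) => //.
    + by move=> a z; rewrite sqr_ge0.
    + by move=> a; exact: integral_sqr_log_kernel.
  - by rewrite integral0.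
  - by rewrite integral0.
  - by move=> z _; rewrite /h !mul0r !addr0.
apply: ae_ge0_le_integral => //.
- by move=> z _; rewrite lee_fin sqr_ge0.
- by apply/measurable_EFinP/measurable_funX/measurable_funTS; exact: measurable_Psi_sum.
- by move=> z _; rewrite lee_fin.
- exact/measurable_EFinP/measurable_funTS.
have FF := ae_filter_ringOfSetsType (@leb2 R).
apply: (@filterS _ _ FF _ _ _ (points_ae S)) => z zS _; rewrite lee_fin /h /Psi_sum -/S -/c -/l.
have e a : a \in S -> ln (cabs (toC z - a)) = log_kernel A a z.
  by move=> aS; rewrite /log_kernel QA.
pose s1 := \sum_(a <- S) `|log_kernel A a z|.
have k1 : `|log_dist S z| <= s1.
  apply: (le_trans (log_dist_le Q0 zS)); rewrite le_eqVlt; apply/orP; left; apply/eqP.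
  by rewrite /s1 !big_seq; apply: eq_bigr => a aS; rewrite e.
have k2 : `|\sum_(a <- S) ln (cabs (toC z - a))| <= s1.
  rewrite (_ : \sum_(a <- S) _ = \sum_(a <- S) log_kernel A a z).
    exact: ler_norm_sum.
  by rewrite big_seq [RHS]big_seq; apply: eq_bigr => a aS; rewrite e.
have k3 : s1 ^+ 2 <= (size S)%:R * \sum_(a <- S) log_kernel A a z ^+ 2.
  apply: (le_trans (sqr_sum_le _ _)); rewrite ler_wpM2l //.
  by apply: ler_sum => a _; rewrite real_normK ?num_real.
have s10 : 0 <= s1 by exact: sumr_ge0.
rewrite exprMn /B.
have k4 : (- log_dist S z + \sum_(a <- S) ln (cabs (toC z - a))) ^+ 2 <= 4 * s1 ^+ 2.
  rewrite -(real_normK (num_real _)); apply: (@le_trans _ _ ((2 * s1) ^+ 2)); last by rewrite exprMn; lra.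
  rewrite ler_sqr ?nnegrE ?mulr_ge0 //; apply: (le_trans (ler_normD _ _)).
  by rewrite normrN; lra.
move: k3 k4; move: (- _ + _) (\sum_(a <- S) _) (s1 ^+ 2) => x y w k3 k4.
have c20 : 0 <= c ^+ 2 by exact: sqr_ge0.
have : (x - l) ^+ 2 <= 8 * ((size S)%:R * y) + 2 * l ^+ 2.
  by have := sqr_ge0 (x + l); nra.
move/(ler_wpM2l c20) => H; apply: (le_trans H); rewrite le_eqVlt; apply/orP; left; apply/eqP; ring.
Qed.

Variables (P Q T : {poly C}).
Hypotheses (cPQ : coprimep P Q) (P0 : P != 0) (q2 : (2 <= deg Q)%N) (t1 : (1 <= deg T)%N)
  (Qm : Q \is monic) (uQ : uniq (zeros Q)).

Let Q0 : zeros Q != [::].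
Proof. by rewrite -size_eq0 size_zeros ?monic_neq0 // -lt0n (leq_trans _ q2). Qed.

Lemma log_mean_L1_cvg : (forall a, a \in zeros Q -> cabs a <= 4 * A) ->
  (\int[@leb2 R]_(z in D) (`|log_mean (deriv_num P Q T n) (toC z) - log_factor P Q T n
     - Psi_sum Q T z|)%:E)%E @[n --> \oo] --> 0%E.
Proof.
move=> QA; have [M HM] := Psi_sum_sqr T Qm Q0 QA.
have A0 : 0 < A := lt_le_trans ltr01 A1.
have D0 : 0 < (2 * A) ^+ 2 by rewrite exprn_gt0 // mulr_gt0.
(* All unbounded quantities go into the constants [c n]: the shift of the far zeros and the term log
   n!. Only their difference is ever controlled. *)
pose w n := kernel_mean A (zeros (deriv_num P Q T n)).
pose c n := kernel_shift A (zeros (deriv_num P Q T n)) - log_factor P Q T n.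
have E n z : log_mean (deriv_num P Q T n) (toC z) - log_factor P Q T n = w n z + c n.
  rewrite /w /c addrA -kernel_meanE /log_mean size_zeros //.
  exact: deriv_num_neq0.
under eq_fun do under eq_integral do rewrite E.
apply: (@L1_cvg_of_L2_bounded _ _ _ (@leb2 R) D _ (measurable_square A) (leb2_square_fin A1) D0
  w c (Psi_sum Q T) (Num.max M (log_kernel_bound A))).
- by move=> n; apply: measurable_funTS; exact: measurable_kernel_mean.
- by apply: measurable_funTS; exact: measurable_Psi_sum.
- move=> n; apply: le_trans (integral_sqr_kernel_mean A1 _) _.
  by rewrite lee_fin le_max lexx orbT.
- by apply: (le_trans HM); rewrite lee_fin le_max lexx.
have FF := ae_filter_ringOfSetsType (@leb2 R).
apply: (@filterS _ _ FF _ _ _ (generic_ae Q0)) => z [zQ [a aQ Ha]] _.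
have [_] := log_mean_cvg P0 Qm t1 q2 cPQ uQ aQ zQ Ha.
by rewrite (Psi_sumE T Qm zQ); under eq_fun do rewrite E.
Qed.

End limit_function.

Section off_finite.
Variable R : realType.
Local Notation C := R[i].

Lemma measurable_point (a : C) : measurable ([set z | toC z = a] : set (plane R)).
Proof.
rewrite (_ : [set z | toC z = a] = [set ofC a]).
  by apply: closed_plane_measurable; apply: accessible_closed_set1; apply: hausdorff_accessible.
apply/seteqP; split => [z /= <-|z /= ->]; last by rewrite toC_ofC.
by case: z.
Qed.

(** Any function is measurable on a finite set, so the value -oo of a potential at a zero, or the
    limit defining Psi at a pole, does no harm. *)
Lemma measurable_off_finite (s : seq C) (g : plane R -> \bar R) (h : plane R -> R) :
  measurable_fun setT h -> (forall z, toC z \notin s -> g z = (h z)%:E) -> measurable_fun setT g.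
Proof.
move=> mh gh.
have [mF mgF] : measurable ([set z | toC z \in s] : set (plane R)) /\
    measurable_fun ([set z | toC z \in s] : set (plane R)) g.
  elim: s {gh} => [|a s [mF mgF]].
    rewrite (_ : [set z | _] = set0); last by apply/seteqP; split.
    by split => //; exact: measurable_fun_set0.
  rewrite (_ : [set z | _] = [set z | toC z = a] `|` [set z | toC z \in s]); last first.
    apply/seteqP; split => z /=; rewrite inE; first by move=> /orP[/eqP|]; [left|right].
    by move=> [->|->]; rewrite ?eqxx ?orbT.
  have ma := measurable_point a.
  split; first exact: measurableU.
  apply/measurable_funU => //; split => //.
  rewrite (_ : [set z | toC z = a] = [set ofC a]); first exact: measurable_fun_set1.
  apply/seteqP; split => [z /= <-|z /= ->]; last by rewrite toC_ofC.
  by case: z.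
rewrite -(setUv [set z : plane R | toC z \in s]).
apply/measurable_funU => //; first exact: measurableC.
split => //; apply: (@eq_measurable_fun _ _ _ _ _ (EFin \o h)).
  by move=> z; rewrite inE /= => /negP zs; rewrite gh.
by apply/measurable_funTS/measurable_EFinP.
Qed.

Lemma L1loc_off_finite (s : seq C) (g : R * R -> \bar R) (h : plane R -> R) (A0 : R) :
  measurable_fun setT h -> (forall z, toC z \notin s -> g z = (h z)%:E) ->
  (forall A : R, (A0 <= A)%R -> \int[@leb2 R]_(z in square A) `|(h z)%:E| < +oo)%E ->
  L1loc g.
Proof.
move=> mh gh hfin K cK; have [A A0' KA] := compact_sub_square cK.
have mg : measurable_fun setT (g : plane R -> \bar R) by exact: measurable_off_finite gh.
have mK := compact_plane_measurable cK.
apply/integrableP; split; first exact: measurable_funTS.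
pose B := Num.max A A0.
apply: (@le_lt_trans _ _ (\int[@leb2 R]_(z in square B) `|g z|)%E).
  apply: ge0_subset_integral => //; first exact: measurable_square.
    by apply: measurable_funTS; exact: measurableT_comp.
  move=> z /KA [z1 z2]; split.
    by apply: (le_trans z1); rewrite le_max lexx.
  by apply: (le_trans z2); rewrite le_max lexx.
apply: le_lt_trans (hfin B _); last by rewrite le_max lexx orbT.
apply: ae_ge0_le_integral => //; first exact: measurable_square.
- by apply: measurable_funTS; exact: measurableT_comp.
- by apply: measurable_funTS; apply: measurableT_comp => //; exact/measurable_EFinP.
have FF := ae_filter_ringOfSetsType (@leb2 R).
by apply: (@filterS _ _ FF _ _ _ (points_ae s)) => z zs _; rewrite gh.
Qed.

End off_finite.

Section L1loc_convergence.
Variable R : realType.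
Local Notation C := R[i].
Variables (P Q T : {poly C}).
Hypotheses (cPQ : coprimep P Q) (P0 : P != 0) (q2 : (2 <= deg Q)%N) (t1 : (1 <= deg T)%N)
  (Qm : Q \is monic) (uQ : uniq (zeros Q)).

Let Q0 : zeros Q != [::].
Proof. by rewrite -size_eq0 size_zeros ?monic_neq0 // -lt0n (leq_trans _ q2). Qed.

Lemma integral_abs_le (A c : R) (w : plane R -> R) (M : R) : 1 <= A ->
  measurable_fun setT w -> (\int[@leb2 R]_(z in square A) (w z ^+ 2)%:E <= M%:E)%E ->
  (\int[@leb2 R]_(z in square A) `|(w z + c)%:E| < +oo)%E.
Proof.
move=> A1 mw wM; under eq_integral do rewrite /=.
apply: (@le_lt_trans _ _ ((1 + `|c|) * (2 * A) ^+ 2 + 1 * M + 0 * 0 + 0 * 0)%:E); last exact: ltry.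
apply: (@integral_le_lin3 _ _ _ (@leb2 R) (square A) _ (measurable_square A) (leb2_square_fin A1)
  (fun z => `|w z + c|) (fun z => w z ^+ 2) (fun => 0) (fun => 0)) => //.
- apply: measurable_funTS; apply: measurableT_comp => //; exact: measurable_funD.
- by apply: measurable_funTS; exact: measurable_funX.
- by move=> z _; rewrite sqr_ge0.
- by rewrite integral0.
- by rewrite integral0.
move=> z _; rewrite mul0r !addr0 mul1r; apply: (le_trans (ler_normD _ _)).
have := normr_ge0 (w z); rewrite -(real_normK (num_real (w z))).
by move: `|w z| `|c| => x y; nra.
Qed.

Definition zeros_radius : R := 1 + \sum_(a <- zeros Q) cabs a.

Let A1 A : zeros_radius <= A -> 1 <= A.
Proof. by apply: le_trans; rewrite lerDl sumr_ge0 // => a _; rewrite cabs_ge0. Qed.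

Lemma zeros_radius_ge a : a \in zeros Q -> cabs a <= zeros_radius.
Proof.
move=> aQ; rewrite /zeros_radius (big_rem a) //=.
have : 0 <= \sum_(y <- rem a (zeros Q)) cabs y by apply: sumr_ge0 => b _; exact: cabs_ge0.
by lra.
Qed.

Lemma zeros_radius_ge4 A : zeros_radius <= A -> forall a, a \in zeros Q -> cabs a <= 4 * A.
Proof. by move=> hA a /zeros_radius_ge; have := A1 hA; lra. Qed.

Lemma L1loc_Psi : L1loc (fun z => (Psi Q T z)%:E).
Proof.
apply: (@L1loc_off_finite _ (zeros Q) _ (Psi_sum Q T) zeros_radius).
- exact: measurable_Psi_sum.
- by move=> z zQ; rewrite Psi_Psi_sum.
move=> A hA; have [M HM] := @Psi_sum_sqr R A (A1 hA) Q T Qm Q0 (zeros_radius_ge4 hA).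
have := integral_abs_le 0 (A1 hA) (measurable_Psi_sum Q T) HM.
by under eq_integral do rewrite addr0.
Qed.

Let U n z := log_mean (deriv_num P Q T n) (toC z) - log_factor P Q T n.

Let mU n : measurable_fun setT (U n : plane R -> R).
Proof.
by apply: measurable_funB => //; exact: measurable_log_mean.
Qed.

Lemma shifted_potentialE n z : toC z \notin zeros (deriv_num P Q T n) ->
  (log_potential (zero_counting_measure (deriv_num P Q T n)) z
    - (ln (n`!%:R) / (n * (deg Q + deg T - 1) + deg P)%N%:R)%:E)%E = (U n z)%:E.
Proof. by move=> zP; rewrite log_potentialE. Qed.

Lemma shifted_potential_cvg_L1loc :
  cvg_L1loc (fun n z => (log_potential (zero_counting_measure (deriv_num P Q T n)) z
      - (ln (n`!%:R) / (n * (deg Q + deg T - 1) + deg P)%N%:R)%:E)%E)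
    (fun z => (Psi Q T z)%:E).
Proof.
split.
- move=> n; apply: (@L1loc_off_finite _ (zeros (deriv_num P Q T n)) _ (U n) 1 (mU n)).
    by move=> z zP; rewrite shifted_potentialE.
  move=> A A1'; pose s := zeros (deriv_num P Q T n).
  have E z : U n z = kernel_mean A s z + (kernel_shift A s - log_factor P Q T n).
    by rewrite /U addrA -kernel_meanE /log_mean /s size_zeros // deriv_num_neq0.
  under eq_integral do rewrite E.
  exact: (integral_abs_le _ A1' (measurable_kernel_mean A s) (integral_sqr_kernel_mean A1' s)).
- exact: L1loc_Psi.
move=> K cK; have [A' A0' KA'] := compact_sub_square cK.
pose A := Num.max A' zeros_radius.
have hA : zeros_radius <= A by rewrite le_max lexx orbT.
have KA : K `<=` square A.
  by move=> z /KA' [z1 z2]; split; [apply: (le_trans z1)|apply: (le_trans z2)];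
    rewrite le_max lexx.
have mK := compact_plane_measurable cK.
have cv := log_mean_L1_cvg (A1 hA) cPQ P0 q2 t1 Qm uQ (zeros_radius_ge4 hA).
apply: (squeeze_cvge _ (cvg_cst _) cv); apply: nearW => n; rewrite integral_ge0 //=.
have mUn := mU n; have mPs := measurable_Psi_sum Q T.
pose g (z : plane R) := (log_potential (zero_counting_measure (deriv_num P Q T n)) z
      - (ln (n`!%:R) / (n * (deg Q + deg T - 1) + deg P)%N%:R)%:E - (Psi Q T z)%:E)%E.
have mg : measurable_fun setT g.
  apply: (@measurable_off_finite _ (zeros (deriv_num P Q T n) ++ zeros Q) _
    (fun z => U n z - Psi_sum Q T z)); first exact: measurable_funB.
  move=> z; rewrite mem_cat negb_or => /andP[zP zQ].
  by rewrite /g shifted_potentialE // Psi_Psi_sum.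
apply: (@le_trans _ _ (\int[@leb2 R]_(z in square A) `|g z|)%E).
  apply: ge0_subset_integral => //; first exact: measurable_square.
  by apply: measurable_funTS; exact: measurableT_comp.
apply: ae_ge0_le_integral => //; first exact: measurable_square.
- by apply: measurable_funTS; exact: measurableT_comp.
- apply/measurable_funTS/measurable_EFinP; apply: measurableT_comp => //.
  exact: measurable_funB.
have FF := ae_filter_ringOfSetsType (@leb2 R).
apply: (@filterS _ _ FF _ _ _ (points_ae (zeros (deriv_num P Q T n) ++ zeros Q))) => z.
rewrite mem_cat negb_or => /andP[zP zQ] _.
by rewrite /g shifted_potentialE // Psi_Psi_sum.
Qed.

End L1loc_convergence.

(** * Divergence of the unshifted potentials *)

Section divergence.
Variable R : realType.
Local Notation C := R[i].
Implicit Types (P Q T : {poly C}).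

Lemma expn_le_fact (k n : nat) : (k <= n)%N -> (k ^ (n - k) <= n`!)%N.
Proof.
elim: n => [|n IH]; first by rewrite leqn0 => /eqP ->.
rewrite leq_eqVlt => /orP[/eqP ->|kn]; first by rewrite subnn fact_gt0.
by rewrite subSn // expnS factS leq_mul // ?IH // ltnW.
Qed.

Lemma log_factor_ge P Q T (B : R) : (0 < deg Q + deg T - 1)%N ->
  \forall n \near \oo, B <= log_factor P Q T n.
Proof.
rewrite /log_factor; set D := (deg Q + deg T - 1)%N; set p := deg P => D0.
pose B' := Num.max B 0; have B'0 : 0 <= B' by rewrite le_max lexx orbT.
(* From n! >= k^(n-k) and n >= 2 k follows ln n! >= (n / 2) ln k; this k makes it at least n (D + p)
   B', which exceeds the degree times B'. *)
pose k := (Num.truncn (expR (2 * (D + p)%:R * B'))).+1.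
have kB : 2 * (D + p)%:R * B' <= ln k%:R.
  rewrite -[leLHS]expRK ler_ln ?posrE ?expR_gt0 ?ltr0n //.
  exact/ltW/truncnS_gt.
exists k.*2.+1 => // n /= kn.
apply: (@le_trans _ _ B'); first by rewrite le_max lexx.
have n0 : (0 < n)%N by apply: leq_trans kn.
have d0 : 0 < (n * D + p)%N%:R :> R by rewrite ltr0n addn_gt0 muln_gt0 n0 D0.
rewrite ler_pdivlMr //.
have kn' : (k <= n)%N by rewrite -addnn in kn; lia.
have k0 : 0 < k%:R :> R by rewrite ltr0n.
have h1 : (n - k)%N%:R * ln k%:R <= ln n`!%:R :> R.
  rewrite mulr_natl -lnXn // ler_ln ?posrE ?exprn_gt0 ?ltr0n ?fact_gt0 //.
  by rewrite -natrX ler_nat expn_le_fact.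
apply: le_trans h1; rewrite natrB //.
have h2 : n%:R / 2 <= n%:R - k%:R :> R.
  have : (k.*2)%:R <= n%:R :> R by rewrite ler_nat ltnW.
  by rewrite -muln2 natrM; lra.
have l0 : 0 <= ln k%:R :> R by rewrite ln_ge0 // ler1n.
apply: (@le_trans _ _ (n%:R / 2 * (2 * (D + p)%:R * B'))).
  have -> : n%:R / 2 * (2 * (D + p)%:R * B') = B' * (n%:R * (D + p)%:R) by field.
  rewrite ler_wpM2l // -natrM ler_nat mulnDr leq_add2l leq_pmull //.
apply: (@le_trans _ _ (n%:R / 2 * ln k%:R)); first by rewrite ler_wpM2l // divr_ge0.
by rewrite ler_wpM2r.
Qed.

(** If z were equidistant from a and b, a small move from z in the direction b - a would stay in the
    cell of a and yet be strictly nearer to b. *)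
Lemma voronoi_interior (S : seq C) (a : C) (z : R * R) : a \in S ->
  interior (voronoi_cell S a) z ->
  forall b, b \in S -> b != a -> cabs (toC z - a) < cabs (toC z - b).
Proof.
move=> aS zV b bS ba.
have nearest w : voronoi_cell S a w -> cabs (toC w - a) <= cabs (toC w - b).
  by rewrite /voronoi_cell /= => ->; apply: min_seq_le; apply/mapP; exists b.
rewrite lt_neqAle nearest ?andbT; last exact: interior_subset zV.
apply/eqP => E; have Ez := equidistant_line E.
move: zV; rewrite /interior => /nbhs_ballP [e /= e0 He].
pose u := complex.Re b - complex.Re a; pose v := complex.Im b - complex.Im a.
have uv0 : 0 < u ^+ 2 + v ^+ 2.
  rewrite lt0r addr_ge0 ?sqr_ge0 // andbT paddr_eq0 ?sqr_ge0 // !sqrf_eq0 !subr_eq0.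
  by apply: contra ba; case: (a) (b) => a1 a2 [b1 b2] /= /andP[/eqP -> /eqP ->].
pose k := 1 + `|u| + `|v|; have k0 : 0 < k by rewrite /k -addrA ltr_pwDl // addr_ge0.
pose t := e / (2 * k); have t0 : 0 < t by rewrite divr_gt0 // mulr_gt0.
have tk : t * k < e.
  have -> : t * k = e / 2 by rewrite /t; field; rewrite gt_eqF.
  by rewrite ltr_pdivrMr // ltr_pMr // ltr1n.
pose w : R * R := (z.1 + t * u, z.2 + t * v).
have tu : t * `|u| < e.
  by apply: le_lt_trans tk; rewrite ler_pM2l // /k; have := normr_ge0 v; lra.
have tv : t * `|v| < e.
  by apply: le_lt_trans tk; rewrite ler_pM2l // /k; have := normr_ge0 u; lra.
have Vw : voronoi_cell S a w.
  by apply: He; split; rewrite /ball /= opprD addNKr normrN normrM gtr0_norm.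
have gen (a1 a2 b1 b2 s x y : R) : 0 < s ->
    2 * (b1 - a1) * x + 2 * (b2 - a2) * y = b1 ^+ 2 + b2 ^+ 2 - a1 ^+ 2 - a2 ^+ 2 ->
    0 < (b1 - a1) ^+ 2 + (b2 - a2) ^+ 2 ->
    (x + s * (b1 - a1) - a1) ^+ 2 + (y + s * (b2 - a2) - a2) ^+ 2 <=
    (x + s * (b1 - a1) - b1) ^+ 2 + (y + s * (b2 - a2) - b2) ^+ 2 -> False.
  by move=> s0 Ez' u0 H; have := mulr_gt0 s0 u0; nra.
have := nearest _ Vw; rewrite !cabs_toC ler_sqrt ?addr_ge0 ?sqr_ge0 //=.
exact: gen.
Qed.

Lemma potential_diverges P Q T (a : C) (z : R * R) : coprimep P Q -> P != 0 ->
  (2 <= deg Q)%N -> (1 <= deg T)%N -> Q \is monic -> uniq (zeros Q) ->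
  a \in zeros Q -> toC z \notin zeros Q -> interior (voronoi_cell (zeros Q) a) z ->
  log_potential (zero_counting_measure (deriv_num P Q T n)) z @[n --> \oo] --> +oo%E.
Proof.
move=> cPQ P0 q2 t1 Qm uQ aQ zQ zV.
have [nz cv] := log_mean_cvg P0 Qm t1 q2 cPQ uQ aQ zQ (voronoi_interior aQ zV).
apply/cvgeyPger => A _.
have D0 : (0 < deg Q + deg T - 1)%N.
  by rewrite -addnBA //; apply: leq_trans (ltnW q2) (leq_addr _ _).
have /cvgrPdist_le /(_ 1 ltr01) cv1 := cv.
near=> n.
have Pz : (deriv_num P Q T n).[toC z] != 0 by near: n.
rewrite log_potentialE; last by rewrite mem_zeros ?deriv_num_neq0.
have h1 : `|Psi_formula Q T z - (log_mean (deriv_num P Q T n) (toC z) - log_factor P Q T n)| <= 1.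
  by near: n.
have h2 : A - Psi_formula Q T z + 1 <= log_factor P Q T n.
  by near: n; exact: log_factor_ge.
rewrite lee_fin; move: h1; rewrite ler_norml => /andP[h3 h4]; lra.
Unshelve. all: by end_near. Qed.

End divergence.

(** * Calculus of test functions *)

Section test_calculus.
Variable R : realType.
Implicit Types (phi : R * R -> R) (z a v w : R * R).

Lemma scale_pairE (h : R) v : h *: v = (h * v.1, h * v.2) :> R * R. Proof. by []. Qed.

Lemma ray_derive phi a v (x : R) : derivable phi (a + x *: v) v ->
  is_derive x 1 (fun x => phi (a + x *: v)) ('D_v phi (a + x *: v)).
Proof.
move=> d; have E : (fun h : R => h^-1 *: (phi (a + (h *: 1 + x) *: v) - phi (a + x *: v))) =
   (fun h : R => h^-1 *: (phi (h *: v + (a + x *: v)) - phi (a + x *: v))).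
  apply/funext => h; congr (_ *: (phi _ - _)).
  by rewrite scalerDl addrCA [h *: 1]mulr1.
by apply: DeriveDef; rewrite ?/derivable ?/derive E.
Qed.

Lemma derive_scale phi z v (c : R) : derivable phi z v -> derivable phi z (c *: v) ->
  'D_(c *: v) phi z = c * 'D_v phi z.
Proof.
move=> d dc; have := @ray_derive phi z v 0; rewrite scale0r addr0 => /(_ d) H.
have := @ray_derive phi z (c *: v) 0; rewrite scale0r addr0 => /(_ dc) [_ Hc].
have dl : is_derive (0 : R) 1 (fun x : R => c * x) c.
  by apply: (is_derive_eq (is_deriveZ c (is_derive_id (0:R) 1))); rewrite /GRing.scale /= mulr1.
have H' : is_derive (c * 0 : R) 1 (fun x : R => phi (z + x *: v)) ('D_v phi z) by rewrite mulr0.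
have [_ E] := is_derive1_comp H' dl.
have F : (fun x : R => phi (z + x *: (c *: v))) = (fun x : R => phi (z + x *: v)) \o *%R c.
  by apply/funext => x; rewrite /= scalerA mulrC.
by rewrite mulrC -E -F -Hc.
Qed.

Lemma MVT_ray phi a v (x : R) : (forall z, derivable phi z v) ->
  exists2 c : R, `|c| <= `|x| & phi (a + x *: v) - phi a = x * 'D_v phi (a + c *: v).
Proof.
move=> d; pose f (x : R) := phi (a + x *: v); pose df (x : R) : R := 'D_v phi (a + x *: v).
have fd (y : R) : is_derive y (1 : R) f (df y) by apply: ray_derive.
have cf (y : R) : {for y, continuous f}.
  by apply: differentiable_continuous; apply/derivable1_diffP; have [] := fd y.
have f0 : f 0 = phi a by rewrite /f scale0r addr0.
have [x0|x0] := leP 0 x.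
  have [c] := MVT_segment x0 (fun y _ => fd y) (continuous_in_subspaceT (fun y _ => cf y)).
  rewrite in_itv /= => /andP[c0 cx]; rewrite f0 subr0 => E.
  by exists c; rewrite ?ger0_norm // mulrC; exact: E.
have [c] := MVT_segment (ltW x0) (fun y _ => fd y) (continuous_in_subspaceT (fun y _ => cf y)).
rewrite in_itv /= => /andP[c0 cx]; rewrite f0 sub0r => E.
exists c; first by rewrite !ler0_norm ?(ltW x0) // lerN2.
by rewrite -[LHS]opprB E /f /df; ring.
Qed.

(** Test functions are given by directional derivatives only. Linearity in the direction is
    recovered from the mean value theorem along v and the continuity of D_v phi; it yields the
    gradient formula [gradE]. *)
Lemma derive_add phi z v w : (forall y, derivable phi y v) -> derivable phi z w ->
  derivable phi z (v + w) -> {for z, continuous ('D_v phi)} ->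
  'D_(v + w) phi z = 'D_v phi z + 'D_w phi z.
Proof.
move=> dv dw dvw cv; apply/cvg_lim => //.
have -> : (fun h : R => h^-1 *: (phi (h *: (v + w) + z) - phi z)) =
  (fun h : R => h^-1 *: (phi (h *: (v + w) + z) - phi (h *: w + z)) +
                h^-1 *: (phi (h *: w + z) - phi z)).
  by apply/funext => h; rewrite -scalerDr addrA subrK.
apply: cvgD; last exact: dw.
apply/cvgrPdist_le => e e0.
have /cvgrPdist_le /(_ e e0) /nbhs_ballP [r /= r0 Hr] := cv.
pose k := 1 + `|v| + `|w|; have k0 : 0 < k by rewrite /k -addrA ltr_pwDl // addr_ge0.
have rk0 : 0 < r / k by rewrite divr_gt0.
apply/nbhs_ballP; exists (r / k) => // h; rewrite /ball /= sub0r normrN => hr h0.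
have [c ch E] := @MVT_ray phi (h *: w + z) v h dv.
have -> : h *: (v + w) + z = h *: w + z + h *: v by rewrite scalerDr -addrA addrC.
rewrite E; have -> : h^-1 *: (h * 'D_v phi (h *: w + z + c *: v)) = 'D_v phi (h *: w + z + c *: v).
  by rewrite /GRing.scale /= mulrA mulVf ?mul1r.
apply: Hr; rewrite -ball_normE /=.
have -> : z - (h *: w + z + c *: v) = - (h *: w + c *: v).
  by rewrite !opprD addrA [- (h *: w) - z]addrC addrA subrr add0r.
rewrite normrN; apply: (le_lt_trans (ler_normD _ _)); rewrite !normrZ.
rewrite ltr_pdivlMr // /k in hr; apply: le_lt_trans hr.
have : `|c| * `|v| <= `|h| * `|v| by rewrite ler_wpM2r.
by have := normr_ge0 h; nra.
Qed.

Lemma gradE phi z v : (forall y u, derivable phi y u) ->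
  (forall u, continuous (fun y => 'D_u phi y)) ->
  'D_v phi z = v.1 * 'D_(1, 0) phi z + v.2 * 'D_(0, 1) phi z.
Proof.
move=> d c; rewrite [in LHS](_ : v = v.1 *: ((1, 0) : R * R) + v.2 *: ((0, 1) : R * R)).
  by rewrite derive_add //; [rewrite !derive_scale|exact: c].
by case: v => x y; rewrite !scale_pairE /= !mulr1 !mulr0; congr pair; rewrite /= ?addr0 ?add0r.
Qed.

Definition supported (A : R) phi := forall z, ~ square A z -> phi z = 0.

Lemma square_setC_open (A : R) : open (~` (square A) : set (R * R)).
Proof.
apply: closed_openC; rewrite (_ : square A = [set z | `|z.1| <= A] `&` [set z | `|z.2| <= A]) //.
apply: closedI.
  apply: (@closed_comp _ _ (fun z : R * R => `|z.1|) [set x | x <= A]); last exact: closed_le.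
  by move=> z _; apply: cvg_norm; exact: cvg_fst.
apply: (@closed_comp _ _ (fun z : R * R => `|z.2|) [set x | x <= A]); last exact: closed_le.
by move=> z _; apply: cvg_norm; exact: cvg_snd.
Qed.

Lemma supported_derive A phi v : supported A phi -> supported A (fun z => 'D_v phi z).
Proof.
move=> s z zA; have [->|v0] := eqVneq v 0.
  rewrite /derive; apply/cvg_lim => //; rewrite (_ : (fun h : R => _) = cst 0); first exact: cvg_cst.
  by apply/funext => h; rewrite scaler0 /= add0r subrr scaler0.
rewrite (@near_eq_derive _ _ _ _ (cst 0)) ?derive_cst //.
have : nbhs z (~` square A) by apply: open_nbhs_nbhs; split => //; exact: square_setC_open.
by apply: filterS => y; exact: s.
Qed.

Lemma square_compact (A : R) : compact (square A).
Proof.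
rewrite squareE; apply: compact_setX; exact: segment_compact.
Qed.

Lemma supported_bounded A phi : continuous phi -> supported A phi ->
  exists2 M, 0 < M & forall z, `|phi z| <= M.
Proof.
move=> c s; have [M [Mr HM]] : bounded_set (phi @` square A).
  apply: compact_bounded; apply: continuous_compact; last exact: square_compact.
  exact: continuous_subspaceT.
exists (`|M| + 1); first by rewrite ltr_wpDl.
move=> z; have [zA|zA] := pselect (square A z); last by rewrite s // normr0 addr_ge0.
by apply: HM; [rewrite ltr_pwDr // ler_norm|exists z].
Qed.

Lemma supported_integrable A (f : plane R -> R) M : 0 <= A -> measurable_fun setT f ->
  supported A f -> (forall z, `|f z| <= M) -> (@leb2 R).-integrable setT (EFin \o f).
Proof.
move=> A0 mf s fM; apply/integrableP; split; first exact/measurable_EFinP.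
have mS : measurable (square A : set (plane R)) by exact: measurable_square.
have -> : (\int[@leb2 R]_z `|(EFin \o f) z| = \int[@leb2 R]_(z in square A) `|(f z)%:E|)%E.
  rewrite [RHS]integral_mkcond; apply: eq_integral => z _; rewrite /patch.
  by case: ifPn => // /negP; rewrite inE => /s /= ->; rewrite normr0.
apply: (@le_lt_trans _ _ (\int[@leb2 R]_(z in (square A : set (plane R))) M%:E)%E).
  apply: ge0_le_integral => //.
  by apply: measurable_funTS; apply: measurableT_comp => //; exact/measurable_EFinP.
  by move=> z _; rewrite lee_fin; exact: fM.
by rewrite integral_cst // leb2_square // -EFinM ltry.
Qed.

Lemma continuous_supported_integrable A (f : plane R -> R) : 0 <= A -> continuous (f : R * R -> R) ->
  supported A f -> (@leb2 R).-integrable setT (EFin \o f).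
Proof.
move=> A0 c s; have [M M0 HM] := supported_bounded c s.
exact: (supported_integrable A0 (continuous_plane_measurable c) s HM).
Qed.

Lemma test_supported phi : test_function phi -> exists2 A, 1 <= A & supported A phi.
Proof.
move=> [_ /compact_sub_square [A A0 HA]]; exists (1 + A); first by rewrite lerDl ltW.
move=> z zA; apply/eqP; apply: contrapT => z0; apply: zA.
have [z1 z2] : square A z by apply: HA; apply: subset_closure; apply/negP.
by split; lra.
Qed.

End test_calculus.

(** * The gradient of the minimum of the ln |z - a| *)

Section integration_by_parts.
Variable R : realType.
Local Notation mu := (@lebesgue_measure R).

Lemma integral_derivative_eq0 (F f : R -> R) (B : R) : 0 <= B ->
  (forall x : R, is_derive x (1 : R) F (f x)) -> continuous f ->
  (forall x, B < `|x| -> F x = 0) -> (forall x, B < `|x| -> f x = 0) ->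
  (\int[mu]_x (f x)%:E = 0)%E.
Proof.
move=> B0 dF cf F0 f0; pose L := B + 1.
have LB : B < L by rewrite /L ltrDl.
have L0 : 0 < L by exact: le_lt_trans LB.
have cF (x : R) : {for x, continuous F}.
  by apply: differentiable_continuous; apply/derivable1_diffP; have [] := dF x.
transitivity (\int[mu]_(x in `[(- L)%R, L%R]) (f x)%:E)%E.
  rewrite [RHS]integral_mkcond; apply: eq_integral => x _; rewrite /patch.
  case: ifPn => //; rewrite mem_setE in_itv /= -ler_norml -ltNge => xL.
  by rewrite f0 // (lt_trans LB).
rewrite (@continuous_FTC2 R f F) //.
- by rewrite !F0 ?subee // ?normrN gtr0_norm.
- by lra.
- by apply: continuous_in_subspaceT => x _; exact: cf.
- split.
  + by move=> x _; have [] := dF x.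
  + exact/cvg_at_right_filter/cF.
  + exact/cvg_at_left_filter/cF.
- by move=> x _; rewrite derive1E; have [_ ->] := dF x.
Qed.

Lemma plane_integral_eq0_x (G : R * R -> R) (A : R) : 0 <= A -> continuous G -> supported A G ->
  (forall y, \int[mu]_x (G (x, y))%:E = 0)%E -> (\int[@leb2 R]_z (G z)%:E = 0)%E.
Proof.
move=> A0 cG sG H; have iG := continuous_supported_integrable A0 cG sG.
rewrite /leb2 -(integral21_prod_meas1 iG) /=; apply: integral0_eq => y _; exact: H.
Qed.

Lemma plane_integral_eq0_y (G : R * R -> R) (A : R) : 0 <= A -> continuous G -> supported A G ->
  (forall x, \int[mu]_y (G (x, y))%:E = 0)%E -> (\int[@leb2 R]_z (G z)%:E = 0)%E.
Proof.
move=> A0 cG sG H; have iG := continuous_supported_integrable A0 cG sG.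
rewrite /leb2 -(integral12_prod_meas1 iG) /=; apply: integral0_eq => x _; exact: H.
Qed.

Variables (A : R) (m dm psi dpsi : R * R -> R).
Hypotheses (A0 : 0 <= A) (cm : continuous m) (cdm : continuous dm)
  (cpsi : continuous psi) (cdpsi : continuous dpsi)
  (spsi : supported A psi) (sdpsi : supported A dpsi).

Let cG : continuous (fun z => m z * dpsi z + dm z * psi z).
Proof. by move=> z; apply: cvgD; apply: cvgM; [exact: cm|exact: cdpsi|exact: cdm|exact: cpsi]. Qed.

Let sG : supported A (fun z => m z * dpsi z + dm z * psi z).
Proof. by move=> z zA; rewrite spsi // sdpsi // !mulr0 addr0. Qed.

Let prod_derive (f df g dg : R -> R) (x : R) :
  is_derive x (1 : R) f (df x) -> is_derive x (1 : R) g (dg x) ->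
  is_derive x (1 : R) (fun x => f x * g x) (f x * dg x + df x * g x).
Proof.
move=> hf hg; rewrite (_ : (fun x => f x * g x) = f * g) //.
apply: (is_derive_eq (is_deriveM hf hg)).
by rewrite /GRing.scale /= [g x * _]mulrC.
Qed.

(** On each horizontal line the integrand is the derivative of m psi, which vanishes far away;
    Fubini concludes. *)
Lemma integration_by_parts_x :
  (forall x y : R, is_derive x (1 : R) (fun x => m (x, y)) (dm (x, y))) ->
  (forall x y : R, is_derive x (1 : R) (fun x => psi (x, y)) (dpsi (x, y))) ->
  (\int[@leb2 R]_z (m z * dpsi z + dm z * psi z)%:E = 0)%E.
Proof.
move=> dm' dpsi'; apply: (plane_integral_eq0_x A0 cG sG) => y.
have out x : A < `|x| -> ~ square A (x, y) by move=> h [h1 _]; move: h1; rewrite /= leNgt h.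
apply: (@integral_derivative_eq0 (fun x => m (x, y) * psi (x, y)) _ A) => //.
- move=> x; exact: (@prod_derive (fun x => m (x, y)) (fun x => dm (x, y))
    (fun x => psi (x, y)) (fun x => dpsi (x, y)) x (dm' x y) (dpsi' x y)).
- move=> x; have cx : {for x, continuous (fun x : R => ((x, y) : R * R))}.
    have h := @cvg_pair _ _ _ (nbhs x) (nbhs x) (nbhs y) _ _ _ id (fun=> y).
    by apply: h; [exact: cvg_id|exact: cvg_cst].
  exact: (continuous_comp cx (@cG (x, y))).
- by move=> x /out h; rewrite spsi // mulr0.
- by move=> x /out h; rewrite spsi // sdpsi // !mulr0 addr0.
Qed.

Lemma integration_by_parts_y :
  (forall x y : R, is_derive y (1 : R) (fun y => m (x, y)) (dm (x, y))) ->
  (forall x y : R, is_derive y (1 : R) (fun y => psi (x, y)) (dpsi (x, y))) ->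
  (\int[@leb2 R]_z (m z * dpsi z + dm z * psi z)%:E = 0)%E.
Proof.
move=> dm' dpsi'; apply: (plane_integral_eq0_y A0 cG sG) => x.
have out y : A < `|y| -> ~ square A (x, y) by move=> h [_ h1]; move: h1; rewrite /= leNgt h.
apply: (@integral_derivative_eq0 (fun y => m (x, y) * psi (x, y)) _ A) => //.
- move=> y; exact: (@prod_derive (fun y => m (x, y)) (fun y => dm (x, y))
    (fun y => psi (x, y)) (fun y => dpsi (x, y)) y (dm' x y) (dpsi' x y)).
- move=> y; have cy : {for y, continuous (fun y : R => ((x, y) : R * R))}.
    have h := @cvg_pair _ _ _ (nbhs y) (nbhs x) (nbhs y) _ _ _ (fun=> x) id.
    by apply: h; [exact: cvg_cst|exact: cvg_id].
  exact: (continuous_comp cy (@cG (x, y))).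
- by move=> y /out h; rewrite spsi // mulr0.
- by move=> y /out h; rewrite spsi // sdpsi // !mulr0 addr0.
Qed.

End integration_by_parts.

Section plane_continuity.
Variable R : realType.
Implicit Types f g : R * R -> R.

Lemma plane_contD f g : continuous f -> continuous g -> continuous (fun z => f z + g z).
Proof. by move=> cf cg z; apply: cvgD; [exact: cf|exact: cg]. Qed.
Lemma plane_contM f g : continuous f -> continuous g -> continuous (fun z => f z * g z).
Proof. by move=> cf cg z; apply: cvgM; [exact: cf|exact: cg]. Qed.
Lemma plane_contV f : (forall z, f z != 0) -> continuous f -> continuous (fun z => (f z)^-1).
Proof. by move=> f0 cf z; apply: cvgV; [exact: f0|exact: cf]. Qed.
Lemma plane_cont_cst (c : R) : continuous (fun _ : R * R => c).
Proof. by move=> z; exact: cvg_cst. Qed.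
Lemma plane_contX f n : continuous f -> continuous (fun z => f z ^+ n).
Proof.
move=> cf; elim: n => [|n IH].
  by rewrite (_ : (fun z => _) = fun=> 1); [exact: plane_cont_cst|apply/funext => z; rewrite expr0].
rewrite (_ : (fun z => _) = fun z => f z * f z ^+ n); first exact: plane_contM.
by apply/funext => z; rewrite exprS.
Qed.
Lemma plane_cont_sum (I : Type) (s : seq I) (F : I -> R * R -> R) :
  (forall i, continuous (F i)) -> continuous (fun z => \sum_(i <- s) F i z).
Proof.
move=> cF; elim: s => [|i s IH].
  by rewrite (_ : (fun z => _) = fun=> 0); [exact: plane_cont_cst|apply/funext => z; rewrite big_nil].
rewrite (_ : (fun z => _) = fun z => F i z + \sum_(j <- s) F j z); first exact: plane_contD.
by apply/funext => z; rewrite big_cons.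
Qed.
Lemma plane_cont_ln f : (forall z, 0 < f z) -> continuous f -> continuous (fun z => ln (f z)).
Proof.
move=> f0 cf z; apply: (@continuous_comp _ _ _ f (@ln R)); first exact: cf.
exact: continuous_ln.
Qed.
Lemma plane_cont_fst : continuous (fun z : R * R => z.1). Proof. by move=> z; exact: cvg_fst. Qed.
Lemma plane_cont_snd : continuous (fun z : R * R => z.2). Proof. by move=> z; exact: cvg_snd. Qed.
End plane_continuity.

(** * Smooth approximation of the minimum *)

Section softmin1.
Variables (R : realType) (I : eqType) (S : seq I) (p r : I -> R) (k : nat).
Hypotheses (r0 : forall i, 0 < r i) (S0 : S != [::]).

(** One-variable model: with r i the square of the other coordinate plus the regularization, it
    gives both partial derivatives of [softmin]. *)
Definition wt1 i (x : R) := (((x - p i) ^+ 2 + r i)^-1) ^+ k.+1.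
Definition softmin1 (x : R) := - (2 * k.+1%:R)^-1 * ln (\sum_(i <- S) wt1 i x).
Definition dsoftmin1 (x : R) := (\sum_(i <- S) wt1 i x)^-1 *
  \sum_(i <- S) wt1 i x * ((x - p i) / ((x - p i) ^+ 2 + r i)).

Let f0 i x : 0 < (x - p i) ^+ 2 + r i. Proof. by rewrite ltr_wpDl ?sqr_ge0. Qed.

Let w0 i x : 0 < wt1 i x. Proof. by rewrite exprn_gt0 // invr_gt0. Qed.

Lemma is_derive_softmin1 (x : R) : is_derive x (1 : R) softmin1 (dsoftmin1 x).
Proof.
have k0 : (k.+1%:R : R) != 0 by rewrite pnatr_eq0.
have dw i : is_derive x (1 : R) (wt1 i)
    (- (2 * k.+1%:R) * (wt1 i x * ((x - p i) / ((x - p i) ^+ 2 + r i)))).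
  have fx := f0 i x.
  have h : is_derive x (1 : R) (fun x => x - p i) 1.
    by have := is_deriveB (is_derive_id x (1:R)) (is_derive_cst (p i) x (1:R)); rewrite subr0.
  have hf : is_derive x (1 : R) (fun x => (x - p i) ^+ 2 + r i) (2 * (x - p i)).
    apply: (is_derive_eq (is_deriveD (is_deriveX 2 h) (is_derive_cst (r i) x (1:R)))).
    by rewrite addr0 /GRing.scale /= expr1 mulr1.
  have hV : is_derive x (1 : R) (fun x => ((x - p i) ^+ 2 + r i)^-1)
      (- (((x - p i) ^+ 2 + r i) ^- 2) * (2 * (x - p i))).
    case: hf => d1 d2; apply: DeriveDef; first by apply: derivableV => //; rewrite gt_eqF.
    by rewrite deriveV ?gt_eqF // d2.
  have := is_deriveX k.+1 hV.
  rewrite (_ : (fun x => _) ^+ k.+1 = wt1 i); last by apply/funext => u; rewrite exprfctE.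
  move=> hX; apply: (is_derive_eq hX); rewrite /GRing.scale /= /wt1.
  rewrite [_^-1 ^+ k.+1]exprS; move: (((x - p i) ^+ 2 + r i)^-1 ^+ k) => u.
  by field; rewrite gt_eqF.
have dZ : is_derive x (1 : R) (fun x => \sum_(i <- S) wt1 i x)
    (- (2 * k.+1%:R) * \sum_(i <- S) wt1 i x * ((x - p i) / ((x - p i) ^+ 2 + r i))).
  elim: (S) => [|i s IH].
    rewrite (_ : (fun x => _) = cst 0); last by apply/funext => y; rewrite big_nil.
    by rewrite big_nil mulr0; exact: is_derive_cst.
  rewrite (_ : (fun x => _) = (fun x => wt1 i x + \sum_(j <- s) wt1 j x)); last first.
    by apply/funext => y; rewrite big_cons.
  by rewrite big_cons mulrDr; exact: is_deriveD.
have Z0 : 0 < \sum_(i <- S) wt1 i x.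
  case: (S) S0 => // i s _; rewrite big_cons ltr_pwDl //.
  by rewrite sumr_ge0 // => j _; exact: ltW.
apply: (is_derive_eq (is_deriveZ (- (2 * k.+1%:R)^-1) (is_derive1_comp (is_derive1_ln Z0) dZ))).
rewrite /dsoftmin1 /GRing.scale /=.
move: (\sum_(i <- S) _ * _) (\sum_(i <- S) _) Z0 => u v v0.
by move: (k.+1%:R) k0 => K K0; field; rewrite K0 gt_eqF.
Qed.

End softmin1.

Lemma laplacian_ibp (R : realType) (A : R) (m mx my phi : R * R -> R) : 0 <= A ->
  continuous m -> continuous mx -> continuous my ->
  (forall x y : R, is_derive x (1 : R) (fun x => m (x, y)) (mx (x, y))) ->
  (forall x y : R, is_derive y (1 : R) (fun y => m (x, y)) (my (x, y))) ->
  supported A phi ->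
  (forall y u, derivable phi y u) -> (forall u, continuous (fun y => 'D_u phi y)) ->
  (forall w y u, derivable (fun z => 'D_w phi z) y u) ->
  (forall w u, continuous (fun y => 'D_u (fun z => 'D_w phi z) y)) ->
  (\int[@leb2 R]_z (m z * laplacian phi z +
    (mx z * 'D_(1, 0) phi z + my z * 'D_(0, 1) phi z))%:E = 0)%E.
Proof.
move=> A0 cm cmx cmy dmx dmy sphi d1 c1 d2 c2.
have s1 w : supported A (fun z => 'D_w phi z) by exact: supported_derive.
have s2 w : supported A (fun z => 'D_w (fun y => 'D_w phi y) z) by apply: supported_derive.
have px (x y u : R) : ((u, y) : R * R) = (0, y) + u *: ((1, 0) : R * R).
  by rewrite scale_pairE; congr pair; rewrite /= ?mulr1 ?mulr0 ?add0r ?addr0.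
have py (x y u : R) : ((x, u) : R * R) = (x, 0) + u *: ((0, 1) : R * R).
  by rewrite scale_pairE; congr pair; rewrite /= ?mulr1 ?mulr0 ?add0r ?addr0.
have hx (x y : R) : is_derive x (1 : R) (fun x => 'D_(1, 0) phi (x, y))
    ('D_(1, 0) (fun z => 'D_(1, 0) phi z) (x, y)).
  rewrite (_ : (fun x => _) = (fun x => 'D_(1, 0) phi ((0, y) + x *: ((1, 0) : R * R)))).
    by rewrite (px x y x); exact: ray_derive.
  by apply/funext => u; rewrite (px x y u).
have hy (x y : R) : is_derive y (1 : R) (fun y => 'D_(0, 1) phi (x, y))
    ('D_(0, 1) (fun z => 'D_(0, 1) phi z) (x, y)).
  rewrite (_ : (fun y => _) = (fun y => 'D_(0, 1) phi ((x, 0) + y *: ((0, 1) : R * R)))).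
    by rewrite (py x y y); exact: ray_derive.
  by apply/funext => u; rewrite (py x y u).
have Ix := integration_by_parts_x A0 cm cmx (c1 (1, 0))
  (c2 (1, 0) (1, 0)) (s1 (1, 0)) (s2 (1, 0)) dmx hx.
have Iy := integration_by_parts_y A0 cm cmy (c1 (0, 1))
  (c2 (0, 1) (0, 1)) (s1 (0, 1)) (s2 (0, 1)) dmy hy.
have ii (dm : R * R -> R) w : continuous dm -> (@leb2 R).-integrable setT (EFin \o
    (fun z : plane R => m z * 'D_w (fun z => 'D_w phi z) z + dm z * 'D_w phi z)).
  move=> cdm; apply: (continuous_supported_integrable A0).
    by apply: plane_contD; apply: plane_contM => //.
  by move=> z zA; rewrite (s2 w) // (s1 w) // !mulr0 addr0.
under eq_integral do rewrite /laplacian mulrDr addrACA EFinD.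
rewrite (integralD measurableT (ii _ _ cmx) (ii _ _ cmy)).
by rewrite [X in (X + _)%E]Ix [X in (_ + X)%E]Iy adde0.
Qed.

Section softmin.
Variables (R : realType) (S : seq R[i]) (k : nat).
Hypothesis S0 : S != [::].
Implicit Types (z : R * R) (a : R[i]).

Definition dist2 a z : R := (z.1 - complex.Re a) ^+ 2 + (z.2 - complex.Im a) ^+ 2.
(** The added term removes the singularity at a. It is tied to the exponent k + 1, so that a single
    limit both sharpens the minimum and removes the regularization. *)
Definition reg2 a z : R := dist2 a z + k.+1%:R^-1.
Definition wt a z : R := (reg2 a z)^-1 ^+ k.+1.
Definition wt_sum z : R := \sum_(a <- S) wt a z.
(* A smooth approximation of the minimum over a of ln |z - a|. *)
Definition softmin z : R := - (2 * k.+1%:R)^-1 * ln (wt_sum z).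
Definition softmin_x z : R := (wt_sum z)^-1 *
  \sum_(a <- S) wt a z * ((z.1 - complex.Re a) / reg2 a z).
Definition softmin_y z : R := (wt_sum z)^-1 *
  \sum_(a <- S) wt a z * ((z.2 - complex.Im a) / reg2 a z).

Lemma dist2_ge0 a z : 0 <= dist2 a z.
Proof. by rewrite addr_ge0 ?sqr_ge0. Qed.

Let k0 : 0 < k.+1%:R^-1 :> R. Proof. by rewrite invr_gt0. Qed.

Lemma reg2_gt0 a z : 0 < reg2 a z.
Proof. by rewrite ltr_wpDl ?dist2_ge0. Qed.

Lemma wt_gt0 a z : 0 < wt a z.
Proof. by rewrite exprn_gt0 // invr_gt0 reg2_gt0. Qed.

Lemma wt_sum_gt0 z : 0 < wt_sum z.
Proof.
rewrite /wt_sum; case: (S) S0 => // i s _; rewrite big_cons ltr_pwDl ?wt_gt0 //.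
by rewrite sumr_ge0 // => j _; exact/ltW/wt_gt0.
Qed.

Lemma is_derive_softmin_x (x y : R) :
  is_derive x (1 : R) (fun x => softmin (x, y)) (softmin_x (x, y)).
Proof.
pose r a := (y - complex.Im a) ^+ 2 + k.+1%:R^-1.
have r0 a : 0 < r a by rewrite ltr_wpDl ?sqr_ge0.
have E a u : (u - complex.Re a) ^+ 2 + r a = reg2 a (u, y) by rewrite /r /reg2 /dist2 addrA.
have := is_derive_softmin1 (@complex.Re R) k r0 S0 x.
rewrite /softmin1 /dsoftmin1 /wt1.
rewrite (_ : (fun u => _) = (fun u => softmin (u, y))); last first.
  by apply/funext => u; congr (_ * ln _); apply: eq_bigr => a _; rewrite E.
rewrite (_ : _ * _ = softmin_x (x, y)) //.
by congr (_^-1 * _); apply: eq_bigr => a _; rewrite E.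
Qed.

Lemma is_derive_softmin_y (x y : R) :
  is_derive y (1 : R) (fun y => softmin (x, y)) (softmin_y (x, y)).
Proof.
pose r a := (x - complex.Re a) ^+ 2 + k.+1%:R^-1.
have r0 a : 0 < r a by rewrite ltr_wpDl ?sqr_ge0.
have E a u : (u - complex.Im a) ^+ 2 + r a = reg2 a (x, u) by rewrite /r /reg2 /dist2 addrCA addrA.
have := is_derive_softmin1 (@complex.Im R) k r0 S0 y.
rewrite /softmin1 /dsoftmin1 /wt1.
rewrite (_ : (fun u => _) = (fun u => softmin (x, u))); last first.
  by apply/funext => u; congr (_ * ln _); apply: eq_bigr => a _; rewrite E.
rewrite (_ : _ * _ = softmin_y (x, y)) //.
by congr (_^-1 * _); apply: eq_bigr => a _; rewrite E.
Qed.

Lemma continuous_dist2 a : continuous (dist2 a).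
Proof.
apply: plane_contD; apply: plane_contX; apply: plane_contD; try exact: plane_cont_cst.
  exact: plane_cont_fst.
exact: plane_cont_snd.
Qed.

Lemma continuous_reg2V a : continuous (fun z => (reg2 a z)^-1).
Proof.
apply: plane_contV; first by move=> z; rewrite gt_eqF ?reg2_gt0.
by apply: plane_contD; [exact: continuous_dist2|exact: plane_cont_cst].
Qed.

Lemma continuous_wt a : continuous (wt a).
Proof. by apply: plane_contX; exact: continuous_reg2V. Qed.

Lemma continuous_wt_sum : continuous wt_sum.
Proof. by apply: plane_cont_sum => a; exact: continuous_wt. Qed.

Lemma continuous_wt_sumV : continuous (fun z => (wt_sum z)^-1).
Proof.
apply: plane_contV; last exact: continuous_wt_sum.
by move=> z; rewrite gt_eqF ?wt_sum_gt0.
Qed.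

Lemma continuous_softmin : continuous softmin.
Proof.
apply: plane_contM; first exact: plane_cont_cst.
apply: plane_cont_ln; last exact: continuous_wt_sum.
exact: wt_sum_gt0.
Qed.

Lemma continuous_softmin_x : continuous softmin_x.
Proof.
apply: plane_contM; first exact: continuous_wt_sumV.
apply: plane_cont_sum => a; apply: plane_contM; first exact: continuous_wt.
apply: plane_contM; last exact: continuous_reg2V.
by apply: plane_contD; [exact: plane_cont_fst|exact: plane_cont_cst].
Qed.

Lemma continuous_softmin_y : continuous softmin_y.
Proof.
apply: plane_contM; first exact: continuous_wt_sumV.
apply: plane_cont_sum => a; apply: plane_contM; first exact: continuous_wt.
apply: plane_contM; last exact: continuous_reg2V.
by apply: plane_contD; [exact: plane_cont_snd|exact: plane_cont_cst].
Qed.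

Lemma softmin_ibp (A : R) (phi : R * R -> R) : 0 <= A -> supported A phi ->
  (forall y u, derivable phi y u) -> (forall u, continuous (fun y => 'D_u phi y)) ->
  (forall w y u, derivable (fun z => 'D_w phi z) y u) ->
  (forall w u, continuous (fun y => 'D_u (fun z => 'D_w phi z) y)) ->
  (\int[@leb2 R]_z (softmin z * laplacian phi z +
    (softmin_x z * 'D_(1, 0) phi z + softmin_y z * 'D_(0, 1) phi z))%:E = 0)%E.
Proof.
move=> A0 sphi d1 c1 d2 c2.
exact: (laplacian_ibp A0 continuous_softmin continuous_softmin_x continuous_softmin_y
  is_derive_softmin_x is_derive_softmin_y sphi d1 c1 d2 c2).
Qed.

End softmin.

Lemma integral_laplacian (R : realType) (A : R) (phi : R * R -> R) : 0 <= A -> supported A phi ->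
  (forall y u, derivable phi y u) -> (forall u, continuous (fun y => 'D_u phi y)) ->
  (forall w y u, derivable (fun z => 'D_w phi z) y u) ->
  (forall w u, continuous (fun y => 'D_u (fun z => 'D_w phi z) y)) ->
  (\int[@leb2 R]_z (laplacian phi z)%:E = 0)%E.
Proof.
move=> A0 sphi d1 c1 d2 c2.
have := @laplacian_ibp R A (fun=> 1) (fun=> 0) (fun=> 0) phi A0 (@plane_cont_cst R 1)
  (@plane_cont_cst R 0) (@plane_cont_cst R 0) (fun x _ => is_derive_cst (1 : R) x (1 : R))
  (fun _ y => is_derive_cst (1 : R) y (1 : R)) sphi d1 c1 d2 c2.
by under eq_integral do rewrite mul1r !mul0r !addr0.
Qed.

Section softmin_limit.
Variable R : realType.
Implicit Types (S : seq R[i]) (z : R * R) (a b : R[i]) (k : nat).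

Lemma dist2E a z : dist2 a z = cabs (toC z - a) ^+ 2.
Proof. by rewrite cabs_toC sqr_sqrtr ?dist2_ge0. Qed.

Lemma dist2_gt0 a z : toC z != a -> 0 < dist2 a z.
Proof. by move=> za; rewrite dist2E exprn_gt0 // cabs_gt0 subr_eq0. Qed.

Lemma ln_dist2 a z : toC z != a -> ln (dist2 a z) = 2 * ln (cabs (toC z - a)).
Proof. by move=> za; rewrite dist2E lnXn ?mulr_natl // cabs_gt0 subr_eq0. Qed.

Lemma invS_le1 k : k.+1%:R^-1 <= 1 :> R.
Proof. by rewrite invf_le1 ?ltr0n // ler1n. Qed.

(** The sum of the weights lies between its largest term and [size S] times that term; the logarithm
    is then divided by 2 (k + 1). *)
Lemma softmin_near S k z a : a \in S ->
  (forall b, b \in S -> dist2 a z <= dist2 b z) ->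
  `|softmin S k z - ln (reg2 k a z) / 2| <= ln (size S)%:R / (2 * k.+1%:R).
Proof.
move=> aS Ha; have S0 : S != [::] by case: (S) aS.
have K0 : 0 < k.+1%:R :> R by rewrite ltr0n.
have wa0 := wt_gt0 k a z; have Z0 := wt_sum_gt0 k S0 z.
have lnwa : ln (wt k a z) = - (k.+1%:R * ln (reg2 k a z)).
  by rewrite lnXn ?invr_gt0 ?reg2_gt0 // lnV ?posrE ?reg2_gt0 // -[_ *+ k.+1]mulr_natl mulrN.
have Zge : wt k a z <= wt_sum S k z.
  rewrite /wt_sum (big_rem a) //= lerDl sumr_ge0 // => b _; exact/ltW/wt_gt0.
have Zle : wt_sum S k z <= (size S)%:R * wt k a z.
  have -> : (size S)%:R * wt k a z = \sum_(b <- S) wt k a z.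
    by rewrite big_const_seq count_predT iter_addr_0 mulr_natl.
  rewrite /wt_sum big_seq [leRHS]big_seq; apply: ler_sum => b bS.
  rewrite lerXn2r ?nnegrE ?invr_ge0 ?(ltW (reg2_gt0 _ _ _)) //.
  by rewrite lef_pV2 ?posrE ?reg2_gt0 // lerD2r Ha.
have s0 : 0 < (size S)%:R :> R by rewrite ltr0n lt0n size_eq0.
have l1 : ln (wt k a z) <= ln (wt_sum S k z) by rewrite ler_ln ?posrE.
have l2 : ln (wt_sum S k z) <= ln (size S)%:R + ln (wt k a z).
  by rewrite -lnM ?posrE // ler_ln ?posrE // mulr_gt0.
have -> : softmin S k z - ln (reg2 k a z) / 2 =
   - (ln (wt_sum S k z) - ln (wt k a z)) / (2 * k.+1%:R).
  by rewrite lnwa /softmin; field; rewrite gt_eqF.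
rewrite mulNr normrN ger0_norm; last by rewrite divr_ge0 ?mulr_ge0 ?subr_ge0 // ltW.
by rewrite ler_pM2r ?invr_gt0 ?mulr_gt0 //; lra.
Qed.

Lemma ln_size_ge0 S : 0 <= ln (size S)%:R :> R.
Proof.
case: (size S) => [|n]; first by rewrite ln0.
by rewrite ln_ge0 // ler1n.
Qed.

Lemma reg2_le1 k a z : reg2 k a z <= dist2 a z + 1.
Proof. by rewrite lerD2l invS_le1. Qed.

Lemma dist2_reg2 k a z : dist2 a z <= reg2 k a z.
Proof. by rewrite lerDl invr_ge0. Qed.

(** A majorant independent of k, for dominated convergence; it comes from [dist2] <= [reg2] <=
    [dist2] + 1. *)
Lemma softmin_le S k z : S != [::] -> toC z \notin S ->
  `|softmin S k z| <= ln (size S)%:R + \sum_(b <- S) (`|ln (cabs (toC z - b))| + dist2 b z + 1).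
Proof.
move=> S0 zS; have [a aS Ha] := exists_nearest (toC z) S0.
have za : toC z != a by apply: contraNneq zS => ->.
have Ha2 b : b \in S -> dist2 a z <= dist2 b z.
  by move=> bS; rewrite !dist2E ler_sqr ?nnegrE ?cabs_ge0 // Ha.
have h1 := softmin_near k aS Ha2; have l0 := ln_size_ge0 S.
have h2 : ln (size S)%:R / (2 * k.+1%:R) <= ln (size S)%:R :> R.
  have K1 : 1 <= k.+1%:R :> R by rewrite ler1n.
  by rewrite ler_piMr // invf_le1; lra.
have d0 := dist2_gt0 za.
have h3 : `|ln (reg2 k a z) / 2| <= `|ln (cabs (toC z - a))| + dist2 a z + 1.
  have k1 : ln (dist2 a z) <= ln (reg2 k a z) by rewrite ler_ln ?posrE ?reg2_gt0 // dist2_reg2.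
  have k2 : ln (reg2 k a z) <= dist2 a z + 1.
    by apply: (le_trans (ln_le_id (reg2_gt0 _ _ _))); exact: reg2_le1.
  move: k1; rewrite ln_dist2 //; have := ler_norm (- ln (cabs (toC z - a))); rewrite normrN.
  have := normr_ge0 (ln (cabs (toC z - a))).
  by move=> *; rewrite ler_norml; apply/andP; split; lra.
have h4 : `|ln (cabs (toC z - a))| + dist2 a z + 1 <= \sum_(b <- S) (`|ln (cabs (toC z - b))| + dist2 b z + 1).
  rewrite (big_rem a) //= lerDl sumr_ge0 // => b _.
  by have := dist2_ge0 b z; have := normr_ge0 (ln (cabs (toC z - b))); lra.
have := ler_normD (softmin S k z - ln (reg2 k a z) / 2) (ln (reg2 k a z) / 2).
rewrite subrK => h5; have h6 := le_trans h1 h2; have h7 := le_trans h3 h4.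
by apply: (le_trans h5); apply: lerD.
Qed.

Lemma cvg_invS : (k.+1%:R^-1 : R) @[k --> \oo] --> (0 : R).
Proof. exact: cvg_harmonic. Qed.

Lemma softmin_cvg S z a : a \in S -> toC z \notin S ->
  (forall b, b \in S -> cabs (toC z - a) <= cabs (toC z - b)) ->
  softmin S k z @[k --> \oo] --> log_dist S z.
Proof.
move=> aS zS Ha; have za : toC z != a by apply: contraNneq zS => ->.
have Ha2 b : b \in S -> dist2 a z <= dist2 b z.
  by move=> bS; rewrite !dist2E ler_sqr ?nnegrE ?cabs_ge0 // Ha.
have d0 := dist2_gt0 za.
have c1 : ln (reg2 k a z) / 2 @[k --> \oo] --> log_dist S z.
  have cr : reg2 k a z @[k --> \oo] --> dist2 a z.
    by have := cvgD (cvg_cst (dist2 a z)) cvg_invS; rewrite addr0 => H; exact: H.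
  have cl : ln (reg2 k a z) @[k --> \oo] --> ln (dist2 a z).
    by apply: continuous_cvg; [exact: continuous_ln|exact: cr].
  have -> : log_dist S z = ln (dist2 a z) / 2.
    by rewrite (log_distE aS za Ha) ln_dist2 // mulrC mulKf.
  exact: cvgMr_tmp cl.
have c2 : softmin S k z - ln (reg2 k a z) / 2 @[k --> \oo] --> (0 : R).
  apply/cvgr0Pnorm_le => e e0.
  have c3 : (ln (size S)%:R / 2) * (k.+1%:R^-1) @[k --> \oo] --> (0 : R).
    by rewrite -(mulr0 (ln (size S)%:R / 2)); apply: cvgMl_tmp; exact: cvg_invS.
  move/cvgr0Pnorm_le : c3 => /(_ e e0); apply: filterS => k.
  apply: le_trans; apply: (le_trans (softmin_near k aS Ha2)); rewrite invfM mulrA.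
  exact: ler_norm.
have H := cvgD c2 c1; rewrite add0r in H.
rewrite (_ : (fun k => softmin S k z) =
  (fun k => softmin S k z - ln (reg2 k a z) / 2 + ln (reg2 k a z) / 2)); first exact: H.
by apply/funext => k; rewrite subrK.
Qed.

(** Dominates the gradient kernel by a product of integrable functions of one variable. With |x| =
    u^2 and |y| = v^2 the claim is u^3 v <= u^4 + v^4. *)
Lemma div_sqr_isqrt_le (x y c : R) : x != 0 -> y != 0 -> x ^+ 2 + y ^+ 2 <= c ->
  `|x / c| <= isqrt x * isqrt y.
Proof.
move=> x0 y0 xyc; rewrite /isqrt.
have u0 : 0 < Num.sqrt `|x| by rewrite sqrtr_gt0 normr_gt0.
have v0 : 0 < Num.sqrt `|y| by rewrite sqrtr_gt0 normr_gt0.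
have xu : `|x| = Num.sqrt `|x| ^+ 2 by rewrite sqr_sqrtr.
have yv : `|y| = Num.sqrt `|y| ^+ 2 by rewrite sqr_sqrtr.
have c0 : 0 < c.
  apply: lt_le_trans xyc; rewrite ltr_pwDl ?sqr_ge0 //.
  by rewrite lt0r sqrf_eq0 x0 sqr_ge0.
rewrite normrM normfV (gtr0_norm c0) ler_pdivrMr // -invfM ler_pdivlMl ?mulr_gt0 //.
apply: le_trans xyc; rewrite -(real_normK (num_real x)) -(real_normK (num_real y)).
move: (Num.sqrt `|x|) (Num.sqrt `|y|) u0 v0 xu yv => u v u0 v0 -> ->.
have uv0 : 0 < u * v by rewrite mulr_gt0.
rewrite [(u ^+ 2) ^+ 2]expr2 [(v ^+ 2) ^+ 2]expr2.
have u20 := sqr_ge0 u; have v20 := sqr_ge0 v.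
have uu : 0 <= u ^+ 2 * u ^+ 2 by rewrite mulr_ge0.
have vv : 0 <= v ^+ 2 * v ^+ 2 by rewrite mulr_ge0.
have [uv|vu] := leP v u.
  have : u * v * u ^+ 2 <= u ^+ 2 * u ^+ 2 by rewrite ler_wpM2r // expr2 ler_pM2l.
  by lra.
have : u * v * u ^+ 2 <= v ^+ 2 * v ^+ 2.
  apply: ler_pM => //; first exact: ltW.
    by rewrite expr2 ler_pM2r // ltW.
  by rewrite ler_sqr ?nnegrE ltW.
by lra.
Qed.

Lemma wt_ratio_le1 S k z b : b \in S -> wt k b z / wt_sum S k z <= 1.
Proof.
move=> bS; have S0 : S != [::] by case: (S) bS.
rewrite ler_pdivrMr ?wt_sum_gt0 // mul1r /wt_sum (big_rem b) //= lerDl sumr_ge0 //.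
by move=> c _; exact/ltW/wt_gt0.
Qed.

(* The x and y components of the gradient are treated at once: g b is the
   corresponding coordinate of z - b. *)
Definition soft_mean S k z (g : R[i] -> R) : R :=
  (wt_sum S k z)^-1 * \sum_(a <- S) wt k a z * (g a / reg2 k a z).

Lemma soft_mean_le S k z g (h : R[i] -> R) : S != [::] ->
  (forall b, b \in S -> `|g b / reg2 k b z| <= h b) ->
  `|soft_mean S k z g| <= \sum_(b <- S) h b.
Proof.
move=> S0 gh; rewrite /soft_mean mulr_sumr; apply: (le_trans (ler_norm_sum _ _ _)).
rewrite big_seq [leRHS]big_seq; apply: ler_sum => b bS.
rewrite (mulrA _^-1 (wt k b z)) normrM; apply: (@le_trans _ _ (1 * h b)); last by rewrite mul1r.
apply: ler_pM; [by []|by []| |exact: gh].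
rewrite ger0_norm; last by rewrite mulr_ge0 ?invr_ge0 ?(ltW (wt_gt0 _ _ _)) // ltW // wt_sum_gt0.
by rewrite mulrC wt_ratio_le1.
Qed.

Lemma soft_mean_cvg S z a g : a \in S -> toC z \notin S ->
  (forall b, b \in S -> b != a -> cabs (toC z - a) < cabs (toC z - b)) ->
  soft_mean S k z g @[k --> \oo] --> g a / dist2 a z.
Proof.
move=> aS zS Ha; have S0 : S != [::] by case: (S) aS.
have zb b : b \in S -> toC z != b by move=> bS; apply: contraNneq zS => ->.
have d0 b : b \in S -> 0 < dist2 b z by move=> bS; exact: dist2_gt0 (zb b bS).
have lt2 b : b \in S -> b != a -> dist2 a z < dist2 b z.
  by move=> bS ba; rewrite !dist2E ltr_sqr ?nnegrE ?cabs_ge0 // Ha.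
have ca : g a / reg2 k a z @[k --> \oo] --> g a / dist2 a z.
  apply: cvgMl_tmp; apply: cvgV; first by rewrite gt_eqF ?d0.
  by have := cvgD (cvg_cst (dist2 a z)) cvg_invS; rewrite addr0 => H; exact: H.
(* The normalized weights sum to 1, so the value at a can be subtracted inside the mean: the term of
   a vanishes and every other one has a weight tending to 0. *)
pose t b k := wt k b z / wt_sum S k z * (g b / reg2 k b z - g a / reg2 k a z).
have E k : soft_mean S k z g = \sum_(b <- S) t b k + g a / reg2 k a z.
  rewrite /t; under eq_bigr do rewrite mulrBr.
  rewrite sumrB /soft_mean -!mulr_suml -/(wt_sum S k z).
  rewrite divff ?gt_eqF ?wt_sum_gt0 // mul1r subrK mulr_sumr; apply: eq_bigr => b _.
  by rewrite (mulrA _^-1 (wt k b z)) [_^-1 * wt _ _ _]mulrC.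
suff ct : \sum_(b <- S) t b k @[k --> \oo] --> (0 : R).
  have H := cvgD ct ca; rewrite add0r in H.
  rewrite (_ : (fun k => soft_mean S k z g) = (fun k => \sum_(b <- S) t b k + g a / reg2 k a z)).
    exact: H.
  by apply/funext => k; exact: E.
suff H (s : seq R[i]) : {subset s <= S} -> \sum_(b <- s) t b k @[k --> \oo] --> (0 : R) by exact: H.
elim: s => [|b s IH] sS.
  rewrite (_ : (fun k => _) = fun=> 0); first exact: cvg_cst.
  by apply/funext => k; rewrite big_nil.
have {}IH := IH (fun x xs => sS x (@mem_behead _ (b :: s) x xs)).
have bS : b \in S by apply: sS; rewrite mem_head.
suff tb : t b k @[k --> \oo] --> (0 : R).
  have H := cvgD tb IH; rewrite addr0 in H.
  rewrite (_ : (fun k => _) = (fun k => t b k + \sum_(c <- s) t c k)); first exact: H.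
  by apply/funext => k; rewrite big_cons.
have [->|ba] := eqVneq b a.
  rewrite (_ : (fun k => _) = fun=> 0); first exact: cvg_cst.
  by apply/funext => k; rewrite /t subrr mulr0.
have lt_ab := lt2 b bS ba; have da := d0 a aS; have db := d0 b bS.
(* For u < v the quotient (u + e) / (v + e) increases with e; its value at e = 1 bounds the ratio of
   the weights for all k at once. *)
pose rho := (dist2 a z + 1) / (dist2 b z + 1).
have rho0 : 0 <= rho by rewrite divr_ge0 // addr_ge0 // ltW.
have rho1 : `|rho| < 1 by rewrite ger0_norm // ltr_pdivrMr ?mul1r ?ltrD2r // ltr_wpDl // ltW.
pose K := `|g b| / dist2 b z + `|g a| / dist2 a z.
have K0 : 0 <= K by rewrite addr_ge0 // divr_ge0 // ltW.
apply: norm_cvg0.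
apply: (@squeeze_cvgr _ _ _ _ (fun _ => 0) (fun k => K * rho * rho ^+ k)); last first.
- by have := @cvg_geometric R (K * rho) _ rho1.
- exact: cvg_cst.
apply: nearW => k; rewrite normr_ge0 /= /t normrM.
have Z0 := wt_sum_gt0 k S0 z; have ra := reg2_gt0 k a z; have rb := reg2_gt0 k b z.
have w1 : `|wt k b z / wt_sum S k z| <= rho ^+ k.+1.
  rewrite ger0_norm; last by rewrite divr_ge0 // ltW // wt_gt0.
  apply: (@le_trans _ _ (wt k b z / wt k a z)).
    rewrite ler_wpM2l ?(ltW (wt_gt0 _ _ _)) // lef_pV2 ?posrE ?wt_gt0 //.
    rewrite /wt_sum (big_rem a) //= lerDl sumr_ge0 // => c _; exact/ltW/wt_gt0.
  rewrite /wt -exprVn invrK -exprMn lerXn2r ?nnegrE ?rho0 //.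
    by rewrite mulr_ge0 ?invr_ge0 // ltW.
  rewrite /rho mulrC ler_pdivrMr // mulrAC ler_pdivlMr ?ltr_wpDl ?(ltW db) //.
  have := invS_le1 k; have : 0 <= k.+1%:R^-1 :> R by rewrite invr_ge0.
  by rewrite /reg2; move: (k.+1%:R^-1) => e; nra.
have w2 : `|g b / reg2 k b z - g a / reg2 k a z| <= K.
  apply: (le_trans (ler_normB _ _)); rewrite !normrM !normfV (gtr0_norm ra) (gtr0_norm rb).
  by apply: lerD; rewrite ler_wpM2l // lef_pV2 ?posrE // dist2_reg2.
by rewrite -mulrA -exprS mulrC; apply: ler_pM.
Qed.

End softmin_limit.

Section gradient_identity.
Variable R : realType.
Implicit Types (S : seq R[i]) (z : R * R) (a b : R[i]).

(** Squared distances make the conditions affine in z, hence affine along each ray. *)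
Definition cell S a : set (R * R) := [set z | all (fun b => dist2 a z <= dist2 b z) S].

Lemma measurable_cell S a : measurable (cell S a : set (plane R)).
Proof.
elim: S => [|b S IH].
  by rewrite (_ : cell [::] a = setT) //; apply/seteqP; split.
rewrite (_ : cell (b :: S) a = [set z | dist2 a z <= dist2 b z] `&` cell S a); last first.
  by apply/seteqP; split => z /=; [move=> /andP|move=> /andP].
apply: measurableI => //; apply: closed_plane_measurable.
rewrite (_ : [set z | _] = (fun z => dist2 b z - dist2 a z) @^-1` [set x | 0 <= x]); last first.
  by apply/seteqP; split => z /=; rewrite subr_ge0.
apply: closed_comp; last exact: closed_ge.
move=> z _; apply: plane_contD; first exact: continuous_dist2.
by move=> w; apply: cvgN; exact: continuous_dist2.
Qed.

(* The inner product of the gradients of ln |z - a| and phi, on the Voronoi cell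
   of a. *)
Definition radial_cell S a (phi : R * R -> R) z : R :=
  \1_(cell S a) z * (((z.1 - complex.Re a) * 'D_(1, 0) phi z
    + (z.2 - complex.Im a) * 'D_(0, 1) phi z) / dist2 a z).

Lemma cell_generic S z a : a \in S ->
  (forall b, b \in S -> b != a -> cabs (toC z - a) < cabs (toC z - b)) ->
  forall b, b \in S -> \1_(cell S b) z = (b == a)%:R :> R.
Proof.
move=> aS Ha b bS; rewrite indicE; congr (nat_of_bool _)%:R.
apply/idP/eqP; rewrite inE /cell /=.
  move=> /allP /(_ a aS); rewrite !dist2E ler_sqr ?nnegrE ?cabs_ge0 // => h.
  by apply/eqP; apply: contraT => ba; have := Ha b bS ba; rewrite ltNge h.
move=> ->; apply/allP => c cS; rewrite !dist2E ler_sqr ?nnegrE ?cabs_ge0 //.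
by have [->//|ca] := eqVneq c a; exact/ltW/Ha.
Qed.

Lemma sum_radial_cell_generic S z a phi : uniq S -> a \in S ->
  (forall b, b \in S -> b != a -> cabs (toC z - a) < cabs (toC z - b)) ->
  \sum_(b <- S) radial_cell S b phi z =
  (z.1 - complex.Re a) / dist2 a z * 'D_(1, 0) phi z
    + (z.2 - complex.Im a) / dist2 a z * 'D_(0, 1) phi z.
Proof.
move=> uS aS Ha; rewrite (bigD1_seq a) //= [X in _ + X]big_seq_cond big1 ?addr0.
  rewrite /radial_cell (cell_generic aS Ha) // eqxx mul1r mulrDl.
  by congr (_ + _); rewrite mulrAC.
by move=> b /andP[bS ba]; rewrite /radial_cell (cell_generic aS Ha) // (negbTE ba) mul0r.
Qed.

End gradient_identity.

Section supported_integrals.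
Variables (R : realType) (A : R).
Local Notation D := (square A : set (plane R)).

Lemma integral_supported (f : plane R -> R) : supported A f ->
  (\int[@leb2 R]_z (f z)%:E = \int[@leb2 R]_(z in D) (f z)%:E)%E.
Proof.
move=> sf; rewrite [RHS]integral_mkcond; apply: eq_integral => z _; rewrite /patch.
by case: ifPn => // /negP; rewrite inE => /sf /= ->.
Qed.

Lemma supported_integrable_ae (f h : plane R -> R) : measurable_fun setT f -> measurable_fun setT h ->
  supported A f -> (forall z, 0 <= h z) -> (\int[@leb2 R]_(z in D) (h z)%:E < +oo)%E ->
  {ae @leb2 R, forall z, D z -> `|f z| <= h z} -> (@leb2 R).-integrable setT (EFin \o f).
Proof.
move=> mf mh sf h0 hfin fh; apply/integrableP; split; first exact/measurable_EFinP.
have mD : measurable D by exact: measurable_square.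
rewrite (_ : (\int[@leb2 R]_z `|(EFin \o f) z| = \int[@leb2 R]_(z in D) `|(f z)%:E|)%E).
  apply: le_lt_trans hfin; apply: ae_ge0_le_integral => //.
  - by apply: measurable_funTS; apply: measurableT_comp => //; exact/measurable_EFinP.
  - by move=> z _; rewrite lee_fin.
  - exact/measurable_EFinP/measurable_funTS.
rewrite [RHS]integral_mkcond; apply: eq_integral => z _; rewrite /patch.
by case: ifPn => // /negP; rewrite inE => /sf /= ->; rewrite normr0.
Qed.

Lemma supportedM (f g : R * R -> R) : supported A g -> supported A (fun z => f z * g z).
Proof. by move=> sg z /sg ->; rewrite mulr0. Qed.

End supported_integrals.

Lemma integral_sum_seq d (T : measurableType d) (R : realType) (mu : {measure set T -> \bar R})
    (I : eqType) (s : seq I) (F : I -> T -> R) :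
  (forall i, i \in s -> mu.-integrable setT (EFin \o F i)) ->
  mu.-integrable setT (fun z => (\sum_(i <- s) F i z)%:E) /\
  (\int[mu]_z (\sum_(i <- s) F i z)%:E = \sum_(i <- s) \int[mu]_z (F i z)%:E)%E.
Proof.
elim: s => [|i s IH] H.
  rewrite big_nil; under [X in _.-integrable _ X]eq_fun do rewrite big_nil.
  under eq_integral do rewrite big_nil.
  by rewrite integral0; split => //; exact: integrable0.
have [IH1 IH2] := IH (fun j js => H j (@mem_behead _ (i :: s) j js)).
have Hi := H i (mem_head i s).
under [X in _.-integrable _ X]eq_fun do rewrite big_cons EFinD.
under eq_integral do rewrite big_cons EFinD.
rewrite big_cons -IH2; split; last by rewrite integralD.
exact: integrableD.
Qed.

Lemma sqrB_le (R : realType) (A x y : R) : - A <= x -> x <= A -> - A <= y -> y <= A ->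
  (x - y) ^+ 2 <= 4 * A ^+ 2.
Proof. nra. Qed.

Section gradient_identity.
Variables (R : realType) (S : seq R[i]) (A : R) (phi : R * R -> R).
Local Notation D := (square A : set (plane R)).
Hypotheses (uS : uniq S) (S0 : S != [::]) (A1 : 1 <= A) (SA : forall b, b \in S -> cabs b <= A).
Hypotheses (sphi : supported A phi) (d1 : forall y u, derivable phi y u)
  (c1 : forall u, continuous (fun y => 'D_u phi y))
  (d2 : forall w y u, derivable (fun z => 'D_w phi z) y u)
  (c2 : forall w u, continuous (fun y => 'D_u (fun z => 'D_w phi z) y)).

Let A0 : 0 < A. Proof. exact: lt_le_trans A1. Qed.
Let D0 : 0 < (2 * A) ^+ 2. Proof. by rewrite exprn_gt0 // mulr_gt0. Qed.
Let mD : measurable D. Proof. exact: measurable_square. Qed.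

Let s1 w : supported A (fun z => 'D_w phi z).
Proof. exact: supported_derive. Qed.

Lemma supported_laplacian : supported A (laplacian phi).
Proof.
have s2 w : supported A (fun z => 'D_w (fun y => 'D_w phi y) z) by apply: supported_derive.
by move=> z zA; rewrite /laplacian (s2 (1, 0)) // (s2 (0, 1)) // addr0.
Qed.

Lemma continuous_laplacian : continuous (laplacian phi).
Proof. by apply: plane_contD; exact: c2. Qed.

Let bound : exists2 M, 0 < M & forall z, [/\ `|laplacian phi z| <= M,
  `|'D_(1, 0) phi z| <= M & `|'D_(0, 1) phi z| <= M].
Proof.
have [M1 M10 H1] := supported_bounded continuous_laplacian supported_laplacian.
have [M2 M20 H2] := supported_bounded (@c1 (1, 0)) (@s1 (1, 0)).
have [M3 M30 H3] := supported_bounded (@c1 (0, 1)) (@s1 (0, 1)).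
exists (M1 + M2 + M3); first by rewrite !addr_gt0.
move=> z; split.
- by apply: (le_trans (H1 z)); rewrite -addrA lerDl addr_ge0 // ltW.
- by apply: (le_trans (H2 z)); rewrite addrAC lerDr addr_ge0 // ltW.
- by apply: (le_trans (H3 z)); rewrite lerDr addr_ge0 // ltW.
Qed.

(** The cutoff makes the integral bound hold for every a, the form in which [integral_sum_seq_le]
    asks for it. *)
Definition isqrt_prod (a : R[i]) (z : plane R) : R :=
  if cabs a <= A then isqrt (z.1 - complex.Re a) * isqrt (z.2 - complex.Im a) else 0.

Lemma Im_le_cabs (a : R[i]) : `|complex.Im a| <= cabs a.
Proof. by case: a => u v; rewrite /cabs /= -sqrtr_sqr ler_wsqrtr // lerDr sqr_ge0. Qed.

Lemma isqrt_prod_ge0 a z : 0 <= isqrt_prod a z.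
Proof. by rewrite /isqrt_prod; case: ifP => // _; rewrite mulr_ge0 // isqrt_ge0. Qed.

Let misq (r : R) : measurable_fun setT (fun x : R => isqrt (x - r)).
Proof. by apply: (measurableT_comp (@measurable_isqrt R)); exact: measurable_funB. Qed.

Lemma measurable_isqrt_prod a : measurable_fun setT (isqrt_prod a).
Proof.
have -> : isqrt_prod a = if cabs a <= A
    then fun z : plane R => isqrt (z.1 - complex.Re a) * isqrt (z.2 - complex.Im a) else fun=> 0.
  by apply/funext => z; rewrite /isqrt_prod; case: ifP.
case: ifP => // _; apply: measurable_funM.
  by apply: (measurableT_comp (@misq (complex.Re a))).
by apply: (measurableT_comp (@misq (complex.Im a))).
Qed.

Definition isqrt_prod_bound : R := (4 * Num.sqrt (2 * A)) * (4 * Num.sqrt (2 * A)).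

Lemma integral_isqrt_prod a :
  (\int[@leb2 R]_(z in D) (isqrt_prod a z)%:E <= isqrt_prod_bound%:E)%E.
Proof.
have sq0 : 0 <= 4 * Num.sqrt (2 * A) by rewrite mulr_ge0 // sqrtr_ge0.
rewrite /isqrt_prod; have [aA|aA] := leP (cabs a) A; last first.
  by rewrite integral0 lee_fin mulr_ge0.
rewrite (integral_square_prod A (misq (complex.Re a)) (misq (complex.Im a))); first last.
- by move=> x; exact: isqrt_ge0.
- by move=> x; exact: isqrt_ge0.
rewrite EFinM; apply: lee_pmul.
- by apply: integral_ge0 => x _; rewrite lee_fin isqrt_ge0.
- by apply: integral_ge0 => x _; rewrite lee_fin isqrt_ge0.
- by apply: integral_isqrt_shift => //; exact: le_trans (Re_le_cabs a) aA.
- by apply: integral_isqrt_shift => //; exact: le_trans (Im_le_cabs a) aA.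
Qed.

(** The horizontal and vertical lines through the poles are discarded too: there [isqrt] takes its
    default value and dominates nothing. *)
Let ae_good : {ae @leb2 R, forall z, generic S z /\
  (forall b, b \in S -> z.1 != complex.Re b /\ z.2 != complex.Im b)}.
Proof.
have FF := ae_filter_ringOfSetsType (@leb2 R).
have H : {ae @leb2 R, forall z, forall b, b \in S -> z.1 != complex.Re b /\ z.2 != complex.Im b}.
  apply: ae_all_seq => b _.
  have h1 : {ae @leb2 R, forall z, 1 * z.1 + 0 * z.2 != complex.Re b}.
    by apply: line_ae; rewrite oner_neq0.
  have h2 : {ae @leb2 R, forall z, 0 * z.1 + 1 * z.2 != complex.Im b}.
    by apply: line_ae; rewrite oner_neq0 orbT.
  apply: (@filterS _ _ FF _ _ _ (@filterI _ _ FF _ _ h1 h2)) => z [].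
  by rewrite !mul1r !mul0r addr0 add0r.
apply: (@filterS _ _ FF _ _ _ (@filterI _ _ FF _ _ (generic_ae S0) H)) => z [? ?]; split => //.
Qed.

(** One majorant for all integrands: M bounds the derivatives of phi, the squared kernels dominate
    the logarithms through |x| <= 1 + x^2, and the last sum dominates the two gradient components,
    whence the factor 2. *)
Let dom c M z := c + M * \sum_(b <- S) log_kernel A b z ^+ 2 + (2 * M) * \sum_(b <- S) isqrt_prod b z.

Let mlk b : measurable_fun setT ((fun z => log_kernel A b z ^+ 2) : plane R -> R).
Proof. by apply: measurable_funX; exact: measurable_log_kernel. Qed.

Let mdom c M : measurable_fun setT (dom c M : plane R -> R).
Proof.
apply: measurable_funD; first apply: measurable_funD => //.
  by apply: measurable_funM => //; exact: measurable_sum.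
by apply: measurable_funM => //; apply: measurable_sum => a; exact: measurable_isqrt_prod.
Qed.

Let dom_ge0 c M z : 0 <= c -> 0 <= M -> 0 <= dom c M z.
Proof.
move=> c0 M0; rewrite !addr_ge0 // mulr_ge0 ?mulr_ge0 // sumr_ge0 // => b _; rewrite ?sqr_ge0 //.
exact: isqrt_prod_ge0.
Qed.

Let int_dom c M : 0 <= c -> 0 <= M -> (\int[@leb2 R]_(z in D) (dom c M z)%:E < +oo)%E.
Proof.
move=> c0 M0; apply: (@le_lt_trans _ _ (c * (2 * A) ^+ 2 + M * ((size S)%:R * log_kernel_bound A)
   + 2 * M * ((size S)%:R * isqrt_prod_bound) + 0 * 0)%:E); last exact: ltry.
apply: (@integral_le_lin3 _ _ _ (@leb2 R) D _ mD (leb2_square_fin A1) (dom c M)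
  (fun z => \sum_(b <- S) log_kernel A b z ^+ 2) (fun z => \sum_(b <- S) isqrt_prod b z) (fun => 0)) => //.
- exact: measurable_funTS.
- by apply: measurable_funTS; exact: measurable_sum.
- by apply: measurable_funTS; apply: measurable_sum => a; exact: measurable_isqrt_prod.
- by move=> z _; exact: dom_ge0.
- by move=> z _; rewrite sumr_ge0 // => b _; rewrite sqr_ge0.
- by move=> z _; rewrite sumr_ge0 // => b _; rewrite isqrt_prod_ge0.
- by rewrite mulr_ge0.
- apply: (@integral_sum_seq_le R A S (fun a z => log_kernel A a z ^+ 2)) => //.
  + by move=> a z; rewrite sqr_ge0.
  + by move=> a; exact: integral_sqr_log_kernel.
- apply: (@integral_sum_seq_le R A S isqrt_prod).
  + exact: measurable_isqrt_prod.
  + exact: isqrt_prod_ge0.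
  + exact: integral_isqrt_prod.
- by rewrite integral0.
- by move=> z _; rewrite mul0r addr0.
Qed.

Let abs_le_sqr (x : R) : `|x| <= 1 + x ^+ 2.
Proof. by have := normr_ge0 x; rewrite -(real_normK (num_real x)); nra. Qed.

Let ln_kernel b z : b \in S -> ln (cabs (toC z - b)) = log_kernel A b z.
Proof. by move=> bS; rewrite /log_kernel (le_trans (SA bS)) //; move: (A0); lra. Qed.

Lemma integrable_log_dist psi : continuous psi -> supported A psi ->
  (@leb2 R).-integrable setT (EFin \o (fun z : plane R => log_dist S z * psi z)).
Proof.
move=> cpsi spsi; have [M M0 HM] := supported_bounded cpsi spsi.
have FF := ae_filter_ringOfSetsType (@leb2 R).
pose c := M * (size S)%:R.
have c0 : 0 <= c by rewrite mulr_ge0 // ltW.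
apply: (@supported_integrable_ae R A _ (dom c M)) => //.
- by apply: measurable_funM; [exact: measurable_log_dist|exact: continuous_plane_measurable].
- exact: supportedM.
- by move=> z; apply: dom_ge0 => //; exact: ltW.
- by apply: int_dom => //; exact: ltW.
apply: (@filterS _ _ FF _ _ _ (points_ae S)) => z zS _.
have k1 : `|log_dist S z| <= (size S)%:R + \sum_(b <- S) log_kernel A b z ^+ 2.
  apply: (le_trans (log_dist_le S0 zS)).
  have -> : (size S)%:R = \sum_(b <- S) 1 :> R.
    by rewrite big_const_seq count_predT iter_addr_0.
  rewrite -big_split /= big_seq [leRHS]big_seq; apply: ler_sum => b bS.
  by rewrite ln_kernel // abs_le_sqr.
have i0 : 0 <= 2 * M * \sum_(b <- S) isqrt_prod b z.
  by rewrite !mulr_ge0 ?(ltW M0) // sumr_ge0 // => b _; exact: isqrt_prod_ge0.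
rewrite /dom /c normrM -mulrDr; apply: ler_wpDr => //; rewrite mulrC.
by apply: ler_pM.
Qed.

Lemma measurable_radial_cell a : measurable_fun setT (radial_cell S a phi : plane R -> R).
Proof.
apply: measurable_funM; first exact: measurable_indic (measurable_cell S a).
apply: measurable_funM.
  apply: continuous_plane_measurable; apply: plane_contD; apply: plane_contM; try exact: c1.
    by apply: plane_contD; [exact: plane_cont_fst|exact: plane_cont_cst].
  by apply: plane_contD; [exact: plane_cont_snd|exact: plane_cont_cst].
apply: (measurableT_comp (@measurable_invr R)).
by apply: continuous_plane_measurable; exact: continuous_dist2.
Qed.

Lemma integrable_radial_cell a : a \in S ->
  (@leb2 R).-integrable setT (EFin \o (radial_cell S a phi : plane R -> R)).
Proof.
move=> aS; have [M M0 HM] := bound.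
have FF := ae_filter_ringOfSetsType (@leb2 R).
apply: (@supported_integrable_ae R A _ (dom 0 M)) => //.
- exact: measurable_radial_cell.
- by move=> z zA; rewrite /radial_cell (@s1 (1, 0)) // (@s1 (0, 1)) // !mulr0 addr0 mul0r mulr0.
- by move=> z; apply: dom_ge0 => //; exact: ltW.
- by apply: int_dom => //; exact: ltW.
apply: (@filterS _ _ FF _ _ _ ae_good) => z [_ Hz] _.
have [za1 za2] := Hz a aS; have [_ H1 H2] := HM z.
have k0 : 0 <= M * \sum_(b <- S) log_kernel A b z ^+ 2.
  by rewrite mulr_ge0 ?(ltW M0) // sumr_ge0 // => b _; rewrite sqr_ge0.
have i0 : isqrt_prod a z <= \sum_(b <- S) isqrt_prod b z.
  by rewrite (big_rem a) //= lerDl sumr_ge0 // => b _; exact: isqrt_prod_ge0.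
have e1 : `|(z.1 - complex.Re a) / dist2 a z| <= isqrt_prod a z.
  rewrite /isqrt_prod SA //; apply: div_sqr_isqrt_le; rewrite ?subr_eq0 //.
have e2 : `|(z.2 - complex.Im a) / dist2 a z| <= isqrt_prod a z.
  rewrite /isqrt_prod SA // [isqrt _ * _]mulrC; apply: div_sqr_isqrt_le; rewrite ?subr_eq0 //.
  by rewrite /dist2 addrC.
rewrite /dom add0r; apply: ler_wpDl => //; rewrite /radial_cell normrM.
apply: (@le_trans _ _ (1 * (2 * M * isqrt_prod a z))); last first.
  by rewrite mul1r ler_wpM2l // mulr_ge0 // ltW.
apply: ler_pM => //; first by rewrite indicE; case: (_ \in _); rewrite ?normr1 ?normr0.
rewrite mulrDl (mulrAC _ ('D_(1, 0) phi z)) (mulrAC _ ('D_(0, 1) phi z)).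
apply: (le_trans (ler_normD _ _)); rewrite (normrM _ ('D_(1, 0) phi z)) (normrM _ ('D_(0, 1) phi z)).
rewrite (_ : 2 * M * isqrt_prod a z = isqrt_prod a z * M + isqrt_prod a z * M); last by ring.
exact: lerD (ler_pM (normr_ge0 _) (normr_ge0 _) e1 H1) (ler_pM (normr_ge0 _) (normr_ge0 _) e2 H2).
Qed.

Let f k z := softmin S k z * laplacian phi z +
    (softmin_x S k z * 'D_(1, 0) phi z + softmin_y S k z * 'D_(0, 1) phi z).
Let flim z := log_dist S z * laplacian phi z + \sum_(a <- S) radial_cell S a phi z.

Let sf k : supported A (f k).
Proof.
move=> z zA; rewrite /f supported_laplacian // (@s1 (1, 0)) // (@s1 (0, 1)) //.
by rewrite !mulr0 !addr0.
Qed.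

Let cf k : continuous (f k).
Proof.
apply: plane_contD; first apply: plane_contM.
- exact: continuous_softmin.
- exact: continuous_laplacian.
apply: plane_contD; apply: plane_contM; try exact: c1.
- exact: continuous_softmin_x.
- exact: continuous_softmin_y.
Qed.

Let mflim : measurable_fun setT (flim : plane R -> R).
Proof.
apply: measurable_funD.
  apply: measurable_funM; first exact: measurable_log_dist.
  by apply: continuous_plane_measurable; exact: continuous_laplacian.
by apply: measurable_sum => a; exact: measurable_radial_cell.
Qed.

Let dom_f M : 0 < M -> (forall z, [/\ `|laplacian phi z| <= M,
    `|'D_(1, 0) phi z| <= M & `|'D_(0, 1) phi z| <= M]) ->
  forall k z, generic S z -> (forall b, b \in S -> z.1 != complex.Re b /\ z.2 != complex.Im b) ->
  D z -> `|f k z| <= dom (M * (ln (size S)%:R + (size S)%:R * (8 * A ^+ 2 + 2))) M z.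
Proof.
move=> M0 HM k z [zS _] Hz Dz; have [H0 H1 H2] := HM z.
have h1 : `|softmin S k z| <= (ln (size S)%:R + (size S)%:R * (8 * A ^+ 2 + 2)) +
    \sum_(b <- S) log_kernel A b z ^+ 2.
  apply: (le_trans (softmin_le k S0 zS)); rewrite -addrA lerD2l.
  have -> : (size S)%:R * (8 * A ^+ 2 + 2) = \sum_(b <- S) (8 * A ^+ 2 + 2).
    by rewrite big_const_seq count_predT iter_addr_0 mulr_natl.
  rewrite -big_split /= big_seq [leRHS]big_seq; apply: ler_sum => b bS.
  rewrite ln_kernel //; have := abs_le_sqr (log_kernel A b z).
  have : dist2 b z <= 8 * A ^+ 2.
    have [z1 z2] := Dz; have r := le_trans (Re_le_cabs b) (SA bS).
    have i := le_trans (Im_le_cabs b) (SA bS).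
    rewrite /dist2; move: z1 z2 r i; rewrite !ler_norml.
    move=> /andP[? ?] /andP[? ?] /andP[? ?] /andP[? ?].
    rewrite (_ : 8 * A ^+ 2 = 4 * A ^+ 2 + 4 * A ^+ 2); last by ring.
    by apply: lerD; apply: sqrB_le.
  lra.
have h2 : `|softmin_x S k z| <= \sum_(b <- S) isqrt_prod b z.
  apply: (@soft_mean_le R S k z (fun b => z.1 - complex.Re b)) => // b bS.
  rewrite /isqrt_prod SA //; have [b1 b2] := Hz b bS.
  by apply: div_sqr_isqrt_le; rewrite ?subr_eq0 // dist2_reg2.
have h3 : `|softmin_y S k z| <= \sum_(b <- S) isqrt_prod b z.
  apply: (@soft_mean_le R S k z (fun b => z.2 - complex.Im b)) => // b bS.
  rewrite /isqrt_prod SA // [isqrt _ * _]mulrC; have [b1 b2] := Hz b bS.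
  by apply: div_sqr_isqrt_le; rewrite ?subr_eq0 // addrC dist2_reg2.
rewrite /f /dom; apply: (le_trans (ler_normD _ _)); apply: lerD.
  by rewrite normrM -mulrDr mulrC; apply: ler_pM.
apply: (le_trans (ler_normD _ _)); rewrite (normrM (softmin_x S k z)) (normrM (softmin_y S k z)).
set s := \sum_(b <- S) isqrt_prod b z in h2 h3 *.
rewrite (_ : 2 * M * s = s * M + s * M); last by ring.
exact: lerD (ler_pM (normr_ge0 _) (normr_ge0 _) h2 H1) (ler_pM (normr_ge0 _) (normr_ge0 _) h3 H2).
Qed.

(** Dominated convergence in [softmin_ibp]: at a generic point the gradient of [softmin] tends to
    that of ln |z - a| for the nearest a, so only one cell contributes there. *)
Lemma gradient_identity :
  (\int[@leb2 R]_z (log_dist S z * laplacian phi z)%:E +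
   \sum_(a <- S) \int[@leb2 R]_z (radial_cell S a phi z)%:E = 0)%E.
Proof.
have [M M0 HM] := bound.
have FF := ae_filter_ringOfSetsType (@leb2 R).
pose c := M * (ln (size S)%:R + (size S)%:R * (8 * A ^+ 2 + 2)).
have c0 : 0 <= c.
  rewrite mulr_ge0 ?(ltW M0) // addr_ge0 ?ln_size_ge0 // mulr_ge0 // addr_ge0 // mulr_ge0 //.
  exact: sqr_ge0.
have slim : supported A flim.
  move=> z zA; rewrite /flim supported_laplacian // mulr0 add0r big1 // => a _.
  by rewrite /radial_cell (@s1 (1, 0)) // (@s1 (0, 1)) // !mulr0 addr0 mul0r mulr0.
have [|||||_ _] := @dominated_convergence _ _ _ (@leb2 R) D mD (fun k z => (f k z)%:E)
  (EFin \o flim) (EFin \o (dom c M)).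
- move=> k; apply/measurable_EFinP/measurable_funTS; apply: continuous_plane_measurable.
  exact: cf.
- exact/measurable_EFinP/measurable_funTS.
- apply: (@filterS _ _ FF _ _ _ ae_good) => z [[zS [a aS Ha]] _] _.
  apply: cvg_EFin; first exact: nearW.
  rewrite /= /flim (sum_radial_cell_generic phi uS aS Ha).
  have Ha' b : b \in S -> cabs (toC z - a) <= cabs (toC z - b).
    by move=> bS; have [->//|ba] := eqVneq b a; exact/ltW/Ha.
  have cx : softmin_x S k z @[k --> \oo] --> (z.1 - complex.Re a) / dist2 a z.
    exact: (@soft_mean_cvg _ _ _ _ (fun b => z.1 - complex.Re b) aS zS Ha).
  have cy : softmin_y S k z @[k --> \oo] --> (z.2 - complex.Im a) / dist2 a z.
    exact: (@soft_mean_cvg _ _ _ _ (fun b => z.2 - complex.Im b) aS zS Ha).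
  have cm := softmin_cvg aS zS Ha'.
  exact: (cvgD (cvgM cm (cvg_cst (laplacian phi z)))
    (cvgD (cvgM cx (cvg_cst ('D_(1, 0) phi z))) (cvgM cy (cvg_cst ('D_(0, 1) phi z))))).
- apply/integrableP; split; first exact/measurable_EFinP/measurable_funTS.
  under eq_integral do rewrite gee0_abs ?lee_fin ?dom_ge0 ?(ltW M0) //.
  by apply: int_dom => //; exact: ltW.
- apply: (@filterS _ _ FF _ _ _ ae_good) => z [gz Hz] k Dz.
  by rewrite lee_fin; exact: dom_f.
have E k : (\int[@leb2 R]_(z in D) (f k z)%:E = 0)%E.
  rewrite -integral_supported; last exact: sf.
  exact: (softmin_ibp k S0 (ltW A0) sphi d1 c1 d2 c2).
under eq_fun do rewrite E.
move=> /(cvg_unique _ (cvg_cst _)) /= H.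
have {}H : (\int[@leb2 R]_z (flim z)%:E = 0)%E by rewrite (integral_supported slim) -H.
have [ir Er] := integral_sum_seq integrable_radial_cell.
by rewrite -Er -integralD //; exact: integrable_log_dist continuous_laplacian supported_laplacian.
Qed.

End gradient_identity.

(** * Integration along the rays of a Voronoi cell *)

Section slope_coordinates.
Variable R : realType.
Local Notation mu := (@lebesgue_measure R).

(** Polar coordinates with the slope in place of the angle; the vertical line through a, which is
    missed, is negligible. *)
Definition slope_point (a : R[i]) (sg : R) (w : R * R) : R * R :=
  (complex.Re a + sg * w.1, complex.Im a + sg * (w.1 * w.2)).

Lemma measurable_slope_point a sg :
  measurable_fun setT (slope_point a sg : plane R -> plane R).
Proof.
apply: measurable_fun_pair; apply: continuous_plane_measurable.
  apply: plane_contD; first exact: plane_cont_cst.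
  by apply: plane_contM; [exact: plane_cont_cst|exact: plane_cont_fst].
apply: plane_contD; first exact: plane_cont_cst.
apply: plane_contM; first exact: plane_cont_cst.
by apply: plane_contM; [exact: plane_cont_fst|exact: plane_cont_snd].
Qed.

Definition slope_pull (a : R[i]) (sg : R) (f : plane R -> \bar R) (w : plane R) : \bar R :=
  (f (slope_point a sg w) * (w.1 * unit_step w.1)%:E)%E.

Lemma measurable_slope_pull a sg f : measurable_fun setT f ->
  measurable_fun setT (slope_pull a sg f).
Proof.
move=> mf; apply: emeasurable_funM.
  by apply: (measurableT_comp mf); exact: measurable_slope_point.
apply/measurable_EFinP; apply: measurable_funM.
  exact: measurable_fst.
by apply: (measurableT_comp (@measurable_unit_step R)); exact: measurable_fst.
Qed.

Lemma step_mul_ge0 (x : R) : 0 <= x * unit_step x.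
Proof. by rewrite /unit_step; case: ltP => h; rewrite ?mulr1 ?mulr0 // ltW. Qed.

Lemma slope_pull_ge0 a sg f : (forall z, 0 <= f z)%E -> forall w, (0 <= slope_pull a sg f w)%E.
Proof. by move=> f0 w; rewrite mule_ge0 // lee_fin step_mul_ge0. Qed.

(* The Jacobian of (x, s) |-> a + sg (x, x s) is x; the two signs cover the
   two half-planes. *)
Lemma ge0_integral_slope a (f : plane R -> \bar R) : measurable_fun setT f ->
  (forall z, 0 <= f z)%E ->
  (\int[@leb2 R]_z f z = \int[@leb2 R]_w slope_pull a 1 f w +
    \int[@leb2 R]_w slope_pull a (-1) f w)%E.
Proof.
move=> mf f0.
(* For fixed x > 0 the map s |-> Im a + sg x s is affine with factor of modulus x, which produces
   the Jacobian; the outer variable is then treated by [ge0_integral_half_lines]. *)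
have E sg : `|sg| = 1 -> (\int[@leb2 R]_w slope_pull a sg f w =
   \int[mu]_x (fubini_F mu f (complex.Re a + sg * x)%R * (unit_step x)%:E))%E.
  move=> sg1; rewrite /leb2 fubini_tonelli1; last 2 first.
  - exact: measurable_slope_pull.
  - exact: slope_pull_ge0.
  apply: eq_integral => x _; rewrite /fubini_F /slope_pull /=.
  have ms : measurable_fun setT (fun s => f (slope_point a sg (x, s))).
    apply: (measurableT_comp mf); apply: (measurableT_comp (measurable_slope_point a sg)).
    exact: measurable_pair1.
  rewrite ge0_integralZr //; last by rewrite lee_fin step_mul_ge0.
  rewrite /unit_step; case: (ltP 0 x) => x0; last by rewrite mulr0 !mule0.
  rewrite mulr1 mule1 [RHS](@ge0_integral_affine R (sg * x) (complex.Im a)); last 3 first.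
  - by rewrite -normr_gt0 normrM sg1 mul1r normr_gt0 gt_eqF.
  - by apply: (measurableT_comp mf); exact: measurable_pair1.
  - by [].
  rewrite normrM sg1 mul1r gtr0_norm // muleC; congr (_ * _)%E.
  by apply: eq_integral => s _; rewrite /slope_point /= mulrA [complex.Im a + _]addrC.
rewrite !E ?normrN ?normr1 // -ge0_integral_half_lines.
- by rewrite /leb2 fubini_tonelli1.
- exact: measurable_fun_fubini_tonelli_F.
- by move=> x; apply: integral_ge0.
Qed.

Lemma abse_slope_pull a sg f w : `|slope_pull a sg f w|%E = slope_pull a sg (abse \o f) w.
Proof. by rewrite /slope_pull abseM /= ger0_norm // step_mul_ge0. Qed.

Lemma funepos_slope_pull a sg f : ((slope_pull a sg f)^\+ = slope_pull a sg (f^\+))%E.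
Proof.
apply/funext => w; rewrite /slope_pull !funeposE.
by rewrite maxe_pMl ?lee_fin ?step_mul_ge0 // mul0e.
Qed.

Lemma funeneg_slope_pull a sg f : ((slope_pull a sg f)^\- = slope_pull a sg (f^\-))%E.
Proof.
apply/funext => w; rewrite /slope_pull !funenegE -mulNe.
by rewrite maxe_pMl ?lee_fin ?step_mul_ge0 // mul0e.
Qed.

Lemma integrable_slope_pull a sg f : sg = 1 \/ sg = -1 -> (@leb2 R).-integrable setT f ->
  (@leb2 R).-integrable setT (slope_pull a sg f).
Proof.
move=> hsg /integrableP[mf fi]; apply/integrableP; split; first exact: measurable_slope_pull.
apply: le_lt_trans fi; under eq_integral do rewrite abse_slope_pull.
have ma : measurable_fun setT (abse \o f) by exact: measurableT_comp.
rewrite [leRHS](ge0_integral_slope a ma); last by move=> z; exact: abse_ge0.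
by case: hsg => ->; rewrite ?leeDl ?leeDr // integral_ge0 // => w _;
  apply: slope_pull_ge0 => z; exact: abse_ge0.
Qed.

Lemma integral_slope a f : (@leb2 R).-integrable setT f ->
  (\int[@leb2 R]_z f z = \int[@leb2 R]_w slope_pull a 1 f w +
    \int[@leb2 R]_w slope_pull a (-1) f w)%E.
Proof.
move=> fi; have mf := measurable_int _ fi.
have [i1 i2] := (integrable_slope_pull a (or_introl erefl) fi,
  integrable_slope_pull a (or_intror erefl) fi).
have pn sg : sg = 1 \/ sg = -1 -> (\int[@leb2 R]_w slope_pull a sg (f^\+)%E w \is a fin_num)%E /\
    (\int[@leb2 R]_w slope_pull a sg (f^\-)%E w \is a fin_num)%E.
  move=> hsg; rewrite -funepos_slope_pull -funeneg_slope_pull.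
  have := integrable_slope_pull a hsg fi => i.
  by split; [exact: integrable_pos_fin_num|exact: integrable_neg_fin_num].
rewrite integralE (ge0_integral_slope a (measurable_funepos mf)) //.
rewrite (ge0_integral_slope a (measurable_funeneg mf)) //.
rewrite [X in (_ = X + _)%E]integralE [X in (_ = _ + X)%E]integralE.
rewrite !funepos_slope_pull !funeneg_slope_pull.
have [/fineK p1 /fineK n1] := pn 1 (or_introl erefl).
have [/fineK p2 /fineK n2] := pn (-1) (or_intror erefl).
rewrite -p1 -n1 -p2 -n2 -!EFinB -!EFinD; congr (_%:E); ring.
Qed.

End slope_coordinates.

Section exit_point.
Variables (R : realType) (S : seq R[i]).
Local Notation mu := (@lebesgue_measure R).
Implicit Types (a b : R[i]) (v : R * R).

(* inv_exit a v is the inverse of the distance, in units of v, at which the ray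
   from a in the direction v leaves the cell of a; it vanishes when the ray
   stays in the cell. The term of b = a is 0 / 0 = 0. *)
Definition inv_exit a v : R := \big[Num.max/0]_(b <- S)
  (2 * (v.1 * (complex.Re b - complex.Re a) + v.2 * (complex.Im b - complex.Im a))
   / dist2 a (ofC b)).

Definition exit_point a v : R * R := ofC a + (inv_exit a v)^-1 *: v.

(** A ray that never leaves its cell exits at infinity, where a compactly supported phi vanishes. *)
Definition exit_val a (phi : R * R -> R) v : R :=
  if 0 < inv_exit a v then phi (exit_point a v) else 0.

Lemma inv_exit_ge0 a v : 0 <= inv_exit a v.
Proof.
by rewrite /inv_exit; elim: (S) => [|b s IH]; rewrite ?big_nil // big_cons le_max IH orbT.
Qed.

Lemma ray_dist2 a b (x : R) v : dist2 b (ofC a + x *: v) =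
  dist2 a (ofC a + x *: v) + dist2 a (ofC b)
  - 2 * x * (v.1 * (complex.Re b - complex.Re a) + v.2 * (complex.Im b - complex.Im a)).
Proof. by rewrite /dist2 /= /GRing.scale /=; ring. Qed.

(** Along the ray the condition against b reads 2 x (v . (b - a)) <= |b - a|^2, linear in x. When b
    coincides with a both sides vanish, in agreement with the quotient 0 / 0 = 0 in [inv_exit]. *)
Lemma cell_ray a (x : R) v : 0 < x ->
  cell S a (ofC a + x *: v) <-> x * inv_exit a v <= 1.
Proof.
move=> x0; rewrite /cell /= (_ : all _ S = (x * inv_exit a v <= 1)) // /inv_exit.
elim: (S) => [|b s IH]; first by rewrite big_nil mulr0 ler01.
rewrite /= big_cons maxr_pMr ?(ltW x0) // ge_max -IH; congr (_ && _).
rewrite (ray_dist2 a b) -addrA lerDl subr_ge0 mulrA.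
set w := _ + _; have := dist2_ge0 a (ofC b); rewrite le_eqVlt => /predU1P[d0|d0].
  suff -> : w = 0 by rewrite -d0 !mulr0 mul0r ler01 lexx.
  have := d0; rewrite /dist2 => /esym/eqP; rewrite paddr_eq0 ?sqr_ge0 //.
  by rewrite !sqrf_eq0 /w /= => /andP[/eqP -> /eqP ->]; rewrite !mulr0 addr0.
by rewrite ler_pdivrMr // mul1r mulrCA mulrA.
Qed.

Lemma measurable_inv_exit a (sg : R) : measurable_fun setT (fun s : R => inv_exit a (sg, sg * s)).
Proof.
rewrite /inv_exit; elim: (S) => [|b s IH].
  by under eq_fun do rewrite big_nil; exact: measurable_cst.
under eq_fun do rewrite big_cons.
apply: measurable_maxr => //; apply: measurable_funM => //; apply: measurable_funM => //.
apply: measurable_funD => //=; apply: measurable_funM => //; exact: measurable_funM.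
Qed.

Lemma measurable_exit_point a (sg : R) :
  measurable_fun setT (fun s : R => exit_point a (sg, sg * s) : plane R).
Proof.
have mk := measurableT_comp (@measurable_invr R) (measurable_inv_exit a sg).
apply: measurable_fun_pair => /=.
  apply: measurable_funD => //; apply: measurable_funM => //; exact: mk.
apply: measurable_funD => //; apply: measurable_funM; first exact: mk.
exact: measurable_funM.
Qed.

Variables (A : R) (phi : R * R -> R).
Hypotheses (A1 : 1 <= A) (SA : forall b, b \in S -> cabs b <= A).
Hypotheses (sphi : supported A phi) (d1 : forall y u, derivable phi y u)
  (c1 : forall u, continuous (fun y => 'D_u phi y)).

(** With z - a = x v and |z - a|^2 = x^2 (1 + s^2), the singular factor 1 / x cancels against the
    Jacobian; what remains is a derivative along the ray. *)
Lemma radial_cell_ray a (sg x s : R) : sg ^+ 2 = 1 -> 0 < x ->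
  radial_cell S a phi (slope_point a sg (x, s)) * x =
  (if x * inv_exit a (sg, sg * s) <= 1
   then (1 + s ^+ 2)^-1 * 'D_(sg, sg * s) phi (ofC a + x *: (sg, sg * s)) else 0).
Proof.
move=> sg2 x0; have E : slope_point a sg (x, s) = ofC a + x *: ((sg, sg * s) : R * R).
  by rewrite /slope_point /= scale_pairE; congr pair => /=; ring.
rewrite /radial_cell E indicE; case: ifPn => h; last first.
  by rewrite memNset ?mul0r // => /(cell_ray _ _ x0) h'; rewrite h' in h.
rewrite mem_set; last exact/cell_ray.
rewrite mul1r (@gradE _ _ _ (sg, sg * s) d1 c1).
move: ('D_(1, 0) phi _) ('D_(0, 1) phi _) => dx dy.
rewrite (_ : dist2 a _ = x ^+ 2 * (1 + s ^+ 2)); last first.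
  transitivity (sg ^+ 2 * (x ^+ 2 * (1 + s ^+ 2))); last by rewrite sg2 mul1r.
  by rewrite /dist2 /= /GRing.scale /=; ring.
rewrite /= /GRing.scale /=; field.
by rewrite (gt_eqF x0) gt_eqF // ltr_wpDr // sqr_ge0.
Qed.

Lemma exit_ray_integral a (sg s : R) : a \in S -> sg ^+ 2 = 1 ->
  (\int[mu]_x slope_pull a sg (EFin \o (radial_cell S a phi : plane R -> R)) (x, s) =
   ((1 + s ^+ 2)^-1 * (exit_val a phi (sg, sg * s) - phi (ofC a)))%:E)%E.
Proof.
move=> aS sg2; set v := (sg, sg * s); set k := inv_exit a v; set c := (1 + s ^+ 2)^-1.
pose F (x : R) := c * phi (ofC a + x *: v).
pose f (x : R) : R := c * 'D_v phi (ofC a + x *: v).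
have dF (x : R) : is_derive x (1 : R) F (f x).
  have := is_deriveZ c (ray_derive (@d1 (ofC a + x *: v) v)).
  by move=> H; apply: (is_derive_eq H).
have out (x : R) : 2 * A < x -> ~ square A (ofC a + x *: v).
  move=> xA [/= + _]; rewrite /GRing.scale /=.
  have := le_trans (Re_le_cabs a) (SA aS); rewrite !ler_norml => /andP[r1 r2] /andP[h1 h2].
  have : (sg - 1) * (sg + 1) = 0 by rewrite -subr_sqr sg2 expr1n subrr.
  by move/eqP; rewrite mulf_eq0 subr_eq0 addr_eq0 => /orP[/eqP sg1|/eqP sg1];
    rewrite sg1 in h1 h2; lra.
have cf : continuous f.
  move=> x; apply: cvgM; first exact: cvg_cst.
  apply: (@continuous_comp _ _ _ (fun x : R => ofC a + x *: v) (fun y => 'D_v phi y)); last exact: c1.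
  by apply: cvgD; [exact: cvg_cst|apply: cvgZr_tmp; exact: cvg_id].
(* The exit time of the ray. If the ray stays in the cell, any point beyond the support of phi
   serves, and |Re a| <= A puts the support before 2 A. *)
pose B := if 0 < k then k^-1 else 2 * A + 1.
have k0 : 0 <= k := inv_exit_ge0 a v.
have B0 : 0 < B.
  by rewrite /B; case: ifP => [kp|_]; rewrite ?invr_gt0 // addr_gt0 // mulr_gt0 // (lt_le_trans _ A1).
transitivity (\int[mu]_(x in `]0%R, B]) (f x)%:E)%E.
  rewrite [RHS]integral_mkcond; apply: eq_integral => x _.
  rewrite /slope_pull /patch mem_setE in_itv /= -EFinM /unit_step.
  have [x0|x0] := ltP 0 x; last by rewrite !mulr0.
  rewrite mulr1 radial_cell_ray // -/v -/k /=.
  have [kp|kn] := ltP 0 k.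
    rewrite /B kp -(ler_pdivlMr _ _ kp) mul1r; case: ifP => //.
  have k00 : k = 0 by apply/eqP; rewrite eq_le kn.
  rewrite /B k00 mulr0 ler01 ltxx.
  case: ifPn => //; rewrite -ltNge => xB.
  rewrite -/v -/(f x) /f (supported_derive v sphi) ?mulr0 //; apply: out.
  by apply: lt_trans xB; rewrite ltrDl.
rewrite integral_itv_obnd_cbnd; last first.
  by apply/measurable_EFinP/measurable_funTS; exact: continuous_measurable_fun.
have cF (x : R) : {for x, continuous F}.
  by apply: differentiable_continuous; apply/derivable1_diffP; have [] := dF x.
rewrite (@continuous_FTC2 R f F) //.
- rewrite /F scale0r addr0 -EFinB mulrBr; congr (_ * _ - _)%:E.
  rewrite /exit_val /exit_point -/k /B; case: ifP => // _.
  by apply: sphi; apply: out; rewrite ltrDl.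
- by apply: continuous_in_subspaceT => x _; exact: cf.
- split.
  + by move=> x _; have [] := dF x.
  + exact/cvg_at_right_filter/cF.
  + exact/cvg_at_left_filter/cF.
- by move=> x _; rewrite derive1E; have [_ ->] := dF x.
Qed.

End exit_point.

Section restricted_measure.
Context d (T : measurableType d) (R : realType) (m : {measure set T -> \bar R}).
Variables (D : set T) (mD : measurable D).

Lemma ge0_integral_mrestr (f : T -> \bar R) : measurable_fun setT f ->
  (forall x, 0 <= f x)%E -> (\int[mrestr m mD]_x f x = \int[m]_(x in D) f x)%E.
Proof.
move=> mf f0; have mC : measurable (~` D) by exact: measurableC.
have mfD : measurable_fun setT (f \_ D) by apply/(measurable_restrictT _ mD)/measurable_funTS.
have fD0 x : (0 <= (f \_ D) x)%E by apply: erestrict_ge0.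
(* m splits into its restrictions to D and to the complement; the second one does not see a function
   vanishing off D. *)
rewrite integral_mkcond (@eq_measure_integral _ _ _ _ (measure_add (mrestr m mD) (mrestr m mC))).
  rewrite ge0_integral_measure_add // [X in (_ = _ + X)%E](_ : _ = 0%E) ?adde0.
    apply: ae_eq_integral => //; exists (~` D); split => //=.
      by rewrite /mrestr setICl measure0.
    move=> x /= H Dx; apply: H => _; rewrite /patch mem_set //.
  transitivity (\int[mrestr m mC]_x (cst 0%E x))%E; last by rewrite integral0.
  apply: ae_eq_integral => //; exists D; split => //=; first by rewrite /mrestr setICr measure0.
  move=> x /= H; apply: contrapT => Dx; apply: H => _; rewrite /patch memNset //.
move=> A mA _; transitivity (mrestr m mD A + mrestr m mC A)%E; last first.
  by rewrite /= /measure_add /msum 2!big_ord_recr big_ord0 /= add0e.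
rewrite /mrestr -measureU ?setIUr ?setUv ?setIT //.
- by rewrite -setIUr setUv setIT.
- exact: measurableI.
- exact: measurableI.
- by rewrite setIACA setICr setI0.
Qed.

End restricted_measure.

Section exit_integral.
Variable R : realType.
Local Notation mu := (@lebesgue_measure R).

Lemma measurable_oneDsqrV : measurable_fun setT (fun s : R => (1 + s ^+ 2)^-1).
Proof. by apply: continuous_measurable_fun; exact: continuous_oneDsqrV. Qed.

Lemma oneDsqrV_ge0 (s : R) : 0 <= (1 + s ^+ 2)^-1.
Proof. by rewrite invr_ge0 addr_ge0 // sqr_ge0. Qed.

Lemma integral_oneDsqrV : (\int[mu]_s ((1 + s ^+ 2)^-1)%:E = pi%:E :> \bar R)%E.
Proof.
rewrite (@ge0_symfun_integralT R (fun s => (1 + s ^+ 2)^-1)).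
- rewrite -set_itvcy integral0y_oneDsqr -EFinM; congr (_%:E); by field.
- exact: oneDsqrV_ge0.
- exact: continuous_oneDsqrV.
- by move=> s; rewrite /= sqrrN.
Qed.

Lemma integrable_oneDsqrV : mu.-integrable setT (fun s : R => ((1 + s ^+ 2)^-1)%:E).
Proof.
apply/integrableP; split; first by apply/measurable_EFinP; exact: measurable_oneDsqrV.
under eq_integral do rewrite gee0_abs ?lee_fin ?oneDsqrV_ge0 //.
by rewrite integral_oneDsqrV ltry.
Qed.

Lemma integrable_weighted (h : R -> R) (M : R) : measurable_fun setT h ->
  (forall s, `|h s| <= M) -> mu.-integrable setT (fun s : R => ((1 + s ^+ 2)^-1 * h s)%:E).
Proof.
move=> mh hM; apply: (@le_integrable _ _ _ mu setT measurableT _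
    (fun s : R => (M%:E * ((1 + s ^+ 2)^-1)%:E)%E)).
- by apply/measurable_EFinP; apply: measurable_funM => //; exact: measurable_oneDsqrV.
- move=> s _; rewrite -EFinM /= lee_fin !normrM mulrC ler_wpM2r //.
  by apply: le_trans (hM s) (ler_norm _).
- by apply: integrableZl => //; exact: integrable_oneDsqrV.
Qed.

Variable S : seq R[i].

Lemma measurable_exit_val a (phi : plane R -> R) (sg : R) : measurable_fun setT phi ->
  measurable_fun setT (fun s : R => exit_val S a phi (sg, sg * s)).
Proof.
move=> mphi; apply: measurable_fun_ifT => //.
  by apply: measurable_fun_ltr => //; exact: measurable_inv_exit.
by apply: (measurableT_comp mphi); exact: measurable_exit_point.
Qed.

Lemma exit_val_le a (phi : plane R -> R) M v : (forall z, `|phi z| <= M) ->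
  `|exit_val S a phi v| <= M.
Proof.
by move=> H; rewrite /exit_val; case: ifP => // _; rewrite normr0 (le_trans _ (H (0, 0))).
Qed.

(** An integral over the directions of one half-plane, of total angle pi. By [exit_meanE] it is
    finite for bounded measurable phi. *)
Definition exit_mean a (sg : R) (phi : plane R -> R) : R :=
  fine (\int[mu]_s ((1 + s ^+ 2)^-1 * exit_val S a phi (sg, sg * s))%:E)%E.

Lemma exit_meanE a sg (phi : plane R -> R) M : measurable_fun setT phi ->
  (forall z, `|phi z| <= M) -> (exit_mean a sg phi)%:E =
  (\int[mu]_s ((1 + s ^+ 2)^-1 * exit_val S a phi (sg, sg * s))%:E)%E.
Proof.
move=> mphi HM; rewrite /exit_mean fineK //; apply: integrable_fin_num => //.
apply: (@integrable_weighted _ M); first exact: measurable_exit_val.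
by move=> s; exact: exit_val_le.
Qed.

Variables (A : R) (phi : R * R -> R).
Hypotheses (uS : uniq S) (S0 : S != [::]) (A1 : 1 <= A) (SA : forall b, b \in S -> cabs b <= A).
Hypotheses (sphi : supported A phi) (d1 : forall y u, derivable phi y u)
  (c1 : forall u, continuous (fun y => 'D_u phi y))
  (d2 : forall w y u, derivable (fun z => 'D_w phi z) y u)
  (c2 : forall w u, continuous (fun y => 'D_u (fun z => 'D_w phi z) y))
  (c0 : continuous phi).

(** Each half-plane contributes the values at the exit points minus pi phi(a), pi being the integral
    of 1 / (1 + s^2); together they give the point mass 2 pi. *)
Lemma integral_radial_cell a : a \in S ->
  (\int[@leb2 R]_z (radial_cell S a phi z)%:E =
   (exit_mean a 1 phi + exit_mean a (-1) phi - 2 * pi * phi (ofC a))%:E)%E.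
Proof.
move=> aS; have ir := integrable_radial_cell S0 A1 SA sphi c1 c2 aS.
have [M M0 HM] := supported_bounded c0 sphi.
have mphi := continuous_plane_measurable c0.
have E sg : sg = 1 \/ sg = -1 -> (\int[@leb2 R]_w slope_pull a sg
   (EFin \o (radial_cell S a phi : plane R -> R)) w = (exit_mean a sg phi - pi * phi (ofC a))%:E)%E.
  move=> hsg; have sg2 : sg ^+ 2 = 1 by case: hsg => ->; rewrite ?sqrrN expr1n.
  have i := integrable_slope_pull a hsg ir.
  rewrite /leb2 -(integral21_prod_meas1 i).
  transitivity (\int[mu]_s (((1 + s ^+ 2)^-1 * exit_val S a phi (sg, sg * s))%:E -
      ((1 + s ^+ 2)^-1 * phi (ofC a))%:E))%E.
    apply: eq_integral => s _; rewrite -EFinB -mulrBr.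
    exact: (exit_ray_integral A1 SA sphi d1 c1 s aS sg2).
  rewrite integralB //.
  - rewrite -(exit_meanE a sg mphi HM) EFinB; congr (_ - _)%E.
    under eq_integral do rewrite EFinM.
    by rewrite integralZr //= ?integral_oneDsqrV ?EFinM //; exact: integrable_oneDsqrV.
  - apply: (@integrable_weighted _ M); first exact: measurable_exit_val.
    by move=> s; exact: exit_val_le.
  - by apply: (@integrable_weighted _ M).
rewrite (integral_slope a ir) (E _ (or_introl erefl)) (E _ (or_intror erefl)) -EFinD.
by congr (_%:E); ring.
Qed.

Lemma integral_log_dist_laplacian :
  (\int[@leb2 R]_z (log_dist S z * laplacian phi z)%:E =
   (\sum_(a <- S) (2 * pi * phi (ofC a) - exit_mean a 1 phi - exit_mean a (-1) phi))%:E)%E.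
Proof.
have := gradient_identity uS S0 A1 SA sphi d1 c1 d2 c2.
have -> : (\sum_(a <- S) \int[@leb2 R]_z (radial_cell S a phi z)%:E =
   (\sum_(a <- S) (exit_mean a 1 phi + exit_mean a (-1) phi - 2 * pi * phi (ofC a)))%:E)%E.
  by rewrite -sumEFin big_seq [RHS]big_seq; apply: eq_bigr => a aS; exact: integral_radial_cell.
have : (\int[@leb2 R]_z (log_dist S z * laplacian phi z)%:E \is a fin_num)%E.
  apply: integrable_fin_num => //; exact: (integrable_log_dist S0 A1 SA
    (@continuous_laplacian _ _ c2) (@supported_laplacian _ _ _ sphi)).
move=> /fineK <-; rewrite -EFinD => -[] /eqP; rewrite addr_eq0 => /eqP ->.
by congr (_%:E); rewrite -sumrN; apply: eq_bigr => a _; ring.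
Qed.

End exit_integral.

(** * The limit measure *)

Section exit_measure.
Variables (R : realType) (S : seq R[i]).
Local Notation mu := (@lebesgue_measure R).
Local Notation C := R[i].

Definition exit_region (p : C * R) : set (plane R) :=
  [set w | [&& 0 < inv_exit S p.1 (p.2, p.2 * w.1), 0 <= w.2 & w.2 <= (1 + w.1 ^+ 2)^-1]].

Lemma measurable_exit_region p : measurable (exit_region p).
Proof.
pose b (w : plane R) := [&& 0 < inv_exit S p.1 (p.2, p.2 * w.1), 0 <= w.2 & w.2 <= (1 + w.1 ^+ 2)^-1].
have mb : measurable_fun setT b.
  apply: measurable_and.
    apply: measurable_fun_ltr => //.
    exact: (measurableT_comp (measurable_inv_exit S p.1 p.2) measurable_fst).
  apply: measurable_and; apply: measurable_fun_ler => //.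
  exact: (measurableT_comp (@measurable_oneDsqrV R) measurable_fst).
have := mb measurableT [set true] I; rewrite setTI => H.
by rewrite (_ : exit_region p = b @^-1` [set true]).
Qed.

Lemma measurable_exit_point_fst p :
  measurable_fun setT (fun w : plane R => exit_point S p.1 (p.2, p.2 * w.1) : plane R).
Proof. exact: (measurableT_comp (measurable_exit_point S p.1 p.2) measurable_fst). Qed.

(* The image of the measure ds / (1 + s^2) under s |-> exit_point a (sg, sg s),
   restricted to the slopes whose ray leaves the cell; the weight is encoded as
   the area of a subgraph. *)
Definition exit_piece (p : C * R) : {measure set (plane R) -> \bar R} :=
  image_measure (mrestr (@leb2 R) (measurable_exit_region p)) (measurable_exit_point_fst p).

Lemma integral_exit_piece p (f : plane R -> R) (M : R) : measurable_fun setT f ->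
  (forall z, 0 <= f z) -> (forall z, f z <= M) ->
  (\int[exit_piece p]_z (f z)%:E = (exit_mean S p.1 p.2 f)%:E)%E.
Proof.
move=> mf f0 fM; have mfE : measurable_fun setT (EFin \o f) by exact/measurable_EFinP.
have fM' z : `|f z| <= M by rewrite ger0_norm.
have mG := measurable_exit_region p.
have mfp : measurable_fun setT (fun w : plane R => (f (exit_point S p.1 (p.2, p.2 * w.1)))%:E).
  by apply: (measurableT_comp mfE); exact: measurable_exit_point_fst.
rewrite /exit_piece ge0_integral_image_measure //.
rewrite ge0_integral_mrestr //; last by move=> z; rewrite lee_fin.
rewrite integral_mkcond /leb2 fubini_tonelli1; last 2 first.
- by apply/(measurable_restrictT _ mG)/measurable_funTS.
- by apply: erestrict_ge0 => z _; rewrite lee_fin.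
rewrite (exit_meanE _ _ _ mf fM'); apply: eq_integral => s _; rewrite /fubini_F.
rewrite /exit_val; have [k0|k0] := ltP 0 (inv_exit S p.1 (p.2, p.2 * s)); last first.
  rewrite mulr0; apply: integral0_eq => u _; rewrite /patch memNset //= /exit_region /=.
  by rewrite ltNge k0.
set c := (1 + s ^+ 2)^-1; have c0 : 0 <= c := oneDsqrV_ge0 s.
(* The integrand does not depend on u, so the second coordinate only contributes the height c of the
   subgraph, which is the weight. *)
transitivity (\int[mu]_(u in `[0%R, c]) (f (exit_point S p.1 (p.2, p.2 * s)))%:E)%E.
  rewrite [RHS]integral_mkcond; apply: eq_integral => u _; rewrite /patch.
  rewrite (_ : ((s, u) \in exit_region p) = (u \in `[0, c]%classic)) //.
  by apply/idP/idP; rewrite !inE /exit_region /= in_itv /= k0.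
rewrite integral_cst //= lebesgue_measure_itv /= lte_fin EFinM muleC.
by case: ltP => [_|h]; [rewrite oppr0 adde0|rewrite (_ : c = 0) //; apply/eqP; rewrite eq_le h].
Qed.

Definition exit_pieces : seq (C * R) := [seq (a, sg) | a <- S, sg <- [:: 1; -1]].

Lemma sum_exit_pieces (F : C * R -> R) :
  \sum_(p <- exit_pieces) F p = \sum_(a <- S) (F (a, 1) + F (a, -1)).
Proof.
rewrite /exit_pieces big_allpairs; apply: eq_bigr => a _.
by rewrite big_cons big_seq1.
Qed.

Variables (c : R) (c0 : 0 <= c).

Definition exit_measure : {measure set (plane R) -> \bar R} :=
  mscale (NngNum c0) (msum (fun i => exit_piece (nth (0, 1) exit_pieces i)) (size exit_pieces)).

Definition exit_sum (f : plane R -> R) : R :=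
  c * \sum_(a <- S) (exit_mean S a 1 f + exit_mean S a (-1) f).

Lemma ge0_integral_exit_measure (f : plane R -> R) (M : R) : measurable_fun setT f ->
  (forall z, 0 <= f z) -> (forall z, f z <= M) ->
  (\int[exit_measure]_z (f z)%:E = (exit_sum f)%:E)%E.
Proof.
move=> mf f0 fM; have mfE : measurable_fun setT (EFin \o f) by exact/measurable_EFinP.
rewrite ge0_integral_mscale //; last by move=> z _; rewrite lee_fin.
rewrite ge0_integral_measure_sum //; last by move=> z _; rewrite lee_fin.
under eq_bigr do rewrite (integral_exit_piece _ mf f0 fM).
rewrite sumEFin -EFinM /exit_sum; congr (_ * _)%:E.
have /= <- := sum_exit_pieces (fun p => exit_mean S p.1 p.2 f).
by rewrite (big_nth (0, 1)) big_mkord.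
Qed.

Lemma exit_mean_lin a sg (f : plane R -> R) (M : R) : measurable_fun setT f ->
  (forall z, `|f z| <= M) ->
  exit_mean S a sg (fun z => f z + M) = exit_mean S a sg f + exit_mean S a sg (fun=> M).
Proof.
move=> mf fM; have M0 : 0 <= M by exact: le_trans (fM (0, 0)).
have mf' : measurable_fun setT (fun z : plane R => f z + M) by exact: measurable_funD.
have fM' z : `|f z + M| <= M + M by rewrite (le_trans (ler_normD _ _)) // lerD // ger0_norm.
have MM (z : plane R) : `|M| <= M by rewrite ger0_norm.
apply/EFin_inj; rewrite EFinD (exit_meanE S a sg mf fM) (exit_meanE S a sg mf' fM').
rewrite (@exit_meanE R S a sg (fun=> M) M) // -integralD //.
- apply: eq_integral => s _; rewrite -EFinD -mulrDr /exit_val; case: ifP => //.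
  by rewrite addr0.
- apply: (@integrable_weighted _ _ M); first exact: measurable_exit_val.
  by move=> s; exact: exit_val_le.
- apply: (@integrable_weighted _ _ M); first exact: measurable_exit_val.
  by move=> s; exact: exit_val_le.
Qed.

(** Reduced to nonnegative functions by adding the constant M; the measure is finite, so it can be
    subtracted again. *)
Lemma integral_exit_measure (f : plane R -> R) (M : R) : measurable_fun setT f ->
  (forall z, `|f z| <= M) -> (\int[exit_measure]_z (f z)%:E = (exit_sum f)%:E)%E.
Proof.
move=> mf fM; have M0 : 0 <= M by exact: le_trans (fM (0, 0)).
have mf' : measurable_fun setT (fun z : plane R => f z + M) by exact: measurable_funD.
have fM0 z : 0 <= f z + M by have := fM z; rewrite ler_norml => /andP[h _]; lra.
have fM' z : f z + M <= M + M by have := fM z; rewrite ler_norml => /andP[_ h]; lra.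
have E1 := ge0_integral_exit_measure mf' fM0 fM'.
have E2 := @ge0_integral_exit_measure (fun=> M) M (@measurable_cst _ _ _ _ _ _) (fun=> M0) (fun=> lexx M).
have i1 : exit_measure.-integrable setT (fun z => (f z + M)%:E).
  apply/integrableP; split; first exact/measurable_EFinP.
  by under eq_integral do rewrite gee0_abs ?lee_fin //; rewrite E1 ltry.
have i2 : exit_measure.-integrable setT (fun z : plane R => M%:E).
  apply/integrableP; split; first by [].
  by under eq_integral do rewrite gee0_abs ?lee_fin //; rewrite E2 ltry.
rewrite (_ : (fun z => (f z)%:E) = (fun z => (f z + M)%:E - M%:E)%E); last first.
  by apply/funext => z; rewrite -EFinB addrK.
rewrite integralB // E1 E2 -EFinB /exit_sum -mulrBr -sumrB; congr (_ * _)%:E.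
by apply: eq_bigr => a _; rewrite !exit_mean_lin //; ring.
Qed.

Lemma exit_measure_setT : exit_measure setT = (exit_sum (fun=> 1))%:E.
Proof.
rewrite -(@ge0_integral_exit_measure (fun=> 1) 1) //.
by rewrite integral_cst // mul1e.
Qed.

(** Each pair excludes at most one slope, that of the direction orthogonal to b - a; otherwise two
    points could be equally high. *)
Lemma generic_slope : {ae mu, forall s : R, forall a, a \in S -> forall b, b \in S -> a != b ->
  complex.Re b - complex.Re a + s * (complex.Im b - complex.Im a) != 0}.
Proof.
apply: ae_all_seq => a _; apply: ae_all_seq => b _.
exists [set - (complex.Re b - complex.Re a) / (complex.Im b - complex.Im a)].
split; [exact: measurable_set1|exact: lebesgue_measure_set1|].
move=> s /= H; apply/eqP; apply: contraT => sN; exfalso; apply: H => ab.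
apply: contra sN => /eqP h; have y0 : complex.Im b - complex.Im a != 0.
  apply: contra ab => /eqP y0; move: h; rewrite y0 mulr0 addr0 => x0.
  by rewrite eq_complex eq_sym -subr_eq0 x0 eqxx eq_sym -subr_eq0 y0 eqxx.
apply/eqP; apply: (mulIf y0); rewrite divfK //.
by move/eqP: h; rewrite addrC addr_eq0 => /eqP.
Qed.

Definition slope_height (sg s : R) (a : C) : R := sg * (complex.Re a + s * complex.Im a).

(** A ray is trapped in its cell exactly when no bisector lies ahead of it, that is, when no point
    of S is further than a in the direction of the ray. *)
Lemma inv_exit_eq0 a (sg s : R) : (inv_exit S a (sg, sg * s) == 0) =
  all (fun b => slope_height sg s b <= slope_height sg s a) S.
Proof.
rewrite /inv_exit; have M0 (l : seq C) : 0 <= \big[Num.max/0]_(b <- l)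
    (2 * (sg * (complex.Re b - complex.Re a) + sg * s * (complex.Im b - complex.Im a))
     / dist2 a (ofC b)).
  by elim: l => [|b l IH]; rewrite ?big_nil // big_cons le_max IH orbT.
elim: (S) => [|b l IH]; first by rewrite big_nil eqxx.
have max0 (x y : R) : 0 <= y -> (Num.max x y == 0) = (x <= 0) && (y == 0).
  by move=> y0; rewrite eq_le ge_max le_max y0 orbT andbT [y == 0]eq_le y0 andbT.
rewrite big_cons max0 // [all _ _]/= -IH [(_, _).1]/= [(_, _).2]/=; congr (_ && _).
rewrite (_ : _ * _ + _ * _ = slope_height sg s b - slope_height sg s a); last first.
  by rewrite /slope_height; ring.
have := dist2_ge0 a (ofC b); rewrite le_eqVlt => /predU1P[d0|d0]; last first.
  by rewrite pmulr_lle0 ?invr_gt0 // pmulr_rle0 // subr_le0.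
have [x0 y0] : complex.Re b = complex.Re a /\ complex.Im b = complex.Im a.
  move: d0; rewrite /dist2 => /esym/eqP; rewrite paddr_eq0 ?sqr_ge0 //.
  by rewrite !sqrf_eq0 !subr_eq0 /= => /andP[/eqP ? /eqP ?].
by rewrite -d0 invr0 mulr0 lexx /slope_height x0 y0 lexx.
Qed.

Lemma exists_highest (g : C -> R) (l : seq C) : l != [::] ->
  exists2 a, a \in l & forall b, b \in l -> g b <= g a.
Proof.
elim: l => // b l IH _; have [->|l0] := eqVneq l [::].
  by exists b; rewrite ?mem_head // => x; rewrite inE => /eqP ->.
have [a al Ha] := IH l0; have [h|h] := leP (g b) (g a).
  by exists a; rewrite ?inE ?al ?orbT // => x; rewrite inE => /predU1P[->|/Ha].
exists b; rewrite ?mem_head // => x; rewrite inE => /predU1P[-> //|/Ha xa].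
exact: le_trans xa (ltW h).
Qed.

(* In a generic direction only the cell of the highest point is unbounded. *)
Lemma sum_exit_val1 (sg s : R) : uniq S -> S != [::] -> sg = 1 \/ sg = -1 ->
  (forall a, a \in S -> forall b, b \in S -> a != b ->
     complex.Re b - complex.Re a + s * (complex.Im b - complex.Im a) != 0) ->
  \sum_(a <- S) exit_val S a (fun=> 1) (sg, sg * s) = (size S - 1)%:R.
Proof.
move=> uS S0 hsg gen; have [a aS Ha] := exists_highest (slope_height sg s) S0.
have E b : b \in S -> exit_val S b (fun=> 1) (sg, sg * s) = 1 - (b == a)%:R.
  move=> bS; rewrite /exit_val lt_neqAle inv_exit_ge0 andbT eq_sym inv_exit_eq0.
  have [->|ba] := eqVneq b a; first by rewrite subrr (_ : all _ _) //; exact/allP.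
  rewrite (_ : all _ _ = false) ?subr0 //; apply/negP => /allP /(_ a aS) h.
  have : slope_height sg s a - slope_height sg s b = 0.
    by apply/eqP; rewrite subr_eq0 eq_le h Ha.
  rewrite /slope_height -mulrBr => /eqP; rewrite mulf_eq0 => /orP[/eqP sg0|].
    by case: hsg => sg1; move: sg0; rewrite sg1 => /eqP; rewrite ?oppr_eq0 oner_eq0.
  have := gen b bS a aS ba; move=> /negP + /eqP h0; apply; apply/eqP; rewrite -h0; ring.
rewrite big_seq; under eq_bigr => b bS do rewrite E //.
rewrite -big_seq sumrB big_const_seq count_predT iter_addr_0.
rewrite (bigD1_seq a) //= eqxx [X in _ - (_ + X)]big1 ?addr0 => [|b /negbTE -> //].
by rewrite natrB // lt0n size_eq0.
Qed.

Lemma sum_exit_mean1 (sg : R) : uniq S -> S != [::] -> sg = 1 \/ sg = -1 ->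
  \sum_(a <- S) exit_mean S a sg (fun=> 1) = (size S - 1)%:R * pi.
Proof.
move=> uS S0 hsg; apply/EFin_inj; rewrite -sumEFin.
have n1 (z : plane R) : `|1| <= 1 :> R by rewrite normr1.
under eq_bigr do rewrite (@exit_meanE R S _ sg (fun=> 1) 1) //.
have i1 a : a \in S -> mu.-integrable setT (EFin \o (fun s : R =>
    (1 + s ^+ 2)^-1 * exit_val S a (fun=> 1) (sg, sg * s))).
  move=> _; apply: (@integrable_weighted _ _ 1); first exact: measurable_exit_val.
  by move=> s; exact: exit_val_le.
have [i <-] := integral_sum_seq i1.
rewrite EFinM -integral_oneDsqrV -integralZl //; last exact: integrable_oneDsqrV.
apply: ae_eq_integral => //.
- exact: measurable_int i.
- by apply: measurable_funeM; apply/measurable_EFinP; exact: measurable_oneDsqrV.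
apply: (@filterS _ _ (ae_filter_ringOfSetsType mu) _ _ _ generic_slope) => s gen _.
by rewrite -mulr_sumr sum_exit_val1 // mulrC EFinM.
Qed.

Lemma exit_measure_mass : uniq S -> S != [::] ->
  exit_measure setT = (c * (2 * (size S - 1)%:R * pi))%:E.
Proof.
move=> uS S0; rewrite exit_measure_setT /exit_sum big_split /= !sum_exit_mean1 //; [|by right|by left].
by congr (_%:E); ring.
Qed.

End exit_measure.

(** * Laplacians of logarithmic potentials *)

Section linear_combination.
Context d (T : measurableType d) (R : realType) (m : {measure set T -> \bar R}).

Lemma integral_lin2 (f g : T -> R) (a b x y : R) :
  m.-integrable setT (EFin \o f) -> m.-integrable setT (EFin \o g) ->
  (\int[m]_z (f z)%:E = x%:E)%E -> (\int[m]_z (g z)%:E = y%:E)%E ->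
  m.-integrable setT (EFin \o (fun z => a * f z + b * g z)) /\
  (\int[m]_z (a * f z + b * g z)%:E = (a * x + b * y)%:E)%E.
Proof.
move=> fi gi fx gy; have fi' := integrableZl measurableT a fi.
have gi' := integrableZl measurableT b gi.
have E : (fun z => (a * f z + b * g z)%:E) = (fun z => a%:E * (f z)%:E + b%:E * (g z)%:E)%E.
  by apply/funext => z; rewrite EFinD !EFinM.
split; first by rewrite /comp E; exact: integrableD.
by rewrite E integralD // !integralZl //= fx gy EFinD !EFinM.
Qed.

End linear_combination.

Section distributional_laplacian.
Variable R : realType.
Local Notation C := R[i].

Lemma supportedW (A B : R) (phi : R * R -> R) : A <= B -> supported A phi -> supported B phi.
Proof.
move=> AB s z zB; apply: s => -[z1 z2]; apply: zB.
by split; [exact: le_trans z1 AB|exact: le_trans z2 AB].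
Qed.

Lemma test_function_regular (phi : R * R -> R) : test_function phi ->
  [/\ continuous phi, forall y u, derivable phi y u, forall u, continuous (fun y => 'D_u phi y),
    forall w y u, derivable (fun z => 'D_w phi z) y u &
    forall w u, continuous (fun y => 'D_u (fun z => 'D_w phi z) y)].
Proof.
move=> [Hk _]; split.
- exact: (Hk 0%N).
- exact: (Hk 1%N).1.
- by move=> u; exact: ((Hk 1%N).2 u).
- by move=> w; exact: ((Hk 2%N).2 w).1.
- by move=> w u; exact: (((Hk 2%N).2 w).2 u).
Qed.

Lemma log_dist1 (a : C) z : log_dist [:: a] z = ln (cabs (toC z - a)).
Proof.
rewrite /log_dist /= /max_seq /= big_cons big_nil maxxx.
have := cabs_ge0 (toC z - a); rewrite le_eqVlt => /predU1P[<-|h]; last by rewrite lnV ?opprK.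
by rewrite invr0 ln0 // oppr0.
Qed.

Variable phi : R * R -> R.
Hypothesis tphi : test_function phi.

(** The case S = {a}: the cell is the whole plane, no ray exits, and only the point mass remains.
    The square is enlarged by |a| so that it contains a. *)
Lemma integral_ln_laplacian (a : C) :
  (@leb2 R).-integrable setT (EFin \o (fun z : plane R => ln (cabs (toC z - a)) * laplacian phi z)) /\
  (\int[@leb2 R]_z (ln (cabs (toC z - a)) * laplacian phi z)%:E = (2 * pi * phi (ofC a))%:E)%E.
Proof.
have [c0 d1 c1 d2 c2] := test_function_regular tphi.
have [A A1 sphi'] := test_supported tphi.
pose B := A + cabs a; have AB : A <= B by rewrite lerDl cabs_ge0.
have sphi := supportedW AB sphi'; have B1 := le_trans A1 AB.
have SB b : b \in [:: a] -> cabs b <= B.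
  by rewrite inE => /eqP ->; rewrite lerDr (le_trans _ A1).
have E : (fun z : plane R => ln (cabs (toC z - a)) * laplacian phi z) =
   (fun z => log_dist [:: a] z * laplacian phi z).
  by apply/funext => z; rewrite log_dist1.
have u1 : uniq [:: a] by []; have n1 : [:: a] != [::] by [].
split.
  rewrite E; exact: (integrable_log_dist n1 B1 SB
    (@continuous_laplacian _ _ c2) (@supported_laplacian _ _ _ sphi)).
under eq_integral do rewrite -log_dist1.
rewrite (integral_log_dist_laplacian u1 n1 B1 SB sphi d1 c1 d2 c2 c0) big_seq1.
have X0 sg : exit_mean [:: a] a sg phi = 0.
  rewrite /exit_mean integral0_eq // => s _; rewrite /exit_val /inv_exit big_cons big_nil !subrr !mulr0 addr0.
  by rewrite mulr0 mul0r maxxx ltxx mulr0.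
by rewrite !X0 !subr0.
Qed.

Lemma integrable_laplacian :
  (@leb2 R).-integrable setT (EFin \o (laplacian phi : plane R -> R)) /\
  (\int[@leb2 R]_z (laplacian phi z)%:E = 0%:E)%E.
Proof.
have [c0 d1 c1 d2 c2] := test_function_regular tphi.
have [A A1 sphi] := test_supported tphi; have A0 : 0 <= A by rewrite (le_trans _ A1).
split; last exact: (integral_laplacian A0 sphi d1 c1 d2 c2).
exact: (continuous_supported_integrable A0 (@continuous_laplacian _ _ c2)
  (@supported_laplacian _ _ _ sphi)).
Qed.

(** The constant k leaves no trace since Laplacian(phi) has integral 0. It will be log n! over the
    degree for the potentials, and the term in d_t t for Psi. *)
Lemma integral_sum_ln_laplacian (s : seq C) (c k : R) :
  let h (z : plane R) := (c * \sum_(a <- s) ln (cabs (toC z - a)) - k) * laplacian phi z in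
  (@leb2 R).-integrable setT (EFin \o h) /\
  (\int[@leb2 R]_z (h z)%:E = (c * \sum_(a <- s) (2 * pi * phi (ofC a)))%:E)%E.
Proof.
have [li l0] := integrable_laplacian.
have [si s0] := @integral_sum_seq _ _ _ (@leb2 R) _ s
  (fun a z => ln (cabs (toC z - a)) * laplacian phi z) (fun a _ => (integral_ln_laplacian a).1).
have {}s0 : (\int[@leb2 R]_z (\sum_(a <- s) ln (cabs (toC z - a)) * laplacian phi z)%:E =
    (\sum_(a <- s) (2 * pi * phi (ofC a)))%:E)%E.
  by rewrite s0 -sumEFin; apply: eq_bigr => a _; exact: (integral_ln_laplacian a).2.
have [hi h0] := integral_lin2 c (- k) si li s0 l0.
move=> h; rewrite (_ : h = (fun z => c * (\sum_(a <- s) ln (cabs (toC z - a)) * laplacian phi z)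
    + - k * laplacian phi z)).
  by split=> //; rewrite h0 mulr0 addr0.
by apply/funext => z; rewrite /h mulrBl -mulrA mulr_suml mulNr.
Qed.

Variables (P Q T : {poly C}).
Hypotheses (cPQ : coprimep P Q) (P0 : P != 0) (q2 : (2 <= deg Q)%N) (t1 : (1 <= deg T)%N)
  (Qm : Q \is monic) (uQ : uniq (zeros Q)).

Let Q0 : zeros Q != [::].
Proof. by rewrite -size_eq0 size_zeros ?monic_neq0 // -lt0n (leq_trans _ q2). Qed.

(** The factor 1 / (2 pi) of the Laplacian times the factor 1 / (q + t - 1) of Psi. *)
Definition exit_scale : R := (2 * pi * (deg Q + deg T - 1)%N%:R)^-1.

Lemma exit_scale_ge0 : 0 <= exit_scale.
Proof. by rewrite invr_ge0 mulr_ge0 // mulr_ge0 // pi_ge0. Qed.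

Lemma integral_Psi_sum_laplacian :
  (@leb2 R).-integrable setT (EFin \o (fun z : plane R => Psi_sum Q T z * laplacian phi z)) /\
  (\int[@leb2 R]_z (Psi_sum Q T z * laplacian phi z)%:E =
   (2 * pi * exit_sum (zeros Q) exit_scale phi)%:E)%E.
Proof.
have [c0 d1 c1 d2 c2] := test_function_regular tphi.
have [A A1 sphi'] := test_supported tphi.
pose B := Num.max A (zeros_radius Q).
have AB : A <= B by rewrite le_max lexx.
have sphi := supportedW AB sphi'; have B1 := le_trans A1 AB.
have SB b : b \in zeros Q -> cabs b <= B.
  by move=> bQ; rewrite le_max zeros_radius_ge ?orbT.
set D := (deg Q + deg T - 1)%N%:R : R; set k := ln (cabs (lead_coef T) * (deg T)%:R).
have D0 : D != 0 by rewrite pnatr_eq0; move: q2 t1; case: (deg Q) => [//|[//|n]]; rewrite addSn subn1.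
have [si s0] := integral_sum_ln_laplacian (zeros Q) D^-1 (D^-1 * k).
have li := integrable_log_dist Q0 B1 SB
    (@continuous_laplacian _ _ c2) (@supported_laplacian _ _ _ sphi).
have l0 := integral_log_dist_laplacian uQ Q0 B1 SB sphi d1 c1 d2 c2 c0.
have [hi h0] := integral_lin2 1 (- D^-1) si li s0 l0.
have E z : Psi_sum Q T z * laplacian phi z =
   1 * ((D^-1 * \sum_(a <- zeros Q) ln (cabs (toC z - a)) - D^-1 * k) * laplacian phi z)
   + - D^-1 * (log_dist (zeros Q) z * laplacian phi z).
  by rewrite /Psi_sum -/D -/k; ring.
split; first by rewrite (funext E).
under eq_integral do rewrite E.
rewrite h0; congr (_%:E); rewrite /exit_sum /exit_scale -/D.
set X := fun a => exit_mean (zeros Q) a 1 phi + exit_mean (zeros Q) a (-1) phi.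
rewrite (_ : \sum_(a <- zeros Q) (_ - _ - _) =
   \sum_(a <- zeros Q) (2 * pi * phi (ofC a)) - \sum_(a <- zeros Q) X a); last first.
  by rewrite -sumrB; apply: eq_bigr => a _; rewrite /X; ring.
have pi0 : pi != 0 :> R by rewrite gt_eqF // pi_gt0.
move: (\sum_(a <- _) X a) (\sum_(a <- _) _) pi0 => s1 s2; move: pi => c pi0.
by field; rewrite D0 pi0.
Qed.

Lemma distr_laplacian_Psi : distr_laplacian (distr_of_fun (Psi Q T)) phi =
  (2 * pi * exit_sum (zeros Q) exit_scale phi)%:E.
Proof.
have [i <-] := integral_Psi_sum_laplacian; rewrite /distr_laplacian /distr_of_fun.
have E z : toC z \notin zeros Q -> (Psi Q T z * laplacian phi z)%:E = (Psi_sum Q T z * laplacian phi z)%:E.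
  by move=> zQ; rewrite Psi_Psi_sum.
have mi := measurable_int _ i.
apply: ae_eq_integral => //.
  by apply: (measurable_off_finite _ E); exact/measurable_EFinP.
apply: (@filterS _ _ (ae_filter_ringOfSetsType (@leb2 R)) _ _ _ (points_ae (zeros Q))) => z zQ _.
exact: E.
Qed.

End distributional_laplacian.

Section weak_convergence.
Variable R : realType.
Local Notation C := R[i].
Variables (P Q T : {poly C}).
Hypotheses (cPQ : coprimep P Q) (P0 : P != 0) (q2 : (2 <= deg Q)%N) (t1 : (1 <= deg T)%N)
  (Qm : Q \is monic) (uQ : uniq (zeros Q)).

Definition limit_measure : {measure set (plane R) -> \bar R} :=
  exit_measure (zeros Q) (exit_scale_ge0 Q T).

Lemma limit_measure_mass :
  limit_measure setT = (((deg Q)%:R - 1) / ((deg Q)%:R - 1 + (deg T)%:R))%:E.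
Proof.
have sQ : size (zeros Q) = deg Q by rewrite size_zeros ?monic_neq0.
have Q0 : zeros Q != [::] by rewrite -size_eq0 sQ -lt0n (leq_trans _ q2).
have q1 : (1 <= deg Q)%N by exact: leq_trans q2.
rewrite /limit_measure exit_measure_mass // sQ /exit_scale natrB ?(leq_trans q1) ?leq_addr //.
rewrite natrB // natrD.
have h : (deg Q)%:R - 1 + (deg T)%:R != 0 :> R.
  by rewrite gt_eqF // ltr_wpDl ?ltr0n // subr_ge0 ler1n.
have pi0 : pi != 0 :> R by rewrite gt_eqF // pi_gt0.
have -> : (deg Q)%:R + (deg T)%:R - 1 = (deg Q)%:R - 1 + (deg T)%:R :> R by ring.
move: (_ - 1 + _) h => e e0; move: (_ - 1) pi pi0 => x c c0.
by congr (_%:E); field; rewrite e0 c0.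
Qed.

Lemma integral_limit_measure (phi : R * R -> R) : test_function phi ->
  distr_of_measure limit_measure phi = (exit_sum (zeros Q) (exit_scale Q T) phi)%:E.
Proof.
move=> tphi; have [c0 _ _ _ _] := test_function_regular tphi.
have [A A1 sphi] := test_supported tphi; have [M M0 HM] := supported_bounded c0 sphi.
apply: (@integral_exit_measure _ _ _ _ _ M) HM; exact: continuous_plane_measurable.
Qed.

Let U n z := log_mean (deriv_num P Q T n) (toC z) - log_factor P Q T n.

Lemma integral_zero_counting_laplacian (phi : R * R -> R) n : test_function phi ->
  (@leb2 R).-integrable setT (EFin \o (fun z : plane R => U n z * laplacian phi z)) /\
  ((2 * pi)%:E * distr_of_measure (zero_counting_measure (deriv_num P Q T n)) phi =
  \int[@leb2 R]_z (U n z * laplacian phi z)%:E)%E.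
Proof.
move=> tphi; have [c0 _ _ _ _] := test_function_regular tphi.
have [hi h0] := integral_sum_ln_laplacian tphi (zeros (deriv_num P Q T n))
  ((deg (deriv_num P Q T n))%:R^-1) (log_factor P Q T n).
split; first exact: hi.
rewrite /distr_of_measure integral_zero_counting_fin; last exact: continuous_plane_measurable.
by rewrite -EFinM [RHS]h0 -mulr_sumr mulrCA.
Qed.

(** Tested on Laplacian(phi), which is bounded by M and supported in a square, the shifted
    potentials and Psi differ by at most M times their L1 distance on that square; dividing by 2 pi
    returns to the measures. *)
Lemma zero_counting_cvg (phi : R * R -> R) : test_function phi ->
  distr_of_measure (zero_counting_measure (deriv_num P Q T n)) phi @[n --> \oo] -->
    distr_of_measure limit_measure phi.
Proof.
move=> tphi; have [c0 d1 c1 d2 c2] := test_function_regular tphi.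
have [A0 A01 sphi'] := test_supported tphi.
pose A := Num.max A0 (zeros_radius Q).
have AA : A0 <= A by rewrite le_max lexx.
have sphi := supportedW AA sphi'; have A1 := le_trans A01 AA.
have QA := @zeros_radius_ge4 _ Q A.
rewrite le_max lexx orbT in QA; have {}QA := QA isT.
have sL := supported_laplacian sphi.
have cL := continuous_laplacian c2.
have [M M0 HM] := supported_bounded cL sL.
have J0 := log_mean_L1_cvg A1 cPQ P0 q2 t1 Qm uQ QA.
set J := (X in X @ _ --> _) in J0.
have [pi_int piE] := integral_Psi_sum_laplacian tphi q2 t1 Qm uQ.
set r := 2 * pi * _ in piE.
have bound n : exists2 u : R, (\int[@leb2 R]_z (U n z * laplacian phi z)%:E = u%:E)%E &
    (`|u - r|%:E <= M%:E * J n)%E.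
  have [ui _] := integral_zero_counting_laplacian n tphi.
  have ufin := integrable_fin_num measurableT ui.
  exists (fine (\int[@leb2 R]_z (U n z * laplacian phi z)%:E)); first by rewrite fineK.
  rewrite -abse_EFin EFinB fineK // -piE -integralB //.
  apply: (le_trans (le_abse_integral _ _ _)) => //.
    exact: emeasurable_funB (measurable_int _ ui) (measurable_int _ pi_int).
  have E z : `|(U n z * laplacian phi z)%:E - (Psi_sum Q T z * laplacian phi z)%:E|%E =
     (`|(U n z - Psi_sum Q T z)| * `|laplacian phi z|)%:E.
    by rewrite -EFinB /= -mulrBl normrM.
  under eq_integral do rewrite E.
  rewrite (@integral_supported R A); last by move=> z zA; rewrite sL // normr0 mulr0.
  have mD : measurable (square A : set (plane R)) by exact: measurable_square.
  have mUn : measurable_fun setT (U n : plane R -> R).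
    by apply: measurable_funB => //; exact: measurable_log_mean.
  have md : measurable_fun (square A : set (plane R)) (fun z => (`|U n z - Psi_sum Q T z|)%:E).
    apply/measurable_EFinP/measurable_funTS/measurableT_comp => //.
    by apply: measurable_funB => //; exact: measurable_Psi_sum.
  rewrite /J -ge0_integralZl //; last by rewrite lee_fin ltW.
  apply: ge0_le_integral => //.
  - apply/measurable_EFinP/measurable_funTS; apply: measurable_funM.
      by apply: measurableT_comp => //; apply: measurable_funB => //; exact: measurable_Psi_sum.
    by apply: measurableT_comp => //; exact: continuous_plane_measurable.
  - exact: measurable_funeM.
  - by move=> z _; rewrite -EFinM lee_fin mulrC ler_wpM2r.
have Jc : (M%:E * J n)%E @[n --> \oo] --> 0%E.
  by rewrite -(mule0 M%:E); apply: cvgeZl.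
have J_ge0 n : (0 <= M%:E * J n)%E.
  rewrite mule_ge0 ?lee_fin ?(ltW M0) //; apply: integral_ge0 => z _.
  by rewrite lee_fin.
pose v n := ((deg (deriv_num P Q T n))%:R : R)^-1 * \sum_(a <- zeros (deriv_num P Q T n)) phi (ofC a).
have vE n : distr_of_measure (zero_counting_measure (deriv_num P Q T n)) phi = (v n)%:E.
  by rewrite /distr_of_measure integral_zero_counting_fin //; exact: continuous_plane_measurable.
rewrite (integral_limit_measure tphi); under eq_fun do rewrite vE.
apply: cvg_EFin; first exact: nearW.
apply/cvgrPdist_le => e e0; have pi20 : 0 < 2 * pi :> R by rewrite mulr_gt0 // pi_gt0.
have /(ge0_cvge0P J_ge0) /(_ (2 * pi * e)) := Jc.
rewrite mulr_gt0 // => /(_ isT); apply: filterS => n Hn.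
have [u uE] := bound n; move=> /le_trans /(_ Hn); rewrite lee_fin.
have [_ vu] := integral_zero_counting_laplacian n tphi.
move: vu; rewrite uE vE -EFinM => -[<-]; rewrite /r -mulrBr normrM (gtr0_norm pi20).
by rewrite ler_pM2l // distrC.
Qed.

End weak_convergence.

Theorem theorem1 (R : realType) (P Q T : {poly R[i]}) (p q t : nat)
    (coprime_PQ : coprimep P Q) (P_neq0 : P != 0)
    (def_p : p = deg P) (def_q : q = deg Q) (def_t : t = deg T)
    (q_ge2 : (2 <= q)%N) (t_ge1 : (1 <= t)%N)
    (Q_monic : Q \is monic) (Q_simple : uniq (zeros Q)) :
  let mu (n : nat) := zero_counting_measure (deriv_num P Q T n) in
  exists muS : {measure set (plane R) -> \bar R},
  [/\ (muS setT = ((q%:R - 1) / (q%:R - 1 + t%:R))%:E /\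
        forall phi : R * R -> R, test_function phi ->
          distr_of_measure (mu n) phi @[n --> \oo] -->
            distr_of_measure muS phi),
      (forall (a : R[i]) (z : R * R), a \in zeros Q -> toC z \notin zeros Q ->
        interior (voronoi_cell (zeros Q) a) z ->
        log_potential (mu n) z @[n --> \oo] --> +oo%E),
      cvg_L1loc
        (fun n z => (log_potential (mu n) z
           - (ln (n`!%:R) / (n * (q + t - 1) + p)%N%:R)%:E)%E)
        (fun z => (Psi Q T z)%:E) &
      (forall phi : R * R -> R, test_function phi ->
         distr_of_measure muS phi =
         (((2 * pi)^-1)%:E * distr_laplacian (distr_of_fun (Psi Q T)) phi)%E)].
Proof.
subst p q t => mu; exists (limit_measure Q T); split.
- split; first exact: limit_measure_mass.
  by move=> phi tphi; exact: zero_counting_cvg.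
- by move=> a z aQ zQ Hz; exact: (potential_diverges coprime_PQ P_neq0 q_ge2 t_ge1 Q_monic Q_simple aQ).
- exact: shifted_potential_cvg_L1loc.
- move=> phi tphi; rewrite integral_limit_measure // distr_laplacian_Psi //.
  by rewrite -EFinM mulrA mulVf ?mul1r // gt_eqF // mulr_gt0 // pi_gt0.
Qed.
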